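(* Let $\Phi$ be a strictly plurisubharmonic quadratic form on $\mathbb{C}^n$, let $\kappa:\mathbb{C}^{2n}\to\mathbb{C}^{2n}$ be a complex linear canonical transformation that is positive relative to $\Lambda_\Phi$, and let $\tilde\Phi$ be the strictly plurisubharmonic quadratic form on $\mathbb{C}^n$ with $\kappa(\Lambda_\Phi)=\Lambda_{\tilde\Phi}$ (which satisfies $\tilde\Phi\le\Phi$). Let $\kappa^\flat:\mathbb{C}^n\to\mathbb{C}^n$ be the $\mathbb{R}$-linear isomorphism $$\kappa^\flat=\mathrm{pr}_{\tilde\Phi}\circ\kappa\circ\mathrm{pr}_\Phi^{-1},$$ where $\mathrm{pr}_\Phi$ and $\mathrm{pr}_{\tilde\Phi}$ are the restrictions of $\pi_1:(z,\zeta)\mapsto z$ to $\Lambda_\Phi$ and $\Lambda_{\tilde\Phi}$. If $G$ is a metaplectic Fourier integral operator quantizing $\kappa$, realized as a continuous linear transformation from $H^{-\infty}_\Phi(\mathbb{C}^n)$ to itself, then for every $u\in H^{-\infty}_\Phi(\mathbb{C}^n)$, $$\mathrm{WF}^{1/2}_\Phi(Gu)\subset\kappa^\flat\big(\mathrm{WF}^{1/2}_\Phi(u)\big)\cap\mathrm{Rad}(\Phi-\tilde\Phi).$$ If, in addition, $G$ is non-zero and $\kappa(\Lambda_\Phi\cap\Lambda_{\tilde\Phi})=\Lambda_\Phi\cap\Lambda_{\tilde\Phi}$, then for every $u\in H^{-\infty}_\Phi(\mathbb{C}^n)$, $$\mathrm{WF}^{1/2}_\Phi(Gu)=\kappa^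\flat\big(\mathrm{WF}^{1/2}_\Phi(u)\big)\cap\mathrm{Rad}(\Phi-\tilde\Phi).$$
   Context: **Basic notions.** A real quadratic form $\Phi$ on $\mathbb{C}^n$ is strictly plurisubharmonic if $\partial^2_{\overline zz}\Phi$ is Hermitian positive definite. $\Lambda_\Phi=\{(z,\frac2i\partial_z\Phi(z)):z\in\mathbb{C}^n\}\subset\mathbb{C}^{2n}$, a maximally totally real subspace. $\sigma=d\zeta\wedge dz$ is the complex symplectic form on $\mathbb{C}^{2n}=\mathbb{C}^n_z\times\mathbb{C}^n_\zeta$; a complex linear canonical transformation is a $\mathbb{C}$-linear $\kappa$ with $\kappa^*\sigma=\sigma$. The radical of a non-negative quadratic form $P$ is its zero set $\mathrm{Rad}(P)=\{P=0\}$. **Positivity.** Let $\iota_{\Lambda_\Phi}$ be the unique antilinear involution of $\mathbb{C}^{2n}$ fixing $\Lambda_\Phi$ pointwise. $\kappa$ is positive relative to $\Lambda_\Phi$ if $\frac1i\big(\sigma(\kappa(X),\iota_{\Lambda_\Phi}\kappa(X))-\sigma(X,\iota_{\Lambda_\Phi}X)\big)\ge0$ for all $X\in\mathbb{C}^{2n}$. It is known that this holds if and only if $\kappa(\Lambda_\Phi)=\Lambda_{\tilde\Phi}$ for some strictly plurisubharmonic quadratic form $\tilde\Phi\le\Phi$. **Spaces.** $H^s_\Phi(\mathbb{C}^n)=\{u\in\mathrm{Hol}(\mathbb{C}^n):\int_{\mathbb{C}^n}|u(z)|^2\langle z\rangle^{2s}e^{-2\Phi(z)}L(dz)<\infty\}$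 with its Hilbert norm, $\langle z\rangle=(1+|z|^2)^{1/2}$, $L(dz)$ Lebesgue measure; $H_\Phi=H^0_\Phi$; $H^{-\infty}_\Phi(\mathbb{C}^n)=\bigcup_{s\in\mathbb{R}}H^s_\Phi(\mathbb{C}^n)$ with the (locally convex) inductive limit topology. **Relative wavefront set.** For $u\in H^{-\infty}_\Phi(\mathbb{C}^n)$, $\mathrm{WF}^{1/2}_\Phi(u)$ is the complement in $\mathbb{C}^n\setminus\{0\}$ of the set of points $z_0\in\mathbb{C}^n\setminus\{0\}$ for which there exist an open conic (invariant under multiplication by positive reals) neighborhood $V$ of $z_0$ in $\mathbb{C}^n\setminus\{0\}$ and $C,c>0$ with $|u(z)|\le Ce^{\Phi(z)-c|z|^2}$ for all $z\in V$. **Metaplectic Fourier integral operators.** A metaplectic Fourier integral operator is an operator formally given by $Gu(z)=a\iint e^{i\phi(z,w,\theta)}u(w)\,dw\wedge d\theta$, where $a\in\mathbb{C}$ and $\phi$ is a holomorphic quadratic form on $\mathbb{C}^n_z\times\mathbb{C}^n_w\times\mathbb{C}^N_\theta$ that is non-degenerate: $d\partial_{\theta_1}\phi,\dots,d\partial_{\theta_N}\phi$ are linearly independent over $\mathbb{C}$. It quantizes $\kappa$ if the relation $(w,-\partial_w\phi(z,w,\theta))\mapsto(z,\partial_z\phi(z,w,\theta))$, taken over $\partial_\theta\phi(z,w,\theta)=0$, is the graph of the complex linear canonical transformation $\kappa$. If $\kappa(\Lambda_{\Phi_2})=\Lambda_{\Phi_1}$ with $\Phi_1,\Phi_2$ strictly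 plurisubharmonic quadratic forms, then $G$ is realized as a bounded operator $H_{\Phi_2}(\mathbb{C}^n)\to H_{\Phi_1}(\mathbb{C}^n)$ by integrating over a suitable (good, in Sjöstrand's sense) smooth $(n+N)$-real-dimensional contour in $\mathbb{C}^{n+N}_{w,\theta}$ depending smoothly on $z$. It is known that this realization can be written uniquely in Bergman form $$Gu(z)=\hat a\int_{\mathbb{C}^n}e^{2\Psi(z,\overline w)}u(w)e^{-2\Phi_2(w)}\,L(dw),$$ where $\hat a\in\mathbb{C}$ and $\Psi$ is a holomorphic quadratic form on $\mathbb{C}^{2n}$, depending only on $\kappa,\Phi_1,\Phi_2$, such that, with $\Psi_2$ the polarization of $\Phi_2$ (the holomorphic quadratic form with $\Psi_2(z,\overline z)=\Phi_2(z)$), the phase $\frac2i\Psi(z,\theta)-\frac2i\Psi_2(w,\theta)$ is non-degenerate and generates $\kappa$, i.e. the relation $(w,\frac2i\partial_w\Psi_2(w,\theta))\mapsto(z,\frac2i\partial_z\Psi(z,\theta))$, taken over $\partial_\theta\Psi(z,\theta)=\partial_\theta\Psi_2(w,\theta)$, is the graph of $\kappa$, and $c|z-\kappa^\flat(w)|^2\le\Phi_1(z)+\Phi_2(w)-2\operatorname{Re}\Psi(z,\overline w)\le C|z-\kappa^\flat(w)|^2$ for some $C,c>0$, with $\kappa^\flat=\pi_1|_{\Lambda_{\Phi_1}}\circ\kappa\circ(\pi_1|_{\Lambda_{\Phi_2}})^{-1}$. By the same formula $G$ extends uniquely to a continuous map $H^{-\infty}_{\Phi_2}(\mathbb{C}^n)\to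 H^{-\infty}_{\Phi_1}(\mathbb{C}^n)$. In the claim this is used with $\Phi_2=\Phi$, $\Phi_1=\tilde\Phi$, composed with the continuous inclusion $H^{-\infty}_{\tilde\Phi}\hookrightarrow H^{-\infty}_\Phi$. *)

(* Defs.v *)
From HB Require Import structures.
From mathcomp Require Import all_boot all_order all_algebra.
From mathcomp Require Import complex.
From mathcomp Require Import all_classical all_reals all_analysis.

Set Implicit Arguments.
Unset Strict Implicit.
Unset Printing Implicit Defensive.

Import Order.TTheory GRing.Theory Num.Theory.
Import numFieldNormedType.Exports.

Local Open Scope classical_set_scope.
Local Open Scope ring_scope.
Local Open Scope complex_scope.

(* The usual topology of the complex plane.  R[i] cannot also carry the
   R[i]-normed module structure, since the library already makes it an
   R-module; functions that are differentiated are therefore given the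
   codomain R[i]^o. *)
HB.instance Definition _ (R : realType) := PseudoMetric.copy R[i] R[i]^o.
HB.instance Definition _ (R : realType) := Pointed.copy R[i] R[i]^o.

Section LebesgueRn.
Variable R : realType.

Definition tcons n (p : measurableTypeR R * n.-tuple (measurableTypeR R)) :
  n.+1.-tuple (measurableTypeR R) := [the _.-tuple _ of p.1 :: p.2].

Lemma measurable_tcons n : measurable_fun [set: _] (@tcons n).
Proof. exact: measurable_cons measurable_fst measurable_snd. Qed.

Section Step.
Variables (n : nat)
  (mu : {sigma_finite_measure set (n.-tuple (measurableTypeR R)) -> \bar R}).

Definition leb_step : set (n.+1.-tuple (measurableTypeR R)) -> \bar R :=
  pushforward (lebesgue_measure \x mu)%E (@tcons n).

Let leb_step0 : leb_step set0 = 0%E.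
Proof. by rewrite /leb_step /pushforward preimage_set0 measure0. Qed.

Let leb_step_ge0 A : (0 <= leb_step A)%E.
Proof. by rewrite /leb_step /pushforward; exact: measure_ge0. Qed.

Let leb_step_sigma_additive : semi_sigma_additive leb_step.
Proof.
move=> F mF tF mUF; rewrite /leb_step /pushforward preimage_bigcup.
have mpre A : measurable A -> measurable (@tcons n @^-1` A).
  by move=> mA; rewrite -[X in measurable X]setTI; exact: measurable_tcons.
apply: measure_semi_sigma_additive.
- by move=> k; exact: mpre.
- apply/trivIsetP => /= i j _ _ ij; rewrite -preimage_setI.
  by move/trivIsetP : tF => /(_ _ _ _ _ ij) ->//; rewrite preimage_set0.
- by rewrite -preimage_bigcup; exact: mpre.
Qed.

HB.instance Definition _ := isMeasure.Build _ _ _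
  leb_step leb_step0 leb_step_ge0 leb_step_sigma_additive.

Let leb_step_sigma_finite : sigma_finite setT leb_step.
Proof.
have /sigma_finiteP[F [FT ndF Foo]] := sigma_finiteT (@lebesgue_measure R).
have /sigma_finiteP[G [GT ndG Goo]] := sigma_finiteT mu.
pose unc (t : n.+1.-tuple (measurableTypeR R)) :
    measurableTypeR R * n.-tuple (measurableTypeR R) :=
  (thead t, [tuple of behead t]).
have consK : cancel (@tcons n) unc.
  by case=> x t; congr pair; apply/val_inj.
have munc : measurable_fun setT unc.
  apply: measurable_fun_pair; last exact: measurable_behead.
  exact: measurable_tnth.
exists (fun k => unc @^-1` (F k `*` G k)).
  apply/esym; rewrite -subTset => t _.
  have [i _ Fi] : (\bigcup_k F k) (unc t).1 by rewrite -FT.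
  have [j _ Gj] : (\bigcup_k G k) (unc t).2 by rewrite -GT.
  exists (maxn i j) => //; split.
  - by move: Fi; exact/subsetPset/ndF/leq_maxl.
  - by move: Gj; exact/subsetPset/ndG/leq_maxr.
move=> k; have [mFk Fk] := Foo k; have [mGk Gk] := Goo k; split.
  by rewrite -[X in measurable X]setTI; apply: munc => //; exact: measurableX.
rewrite /leb_step /pushforward -comp_preimage.
rewrite (_ : unc \o @tcons n = id); last by apply/funext => p /=; rewrite consK.
by rewrite preimage_id product_measure1E// lte_mul_pinfty// ge0_fin_numE.
Qed.

HB.instance Definition _ := Measure_isSigmaFinite.Build _ _ _
  leb_step leb_step_sigma_finite.

End Step.

Fixpoint leb n :
    {sigma_finite_measure set (n.-tuple (measurableTypeR R)) -> \bar R} :=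
  match n return
    {sigma_finite_measure set (n.-tuple (measurableTypeR R)) -> \bar R} with
  | 0 => dirac [tuple]
  | m.+1 => leb_step (leb m)
  end.

End LebesgueRn.

Section Definitions.
Variable R : realType.
Local Notation C := R[i].
Local Notation "''C^' n" := 'rV[R[i]]_n (at level 0, n at level 2).

Definition cvec n (p : n.-tuple R * n.-tuple R) : 'C^n :=
  \row_j (tnth p.1 j +i* tnth p.2 j).

Definition rvec n (t : n.-tuple R) : 'C^n := \row_j (tnth t j)%:C.

Definition sqnorm n (z : 'C^n) : R := \sum_j Normc.normc (z 0 j) ^+ 2.

Definition japanese n (z : 'C^n) : R := Num.sqrt (1 + sqnorm z).

Definition conjv n (z : 'C^n) : 'C^n := map_mx Num.conj z.

Definition cexp (z : C) : C :=
  (expR (complex.Re z))%:C * (cos (complex.Im z) +i* sin (complex.Im z)).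

Definition lebC n :
    {measure set (n.-tuple (measurableTypeR R) * n.-tuple (measurableTypeR R))
       -> \bar R} :=
  (leb R n \x leb R n)%E.

Definition Cintegral d (T : measurableType d) (mu : {measure set T -> \bar R})
    (f : T -> C) : C :=
  Rintegral mu setT (fun x => complex.Re (f x))
    +i* Rintegral mu setT (fun x => complex.Im (f x)).

Definition gradC n (f : 'C^n -> C) (z : 'C^n) : 'C^n :=
  \row_j 'D_(delta_mx 0 j) (f : _ -> C^o) z.

Definition dreal n (f : 'C^n -> C) (v z : 'C^n) : C :=
  derive1 (fun t : R => complex.Re (f (z + t%:C *: v))) 0
    +i* derive1 (fun t : R => complex.Im (f (z + t%:C *: v))) 0.

Definition dz n (f : 'C^n -> C) (j : 'I_n) (z : 'C^n) : C :=
  2^-1 * (dreal f (delta_mx 0 j) z - 'i * dreal f ('i *: delta_mx 0 j) z).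

Definition dzbar n (f : 'C^n -> C) (j : 'I_n) (z : 'C^n) : C :=
  2^-1 * (dreal f (delta_mx 0 j) z + 'i * dreal f ('i *: delta_mx 0 j) z).

Definition grad_z n (Phi : 'C^n -> R) (z : 'C^n) : 'C^n :=
  \row_j dz (fun y => (Phi y)%:C) j z.

Definition levi n (Phi : 'C^n -> R) (z : 'C^n) : 'M[C]_n :=
  \matrix_(j, k) dzbar (dz (fun y => (Phi y)%:C) k) j z.

Definition real_quadratic n (Phi : 'C^n -> R) :=
  exists S : 'M[R]_(n + n), forall z : 'C^n,
    let x := row_mx (map_mx (@complex.Re R) z) (map_mx (@complex.Im R) z) in
    Phi z = (x *m S *m x^T) 0 0.

Definition hol_quadratic m (q : 'C^m -> C) :=
  exists A : 'M[C]_m, forall x, q x = (x *m A *m x^T) 0 0.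

Definition hol_quadratic2 n (Psi : 'C^n -> 'C^n -> C) :=
  hol_quadratic (fun x : 'C^(n + n) => Psi (lsubmx x) (rsubmx x)).

Definition hol_quadratic3 n N (phi : 'C^n -> 'C^n -> 'C^N -> C) :=
  hol_quadratic (fun x : 'C^(n + n + N) =>
    phi (lsubmx (lsubmx x)) (rsubmx (lsubmx x)) (rsubmx x)).

Definition pos_def n (A : 'M[C]_n) :=
  A \is hermsymmx /\
  forall v : 'C^n, v != 0 -> 0 < (conjv v *m A *m v^T) 0 0.

Definition strictly_psh n (Phi : 'C^n -> R) :=
  real_quadratic Phi /\ forall z, pos_def (levi Phi z).

Definition polarization n (Psi : 'C^n -> 'C^n -> C) (Phi : 'C^n -> R) :=
  hol_quadratic2 Psi /\ forall z, Psi z (conjv z) = (Phi z)%:C.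

Definition radical n (P : 'C^n -> R) : set 'C^n := [set z | P z = 0].

Definition lift_Lambda n (Phi : 'C^n -> R) (z : 'C^n) : 'C^n * 'C^n :=
  (z, (2 / 'i) *: grad_z Phi z).

Definition Lambda n (Phi : 'C^n -> R) : set ('C^n * 'C^n) :=
  range (lift_Lambda Phi).

(* The form dzeta /\ dz, with X = (z, zeta). *)
Definition sigma n (X Y : 'C^n * 'C^n) : C :=
  \sum_j (X.2 0 j * Y.1 0 j - Y.2 0 j * X.1 0 j).

Definition canonical_transformation n (kappa : 'C^n * 'C^n -> 'C^n * 'C^n) :=
  forall X Y, sigma (kappa X) (kappa Y) = sigma X Y.

Definition antilinear_involution_fixing n (L : set ('C^n * 'C^n))
    (iota : 'C^n * 'C^n -> 'C^n * 'C^n) :=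
  [/\ forall (a : C) X Y, iota (a *: X + Y) = Num.conj a *: iota X + iota Y,
      involutive iota
    & forall X, L X -> iota X = X].

(* The order on C makes this say that the left-hand side is real and >= 0. *)
Definition positive_rel n (Phi : 'C^n -> R)
    (kappa : 'C^n * 'C^n -> 'C^n * 'C^n) :=
  exists iota, antilinear_involution_fixing (Lambda Phi) iota /\
    forall X, 0 <= 'i^-1 *
      (sigma (kappa X) (iota (kappa X)) - sigma X (iota X)).

(* (pi_1 on Lambda_Phi1) o kappa o (pi_1 on Lambda_Phi)^-1; the target weight
   Phi1, with kappa (Lambda Phi) = Lambda Phi1, does not enter the formula. *)
Definition kappa_flat n (Phi : 'C^n -> R)
    (kappa : 'C^n * 'C^n -> 'C^n * 'C^n) (w : 'C^n) : 'C^n :=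
  (kappa (lift_Lambda Phi w)).1.

Definition holomorphic n (u : 'C^n -> C) :=
  forall z, differentiable (u : _ -> C^o) z.

Definition wsqnorm n (Phi : 'C^n -> R) (s : R) (u : 'C^n -> C) : \bar R :=
  (\int[@lebC n]_p (let z := cvec p in
     Normc.normc (u z) ^+ 2 * japanese z `^ (2 * s)
       * expR (- (2 * Phi z)))%:E)%E.

Definition Hs n (Phi : 'C^n -> R) (s : R) : set ('C^n -> C) :=
  [set u | holomorphic u /\ (wsqnorm Phi s u < +oo)%E].

Definition Hnorm n (Phi : 'C^n -> R) (s : R) (u : 'C^n -> C) : R :=
  Num.sqrt (fine (wsqnorm Phi s u)).

Definition Hinf n (Phi : 'C^n -> R) : set ('C^n -> C) :=
  [set u | exists s, Hs Phi s u].

(* Continuous seminorms of the locally convex inductive limit topology on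
   Hinf Phi: the seminorms whose restriction to every Hs Phi s is continuous. *)
Definition Hinf_seminorm n (Phi : 'C^n -> R) (p : ('C^n -> C) -> R) :=
  [/\ forall u v, Hinf Phi u -> Hinf Phi v ->
        p (fun z => u z + v z) <= p u + p v,
      forall (a : C) u, Hinf Phi u ->
        p (fun z => a * u z) = Normc.normc a * p u
    & forall s, exists M : R, forall u, Hs Phi s u -> p u <= M * Hnorm Phi s u].

Definition continuous_linear_on_Hinf n (Phi : 'C^n -> R)
    (G : ('C^n -> C) -> ('C^n -> C)) :=
  [/\ forall u, Hinf Phi u -> Hinf Phi (G u),
      forall (a : C) u v, Hinf Phi u -> Hinf Phi v ->
        G (fun z => a * u z + v z) = (fun z => a * G u z + G v z)
    & forall p, Hinf_seminorm Phi p -> Hinf_seminorm Phi (fun u => p (G u))].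

Definition conic n (V : set 'C^n) :=
  forall (t : R) z, 0 < t -> V z -> V (t%:C *: z).

Definition WF n (Phi : 'C^n -> R) (u : 'C^n -> C) : set 'C^n :=
  [set z0 | z0 != 0 /\
    ~ exists V : set 'C^n,
        [/\ open V, conic V, ~ V 0, V z0
          & exists K c : R, [/\ 0 < K, 0 < c & forall z, V z ->
              Normc.normc (u z) <= K * expR (Phi z - c * sqnorm z)]]].

Definition dtheta n N (phi : 'C^n -> 'C^n -> 'C^N -> C) (j : 'I_N)
    (X : 'C^n * 'C^n * 'C^N) : C^o :=
  gradC (phi X.1.1 X.1.2) X.2 0 j.

Definition nondegenerate_phase n N (phi : 'C^n -> 'C^n -> 'C^N -> C) :=
  forall (X : 'C^n * 'C^n * 'C^N) (c : 'C^N),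
    (forall V, \sum_j c 0 j * 'd (dtheta phi j) X V = 0) -> c = 0.

Definition generates n N (phi : 'C^n -> 'C^n -> 'C^N -> C)
    (kappa : 'C^n * 'C^n -> 'C^n * 'C^n) :=
  [set XY | exists z w theta, gradC (phi z w) theta = 0 /\
     XY = ((w, - gradC (fun w' => phi z w' theta) w),
           (z, gradC (fun z' => phi z' w theta) z))]
  = [set XY | XY.2 = kappa XY.1].

Definition contour_w n N (wc : 'C^n -> 'C^n) (L : 'M[C]_(n + N))
    (z : 'C^n) (t : (n + N).-tuple R) : 'C^n :=
  wc z + lsubmx (rvec t *m L).

Definition contour_theta n N (tc : 'C^n -> 'C^N) (L : 'M[C]_(n + N))
    (z : 'C^n) (t : (n + N).-tuple R) : 'C^N :=
  tc z + rsubmx (rvec t *m L).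

(* The contour z |-> { (wc z, tc z) + t *m L : t in R^(n+N) } is good: it passes
   through the critical point of (w, theta) |-> - Im phi (z, w, theta) + Phi2 w,
   and this function stays below its critical value Phi1 z minus a positive
   definite quadratic form along it. *)
Definition good_contour n N (phi : 'C^n -> 'C^n -> 'C^N -> C)
    (Phi1 Phi2 : 'C^n -> R)
    (wc : 'C^n -> 'C^n) (tc : 'C^n -> 'C^N) (L : 'M[C]_(n + N)) :=
  (forall z, gradC (phi z (wc z)) (tc z) = 0 /\
     - gradC (fun w => phi z w (tc z)) (wc z)
       = (2 / 'i) *: grad_z Phi2 (wc z)) /\
  exists2 c : R, 0 < c & forall z t,
    let w := contour_w wc L z t in
    let theta := contour_theta tc L z t in
    - complex.Im (phi z w theta) + Phi2 w
      <= Phi1 z - c * \sum_j tnth t j ^+ 2.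

(* G u (z) = a * iint e^{i phi(z,w,theta)} u(w) dw /\ dtheta on H_Phi2, over a
   good contour; dw /\ dtheta pulls back to \det L dt. *)
Definition contour_realization n (Phi1 Phi2 : 'C^n -> R)
    (kappa : 'C^n * 'C^n -> 'C^n * 'C^n) (G : ('C^n -> C) -> ('C^n -> C)) :=
  exists (N : nat) (phi : 'C^n -> 'C^n -> 'C^N -> C) (a : C)
         (wc : 'C^n -> 'C^n) (tc : 'C^n -> 'C^N) (L : 'M[C]_(n + N)),
    [/\ hol_quadratic3 phi, nondegenerate_phase phi, generates phi kappa,
        good_contour phi Phi1 Phi2 wc tc L
      & forall u, Hs Phi2 0 u -> forall z,
          G u z = a * Cintegral (leb R (n + N)) (fun t =>
            let w := contour_w wc L z t in
            let theta := contour_theta tc L z t in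
            cexp ('i * phi z w theta) * u w * \det L)].

(* The Bergman form of G; H_Phi2 is dense in Hinf Phi2, and it is this absolutely
   convergent integral that extends G from the former to the latter. *)
Definition bergman_realization n (Phi1 Phi2 : 'C^n -> R)
    (kappa : 'C^n * 'C^n -> 'C^n * 'C^n) (G : ('C^n -> C) -> ('C^n -> C)) :=
  exists (a : C) (Psi Psi2 : 'C^n -> 'C^n -> C),
    let phase z w theta := 2 / 'i * Psi z theta - 2 / 'i * Psi2 w theta in
    [/\ hol_quadratic2 Psi /\ polarization Psi2 Phi2,
        nondegenerate_phase phase, generates phase kappa,
        exists c K : R, [/\ 0 < c, 0 < K & forall z w,
          c * sqnorm (z - kappa_flat Phi2 kappa w)
            <= Phi1 z + Phi2 w - 2 * complex.Re (Psi z (conjv w))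
            <= K * sqnorm (z - kappa_flat Phi2 kappa w)]
      & forall u, Hinf Phi2 u -> forall z,
          G u z = a * Cintegral (@lebC n) (fun p =>
            let w := cvec p in
            cexp (2 * Psi z (conjv w)) * u w * (expR (- (2 * Phi2 w)))%:C)].

(* G is a metaplectic Fourier integral operator quantizing kappa, where
   kappa (Lambda Phi) = Lambda Phi1, realized as a continuous linear map of
   Hinf Phi into itself. *)
Definition metaplectic_FIO n (Phi1 Phi : 'C^n -> R)
    (kappa : 'C^n * 'C^n -> 'C^n * 'C^n) (G : ('C^n -> C) -> ('C^n -> C)) :=
  [/\ contour_realization Phi1 Phi kappa G,
      bergman_realization Phi1 Phi kappa G
    & continuous_linear_on_Hinf Phi G].

End Definitions.

(* Main.v *)
Require Import Defs.
From HB Require Import structures.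
From mathcomp Require Import all_boot all_order all_algebra.
From mathcomp Require Import complex.
From mathcomp Require Import all_classical all_reals all_analysis.
From mathcomp Require Import measurable_realfun ring lra.

Set Implicit Arguments.
Unset Strict Implicit.
Unset Printing Implicit Defensive.

Import Order.TTheory GRing.Theory Num.Theory.
Import numFieldNormedType.Exports.

Local Open Scope classical_set_scope.
Local Open Scope ring_scope.
Local Open Scope complex_scope.

(** Write Phi z = b z z, Phit z = bt z z and L = kappa^flat, and let T be the
    Bergman form of G without its scalar factor a, so that G = a T.  The bounds
    on the phase say that exp(- Phit z) |exp(2 Psi(z, conj w))| exp(- Phi w) is
    at most exp(- c |z - L w|^2): relative to the two weights, the kernel is
    concentrated along the graph of the real linear isomorphism L.

    Inclusion.  Scaling shows that a kernel concentrated along the graph of L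
    carries Gaussian decay of exp(- Phi) u in a cone about w0 to Gaussian decay
    of exp(- Phit) T u in a cone about L w0 (kernel_cone_decay), and it always
    gives exp(- Phit) |T u| <= K exp(eps |z|^2) for every eps > 0
    (kernel_subgaussian_bound).  Positivity of kappa implies Phit <= Phi
    (positive_le).  Hence the wavefront set of G u lies in the image of that of u
    by the first fact, and in the radical of Phi - Phit by the second, since
    exp(Phit - Phi) is a decaying Gaussian in a cone about every other point
    (decays_gap).

    Equality.  T has an explicit left inverse: integrating T u against
    conj(exp(2 Psi(z, conj w))) exp(- 2 Phit z) gives a positive multiple
    of u at w (transform_inversion).  This kernel is again concentrated along the
    graph of L, read from z to w, so decay of exp(- Phit) T u about L w0 gives
    decay of exp(- Phi) u about w0 (transform_decays_inv).  At a point of the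
    radical, decay relative to Phi implies decay relative to Phit in a thinner
    cone, because exp(Phi - Phit) grows slower there than any given Gaussian
    (decays_null).  Finally a != 0 as soon as G is non-zero.

    Inversion.  The non-negative form Phit z + Phi w - 2 Re Psi(z, conj w)
    vanishes on the graph of L, hence is stationary there, which expresses the
    part of Psi mixing z and w through one positive definite form (Re_phm).
    The integral over z in the composition is then a Gaussian integral with a
    complex linear term, equal to a positive constant times the Bergman kernel
    exp(2 pol w w') of the weight Phi (completed_square, gauss_complex), and
    this kernel reproduces holomorphic functions (bergman_reproducing).  The
    Gaussian integral and the reproducing property both follow from one
    principle (rotation_mean): if the measure on pairs of vectors is rotation
    invariant, and the integrand restricts on the orbit circle of each point to
    the boundary value of an entire function, then the integrand may be
    replaced by the values of these functions at the origin.  This is the mean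
    value property on circles (circle_mean_Re), which comes from Goursat's
    lemma on squares. *)


(** * Goursat's lemma and the mean value property of entire functions *)

Section Goursat.
Variable R : realType.

(** Goursat's bisection: one of the four quarters of a square carries at least
    a quarter of |F|, and so on; at the common point of the nested squares this
    contradicts the local bound, which is o of the area. *)
Lemma bisection_vanish (F : R -> R -> R -> R) :
  (forall a b l, 0 < l ->
     F a b l = F a b (l / 2) + F (a + l / 2) b (l / 2)
             + (F a (b + l / 2) (l / 2) + F (a + l / 2) (b + l / 2) (l / 2))) ->
  (forall p q eps, 0 < eps -> exists2 del : R, 0 < del &
     forall a b l, 0 < l -> l < del -> a <= p <= a + l -> b <= q <= b + l ->
       `|F a b l| <= eps * l ^+ 2) ->
  forall a b l, 0 < l -> F a b l = 0.
Proof.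
move=> Fadd Floc a0 b0 l0 l0_gt0; apply/eqP/negPn/negP => F0.
have pick a b l : exists ab : R * R, 0 < l ->
    [/\ ab.1 = a \/ ab.1 = a + l / 2, ab.2 = b \/ ab.2 = b + l / 2
      & `|F a b l| / 4 <= `|F ab.1 ab.2 (l / 2)|].
  have [l_gt0|_] := ltP 0 l; last by exists (a, b).
  have [h|h1] := leP (`|F a b l| / 4) `|F a b (l / 2)|.
    by exists (a, b) => _; split=> //; left.
  have [h|h2] := leP (`|F a b l| / 4) `|F (a + l / 2) b (l / 2)|.
    by exists (a + l / 2, b) => _; split=> //=; [right|left].
  have [h|h3] := leP (`|F a b l| / 4) `|F a (b + l / 2) (l / 2)|.
    by exists (a, b + l / 2) => _; split=> //=; [left|right].
  exists (a + l / 2, b + l / 2) => _; split=> /=; [by right|by right|].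
  have : `|F a b l| <= `|F a b (l / 2)| + `|F (a + l / 2) b (l / 2)|
      + (`|F a (b + l / 2) (l / 2)| + `|F (a + l / 2) (b + l / 2) (l / 2)|).
    rewrite Fadd//; apply: le_trans (ler_normD _ _) _.
    by apply: lerD; exact: ler_normD.
  by move: h1 h2 h3; lra.
pose next a b l := projT1 (cid (pick a b l)).
have nextP a b l : 0 < l ->
    [/\ (next a b l).1 = a \/ (next a b l).1 = a + l / 2,
        (next a b l).2 = b \/ (next a b l).2 = b + l / 2
      & `|F a b l| / 4 <= `|F (next a b l).1 (next a b l).2 (l / 2)|].
  by rewrite /next; case: (cid _).
pose lk k := l0 / 2 ^+ k.
pose ab := fix ab k := if k is k'.+1 then next (ab k').1 (ab k').2 (lk k')
                       else (a0, b0).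
have lk_gt0 k : 0 < lk k by rewrite divr_gt0// exprn_gt0.
have lkS k : lk k.+1 = lk k / 2 by rewrite /lk exprS invfM mulrA mulrAC.
have abE k : `|F a0 b0 l0| / 4 ^+ k <= `|F (ab k).1 (ab k).2 (lk k)|.
  elim: k => [|k IH]; first by rewrite expr0 divr1 /lk expr0 divr1.
  have [_ _ h] := nextP (ab k).1 (ab k).2 (lk k) (lk_gt0 k).
  rewrite lkS; apply: le_trans h; rewrite exprS invfM mulrCA.
  by rewrite mulrC ler_wpM2r// invr_ge0.
(* Either coordinate of the corners increases to a common point of the intervals. *)
have mono (x : nat -> R) : (forall k, x k.+1 = x k \/ x k.+1 = x k + lk k / 2) ->
    exists p, forall k, x k <= p <= x k + lk k.
  move=> xS.
  have nd : {homo x : m n / (m <= n)%N >-> m <= n}.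
    apply: homo_leq => //; first by move=> ? ? ?; exact: le_trans.
    move=> k; have := lk_gt0 k; case: (xS k) => ->; lra.
  have ni : {homo (fun k => x k + lk k) : m n / (m <= n)%N >-> n <= m}.
    apply: homo_leq => //; first by move=> y z t h1 h2; exact: le_trans h2 h1.
    move=> k; have := lk_gt0 k; rewrite lkS; case: (xS k) => ->; lra.
  have ub m k : x m <= x k + lk k.
    have [mk|/ltnW km] := leqP m k.
      by apply: le_trans (nd _ _ mk) _; rewrite lerDl ltW.
    by apply: le_trans (ni _ _ km); rewrite lerDl ltW.
  exists (sup (range x)) => k; apply/andP; split.
    apply: ub_le_sup; last by exists k.
    by exists (x 0%N + lk 0%N) => _ [m _ <-].
  apply: ge_sup; first by exists (x 0%N), 0%N.
  by move=> _ [m _ <-].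
have [p Hp] : exists p, forall k, (ab k).1 <= p <= (ab k).1 + lk k.
  by apply: (mono (fun k => (ab k).1)) => k /=; case: (nextP (ab k).1 (ab k).2 (lk k)).
have [q Hq] : exists q, forall k, (ab k).2 <= q <= (ab k).2 + lk k.
  by apply: (mono (fun k => (ab k).2)) => k /=; case: (nextP (ab k).1 (ab k).2 (lk k)).
have eps_gt0 : 0 < `|F a0 b0 l0| / l0 ^+ 2 / 2.
  by rewrite divr_gt0// divr_gt0 ?normr_gt0// exprn_gt0.
have [del del_gt0 Hdel] := Floc p q _ eps_gt0.
have [k lk_lt] : exists k, lk k < del.
  have [k hk] : exists k : nat, l0 / del < k%:R.
    by exists (Num.bound (l0 / del)); apply: archi_boundP; rewrite divr_ge0 ?ltW.
  exists k; rewrite /lk ltr_pdivrMr ?exprn_gt0// mulrC -ltr_pdivrMr//.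
  by apply: lt_trans hk _; rewrite -natrX ltr_nat ltn_expl.
have := Hdel _ _ _ (lk_gt0 k) lk_lt (Hp k) (Hq k).
apply/negP; rewrite -ltNge; apply: lt_le_trans (abE k).
have -> : `|F a0 b0 l0| / l0 ^+ 2 / 2 * lk k ^+ 2 = `|F a0 b0 l0| / 4 ^+ k / 2.
  rewrite /lk expr_div_n -exprM mulnC exprM -[2 ^+ 2]natrX.
  by field; rewrite ?expf_neq0 ?gt_eqF.
by rewrite ltr_pdivrMr// mulr_natr mulr2n ltrDl divr_gt0 ?normr_gt0// exprn_gt0.
Qed.

End Goursat.

Section GoursatReal.
Variable R : realType.
Local Notation mu := (@lebesgue_measure R).

Definition itg (f : R -> R) (a c : R) : R := \int[mu]_(x in `[a, c]) f x.

Lemma continuous_integrable_itv (f : R -> R) (a c : R) :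
  continuous f -> mu.-integrable `[a, c] (EFin \o f).
Proof.
move=> cf; apply: continuous_compact_integrable; first exact: segment_compact.
by apply: continuous_subspaceT.
Qed.

Lemma itg_split (f : R -> R) (a c d : R) : continuous f -> a <= c -> c <= d ->
  itg f a d = itg f a c + itg f c d.
Proof.
move=> cf ac cd; rewrite /itg.
have := @Rintegral_itvB R f (BLeft a) (BRight d) c
  (continuous_integrable_itv a d cf).
rewrite !bnd_simp => /(_ ac cd) /eqP; rewrite subr_eq => /eqP ->.
rewrite addrC; congr (_ + _).
apply: Rintegral_itv_obnd_cbnd.
apply: integrableS (continuous_integrable_itv c d cf) => //.
by apply: subset_itvr; rewrite bnd_simp.
Qed.

Lemma itgB (f g : R -> R) a c : continuous f -> continuous g ->
  itg (fun x => f x - g x) a c = itg f a c - itg g a c.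
Proof. by move=> cf cg; apply: RintegralB => //; exact: continuous_integrable_itv. Qed.

Lemma itg_near_cst (f : R -> R) (a l k M : R) : continuous f -> 0 <= l ->
  (forall x, a <= x <= a + l -> `|f x - k| <= M) ->
  `|itg f a (a + l) - k * l| <= M * l.
Proof.
move=> cf l0 fk.
have mul : fine (mu `[a, a + l]) = l.
  rewrite lebesgue_measure_itv/= lte_fin; case: ltP => /=; first by move=> _; ring.
  by move=> h; lra.
have cst (m : R) : itg (fun=> m) a (a + l) = m * l by rewrite /itg Rintegral_cst// mul.
have ck : continuous (fun _ : R => k) by exact: cst_continuous.
have cM : continuous (fun _ : R => M) by exact: cst_continuous.
rewrite -(cst k) -itgB// -(cst M).
have cfk : continuous (fun x => f x - k) by move=> x; apply: cvgB; [exact: cf|exact: cvg_cst].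
apply: le_trans (le_normr_Rintegral _ _) _ => //.
  exact: continuous_integrable_itv.
apply: le_Rintegral => //.
- apply: (@continuous_integrable_itv (fun x => `|f x - k|)) => x.
  by apply: cvg_norm; exact: cfk.
- exact: continuous_integrable_itv.
Qed.

(** The real part of the contour integral of U + i V around [a, c] x [b, d], that
    is, of U dx - V dy; multiplying the function by i covers the other part. *)
Definition rect_form (U V : R -> R -> R) (a c b d : R) :=
  itg (U^~ b) a c - itg (U^~ d) a c - (itg (V c) b d - itg (V a) b d).

(** Complex differentiability of U + i V at the point a + i b, with derivative
    al + i be. *)
Definition cauchy_riemann_at (U V : R -> R -> R) (a b : R) :=
  exists al be : R, forall eps, 0 < eps -> exists2 del, 0 < del &
    forall h k, `|h| < del -> `|k| < del ->
    `|U (a + h) (b + k) - U a b - (al * h - be * k)| <= eps * (`|h| + `|k|) /\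
    `|V (a + h) (b + k) - V a b - (be * h + al * k)| <= eps * (`|h| + `|k|).

Lemma cauchy_riemann_continuous U V : (forall a b, cauchy_riemann_at U V a b) ->
  forall a b, [/\ continuous (U^~ b), continuous (U a), continuous (V^~ b)
    & continuous (V a)].
Proof.
move=> CR.
have key (f : R -> R) x c : (exists2 del, 0 < del & forall h, `|h| < del ->
     `|f (x + h) - f x - c * h| <= 1 * `|h|) -> f y @[y --> x] --> f x.
  move=> [del del0 H]; apply/cvgrPdist_le => e e0.
  near=> y.
  have -> : y = x + (y - x) by ring.
  have dy : `|y - x| < del.
    by near: y; apply: cvgr_distC_lt => //; exact: cvg_id.
  have := H _ dy; rewrite mul1r => h.
  rewrite distrC; have {h} : `|f (x + (y - x)) - f x| <= (1 + `|c|) * `|y - x|.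
    rewrite mulrDl mul1r -normrM.
    rewrite -[X in `|X| <= _](subrK (c * (y - x))).
    by apply: le_trans (ler_normD _ _) _; rewrite lerD2r.
  move=> h; apply: le_trans h _; rewrite mulrC -ler_pdivlMr ?ltr_pwDl//.
  apply: ltW; near: y; apply: cvgr_distC_lt; first exact: cvg_id.
  by rewrite divr_gt0 ?ltr_pwDl.
move=> a b; split=> x.
- have [al [be]] := CR x b; move=> /(_ 1 ltr01)[del d0 H].
  apply: (key _ _ al); exists del => // h hd.
  by have [+ _] := H h 0 hd ltac:(by rewrite normr0); rewrite normr0 !addr0 mulr0 subr0.
- have [al [be]] := CR a x; move=> /(_ 1 ltr01)[del d0 H].
  apply: (key _ _ (- be)); exists del => // h hd.
  have [+ _] := H 0 h ltac:(by rewrite normr0) hd.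
  by rewrite normr0 !addr0 mulr0 !sub0r add0r mulNr.
- have [al [be]] := CR x b; move=> /(_ 1 ltr01)[del d0 H].
  apply: (key _ _ be); exists del => // h hd.
  by have [_] := H h 0 hd ltac:(by rewrite normr0); rewrite normr0 !addr0 mulr0 addr0.
- have [al [be]] := CR a x; move=> /(_ 1 ltr01)[del d0 H].
  apply: (key _ _ al); exists del => // h hd.
  have [_] := H 0 h ltac:(by rewrite normr0) hd.
  by rewrite normr0 !addr0 mulr0 !add0r.
Unshelve. all: by end_near. Qed.

(** The contour integral is additive under subdivision of squares, and the
    affine part of a differentiable function contributes nothing to it, so that
    it is o of the area of small squares. *)
Lemma goursat U V : (forall a b, cauchy_riemann_at U V a b) ->
  forall a b l, 0 < l -> rect_form U V a (a + l) b (b + l) = 0.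
Proof.
move=> CR; have C := cauchy_riemann_continuous CR.
apply: (@bisection_vanish R (fun a b l => rect_form U V a (a + l) b (b + l))).
  move=> a b l l0; rewrite /rect_form.
  have sp f x : continuous f ->
      itg f x (x + l) = itg f x (x + l / 2) + itg f (x + l / 2) (x + l / 2 + l / 2).
    move=> cf; have -> : x + l = x + l / 2 + l / 2 by field.
    by apply: itg_split => //; lra.
  have cU y : continuous (U^~ y) by case: (C 0 y).
  have cV y : continuous (V y) by case: (C y 0).
  have E x : x + l / 2 + l / 2 = x + l by field.
  rewrite !sp// !E.
  by ring.
move=> p q eps eps0; have [al [be H]] := CR p q.
have eps8 : 0 < eps / 8 by lra.
have [del del0 {}H] := H _ eps8.
exists del => // a b l l0 ld /andP[ap pa] /andP[bq qb].
have loc x y : a <= x <= a + l -> b <= y <= b + l ->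
    `|U x y - U p q - (al * (x - p) - be * (y - q))| <= eps / 4 * l /\
    `|V x y - V p q - (be * (x - p) + al * (y - q))| <= eps / 4 * l.
  move=> /andP[ax xa] /andP[b_y yb].
  have xp : `|x - p| <= l by rewrite ler_norml; lra.
  have yq : `|y - q| <= l by rewrite ler_norml; lra.
  have [] := H (x - p) (y - q) (le_lt_trans xp ld) (le_lt_trans yq ld).
  rewrite ![_ + (_ - _)]addrC !subrK => h1 h2.
  by split; [apply: le_trans h1 _|apply: le_trans h2 _]; nra.
have cU y : continuous (U^~ y) by case: (C 0 y).
have cV y : continuous (V y) by case: (C y 0).
rewrite /rect_form -!itgB//.
have h1 : `|itg (fun x => U x b - U x (b + l)) a (a + l) - be * l * l|
   <= eps / 2 * l * l.
  apply: itg_near_cst => [x||x xa]; [|exact: ltW|].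
    by apply: cvgB; exact: cU.
  have [A _] := loc x b xa ltac:(lra); have [B _] := loc x (b + l) xa ltac:(lra).
  by move: A B; rewrite !ler_norml; lra.
have h2 : `|itg (fun x => V (a + l) x - V a x) b (b + l) - be * l * l|
   <= eps / 2 * l * l.
  apply: itg_near_cst => [x||x xa]; [|exact: ltW|].
    by apply: cvgB; exact: cV.
  have [_ A] := loc (a + l) x ltac:(lra) xa; have [_ B] := loc a x ltac:(lra) xa.
  by move: A B; rewrite !ler_norml; lra.
by rewrite expr2; move: h1 h2; rewrite !ler_norml; lra.
Qed.

End GoursatReal.

Section Cderiv.
Variable R : realType.
Local Notation C := R[i].
Local Notation normc := (@Normc.normc R).
Implicit Types (z w h : C) (f g : C -> C).

Lemma derivable_remainder (K : numFieldType) (V W : normedModType K)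
    (f : V -> W) x v : derivable f x v ->
  forall eps : K, 0 < eps -> exists2 del : K, 0 < del &
    forall h : K, `|h| < del ->
      `|f (h *: v + x) - f x - h *: 'D_v f x| <= eps * `|h|.
Proof.
move=> Hl eps eps0; set l := 'D_v f x.
move/cvgrPdist_le : Hl => /(_ _ eps0).
rewrite near_withinE => /nbhs_ballP[del /= del0 H].
exists del => // h hdel.
have [->|h0] := eqVneq h 0.
  by rewrite !scale0r add0r subrr subr0 !normr0 mulr0.
have /H /(_ h0) : ball 0 del h by rewrite -ball_normE/= sub0r normrN.
rewrite distrC => {}H.
have -> : f (h *: v + x) - f x - h *: l
        = h *: (h^-1 *: (f (h *: v + x) - f x) - l).
  by rewrite scalerBr scalerA mulfV// scale1r.
by rewrite normrZ mulrC ler_wpM2r.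
Qed.

Lemma normr_normc z : `|z| = (normc z)%:C.
Proof. by []. Qed.

Lemma normc_ge0 z : 0 <= normc z.
Proof. by case: z => a b; exact: sqrtr_ge0. Qed.

Lemma normc_complex_sqr (a b : R) : normc (a +i* b) ^+ 2 = a ^+ 2 + b ^+ 2.
Proof. by rewrite /= sqr_sqrtr// addr_ge0// sqr_ge0. Qed.

Lemma normr_Re z : `|complex.Re z| <= normc z.
Proof.
case: z => a b /=; rewrite -sqrtr_sqr ler_wsqrtr// lerDl sqr_ge0//.
Qed.

Lemma normr_Im z : `|complex.Im z| <= normc z.
Proof.
case: z => a b /=; rewrite -sqrtr_sqr ler_wsqrtr// lerDr sqr_ge0//.
Qed.

Lemma normc_le_ReIm z : normc z <= `|complex.Re z| + `|complex.Im z|.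
Proof.
case: z => a b; rewrite -(@ler_pXn2r _ 2) ?nnegrE ?addr_ge0 ?normc_ge0//.
rewrite normc_complex_sqr /= sqrrD !real_normK ?num_real//.
have := mulr_ge0 (normr_ge0 a) (normr_ge0 b); lra.
Qed.

(** Complex differentiability in terms of the real valued modulus; over the
    field C the general notion of derivative has complex moduli eps and del. *)
Definition cderivable f z := exists l : C, forall eps : R, 0 < eps ->
  exists2 del : R, 0 < del & forall h, normc h < del ->
    normc (f (z + h) - f z - l * h) <= eps * normc h.

Lemma cderivable_derivable (V : normedModType C) (u : V -> C^o) (x y : V) z :
  derivable u (x + z *: y) y -> cderivable (fun t => u (x + t *: y)) z.
Proof.
move=> /derivable_remainder H; exists ('D_y u (x + z *: y)) => eps eps0.
have [|del del0 {}H] := H (eps%:C); first by rewrite ltcR.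
exists (complex.Re del).
  by move: del0; rewrite ltcE/= => /andP[].
move=> h hd; have := H h; have -> : del = (complex.Re del)%:C.
  by move: del0; case: (del) => a b; rewrite ltcE /= => /andP[/eqP -> _].
rewrite !normr_normc ltcR => /(_ hd); rewrite -rmorphM lecR.
have -> : h *: y + (x + z *: y) = x + (z + h) *: y.
  by rewrite scalerDl addrCA (addrC (h *: y)).
by rewrite [h *: 'D_y u _]mulrC.
Qed.


Lemma cderivable_cst (c : C) z : cderivable (fun=> c) z.
Proof.
exists 0 => eps eps0; exists 1 => // h _.
have -> : c - c - 0 * h = 0 by ring.
by rewrite Normc.normc0 mulr_ge0 ?normc_ge0// ltW.
Qed.

Lemma cderivable_id z : cderivable id z.
Proof.
exists 1 => eps eps0; exists 1 => // h _.
have -> : id (z + h) - id z - 1 * h = 0 by rewrite /=; ring.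
by rewrite Normc.normc0 mulr_ge0 ?normc_ge0// ltW.
Qed.

Lemma cderivable_lipschitz g z : cderivable g z -> exists2 M : R, 0 < M &
  exists2 del : R, 0 < del & forall h, normc h < del ->
    normc (g (z + h) - g z) <= M * normc h.
Proof.
move=> [l /(_ 1 ltr01)[d d0 H]].
exists (1 + normc l); first by rewrite ltr_pwDl// normc_ge0.
exists d => // h /H hd; rewrite -(subrK (l * h) (g (z + h) - g z)).
by apply: le_trans (le_normcD _ _) _; rewrite Normc.normcM mulrDl lerD2r.
Qed.

Lemma cderivable_comp f g z :
  cderivable g z -> cderivable f (g z) -> cderivable (f \o g) z.
Proof.
move=> Hg [lf Hf]; have [M M0 [d0 d00 H0]] := cderivable_lipschitz Hg.
case: Hg => lg Hg; exists (lf * lg) => eps eps0.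
have e1 : 0 < eps / 2 / M by rewrite divr_gt0// divr_gt0.
have [d1 d10 H1] := Hf _ e1.
pose N := normc lf + 1.
have N0 : 0 < N by rewrite ltr_wpDl// normc_ge0.
have e2 : 0 < eps / 2 / N by rewrite divr_gt0// divr_gt0.
have [d2 d20 H2] := Hg _ e2.
exists (Num.min d0 (Num.min d2 (d1 / M))) => [|h].
  by rewrite !lt_min d00 d20 divr_gt0.
rewrite !lt_min => /and3P[/H0 kh /H2 kd]; rewrite ltr_pdivlMr// mulrC => hd1.
set k := g (z + h) - g z in kh kd *.
have kE : g (z + h) = g z + k by rewrite /k; ring.
have -> : (f \o g) (z + h) - (f \o g) z - lf * lg * h
    = (f (g z + k) - f (g z) - lf * k) + lf * (k - lg * h).
  by rewrite /= kE; ring.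
apply: le_trans (le_normcD _ _) _; rewrite Normc.normcM.
have := H1 _ (le_lt_trans kh hd1) => h1.
have {h1} h1 : normc (f (g z + k) - f (g z) - lf * k) <= eps / 2 * normc h.
  apply: le_trans h1 _; apply: le_trans (ler_wpM2l (ltW e1) kh) _.
  by rewrite mulrA divfK// gt_eqF.
have h2 : normc lf * normc (k - lg * h) <= eps / 2 * normc h.
  apply: le_trans (_ : N * (eps / 2 / N * normc h) <= _).
    by apply: ler_pM; rewrite ?normc_ge0// /N lerDl.
  by rewrite mulrA mulrCA divff ?mulr1// gt_eqF.
by apply: le_trans (lerD h1 h2) _; rewrite -mulrDl -splitr.
Qed.

Lemma cderivableD f g z :
  cderivable f z -> cderivable g z -> cderivable (fun t => f t + g t) z.
Proof.
move=> [lf Hf] [lg Hg]; exists (lf + lg) => eps eps0.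
have e2 : 0 < eps / 2 by rewrite divr_gt0.
have [d1 d10 H1] := Hf _ e2; have [d2 d20 H2] := Hg _ e2.
exists (Num.min d1 d2) => [|h]; first by rewrite lt_min d10.
rewrite lt_min => /andP[/H1 h1 /H2 h2].
have -> : f (z + h) + g (z + h) - (f z + g z) - (lf + lg) * h
  = (f (z + h) - f z - lf * h) + (g (z + h) - g z - lg * h) by ring.
by apply: le_trans (le_normcD _ _) _; move: h1 h2; lra.
Qed.

Lemma cderivableZ (c : C) f z :
  cderivable f z -> cderivable (fun t => c * f t) z.
Proof.
move=> [lf Hf]; exists (c * lf) => eps eps0.
have c0 : 0 < normc c + 1 by rewrite ltr_wpDl// normc_ge0.
have [d d0 H] := Hf _ (divr_gt0 eps0 c0).
exists d => // h /H {}H.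
have -> : c * f (z + h) - c * f z - c * lf * h = c * (f (z + h) - f z - lf * h).
  by ring.
rewrite Normc.normcM; apply: le_trans (_ : (normc c + 1) * (eps / (normc c + 1) * normc h) <= _).
  by apply: ler_pM; rewrite ?normc_ge0// lerDl.
by rewrite mulrA mulrCA divff ?mulr1// gt_eqF.
Qed.

Lemma cderivable_sqr z : cderivable (fun t => t ^+ 2) z.
Proof.
exists (2 * z) => eps eps0; exists eps => // h hd.
have -> : (z + h) ^+ 2 - z ^+ 2 - 2 * z * h = h * h by ring.
by rewrite Normc.normcM ler_wpM2r ?normc_ge0// ltW.
Qed.

(** The product rule is reduced to the square by polarization. *)
Lemma cderivableM f g z :
  cderivable f z -> cderivable g z -> cderivable (fun t => f t * g t) z.
Proof.
move=> df dg.
have -> : (fun t => f t * g t) = (fun t => 2^-1 * ((f t + g t) ^+ 2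
    + ((-1) * (f t) ^+ 2 + (-1) * (g t) ^+ 2))).
  by apply/funext => t; field.
have sq k : cderivable k z -> cderivable (fun t => k t ^+ 2) z.
  by move=> dk; apply: (cderivable_comp (f := fun t => t ^+ 2)) => //; exact: cderivable_sqr.
apply: cderivableZ; apply: cderivableD; first exact/sq/cderivableD.
by apply: cderivableD; apply: cderivableZ; exact: sq.
Qed.

Lemma cexpD z w : cexp (z + w) = cexp z * cexp w.
Proof.
case: z w => [a b] [c d]; rewrite /cexp /= expRD cosD sinD.
by apply/eqP; rewrite eq_complex /=; apply/andP; split; apply/eqP; ring.
Qed.

Lemma cexp0 : cexp 0 = 1 :> C.
Proof.
by rewrite /cexp /= expR0 cos0 sin0 mul1r.
Qed.

Lemma normc_cexp z : normc (cexp z) = expR (complex.Re z).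
Proof.
rewrite /cexp Normc.normcM /= cos2Dsin2 sqrtr1 mulr1 expr0n /= addr0 sqrtr_sqr.
by rewrite ger0_norm// expR_ge0.
Qed.

Lemma real_remainder (f : R -> R) (x l : R) : is_derive x 1 f l ->
  forall eps : R, 0 < eps -> exists2 del : R, 0 < del &
    forall h : R, `|h| < del -> `|f (x + h) - f x - l * h| <= eps * `|h|.
Proof.
move=> [df <-] eps eps0.
have [d d0 H] := @derivable_remainder R R R f x 1 df _ eps0; exists d => // h /H.
by rewrite [h *: 1]mulr1 [h *: _]mulrC [h + x]addrC.
Qed.

Lemma cderivable_cexp z : cderivable (@cexp R) z.
Proof.
suff d0 : cderivable (@cexp R) 0.
  have -> : @cexp R = (fun t => cexp z * cexp (t + - z)).
    by apply/funext => t; rewrite -cexpD; congr cexp; ring.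
  apply: cderivableZ; apply: (cderivable_comp (f := @cexp R)).
    by apply: cderivableD; [exact: cderivable_id|exact: cderivable_cst].
  by rewrite subrr.
exists 1 => eps eps0.
pose e := Num.min 1 (eps / 8).
have e0 : 0 < e by rewrite lt_min ltr01 divr_gt0.
have e1 : e <= 1 by rewrite ge_min lexx.
have e8 : e <= eps / 8 by rewrite ge_min lexx orbT.
have [d1 d10 H1] := real_remainder (is_derive_expR 0) e0.
have [d2 d20 H2] := real_remainder (is_derive_cos 0) e0.
have [d3 d30 H3] := real_remainder (is_derive_sin 0) e0.
exists (Num.min (e / 2) (Num.min d1 (Num.min d2 d3))) => [|[a b]].
  by rewrite !lt_min d10 d20 d30 divr_gt0.
rewrite !lt_min => /and4P[he h1 h2 h3].
have na : `|a| <= normc (a +i* b) := normr_Re (a +i* b).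
have nb : `|b| <= normc (a +i* b) := normr_Im (a +i* b).
set nh := normc _ in he h1 h2 h3 na nb *.
have /H1 := le_lt_trans na h1; have /H2 := le_lt_trans nb h2.
have /H3 := le_lt_trans nb h3.
rewrite !add0r expR0 cos0 sin0 !mul1r oppr0 mul0r !subr0 addr0 => Hs Hc He.
have ea : `|expR a - 1| <= 2 * `|a|.
  rewrite -(subrK a (expR a - 1)); apply: le_trans (ler_normD _ _) _.
  by have := ler_wpM2r (normr_ge0 a) e1; move: He; lra.
have sb : `|sin b| <= 2 * `|b|.
  rewrite -(subrK b (sin b)); apply: le_trans (ler_normD _ _) _.
  by have := ler_wpM2r (normr_ge0 b) e1; move: Hs; lra.
have enh : 0 <= e * nh by rewrite mulr_ge0 ?normc_ge0// ltW.
have ane : 2 * `|a| <= e by move: he na; lra.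
apply: le_trans (normc_le_ReIm _) _.
rewrite cexp0 /cexp /= !mul0r subr0 addr0 subr0.
have r1 : `|expR a * cos b - 1 - a| <= 4 * e * nh.
  have -> : expR a * cos b - 1 - a = (expR a - 1 - a) + (cos b - 1)
     + (expR a - 1) * (cos b - 1) by ring.
  apply: le_trans (ler_normD _ _) _.
  have := ler_normD (expR a - 1 - a) (cos b - 1).
  have : `|(expR a - 1) * (cos b - 1)| <= 1 * (e * `|b|).
    by rewrite normrM; apply: ler_pM => //; lra.
  have := ler_wpM2l (ltW e0) na; have := ler_wpM2l (ltW e0) nb; lra.
have r2 : `|expR a * sin b - b| <= 4 * e * nh.
  have -> : expR a * sin b - b = (expR a - 1) * sin b + (sin b - b) by ring.
  apply: le_trans (ler_normD _ _) _.
  have : `|(expR a - 1) * sin b| <= e * (2 * `|b|).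
    by rewrite normrM; apply: ler_pM => //; lra.
  have := ler_wpM2l (ltW e0) nb; lra.
have := ler_wpM2r (le_trans (normr_ge0 a) na) e8; move: r1 r2; lra.
Qed.

End Cderiv.

Section MeanValue.
Variable R : realType.
Local Notation C := R[i].
Local Notation normc := (@Normc.normc R).

Lemma cderivable_cauchy_riemann (F : C -> C) : (forall z, cderivable F z) ->
  forall a b, cauchy_riemann_at (fun s t => complex.Re (F (s +i* t)))
                                (fun s t => complex.Im (F (s +i* t))) a b.
Proof.
move=> dF a b; have [[al be] H] := dF (a +i* b).
exists al, be => eps eps0; have [d d0 {}H] := H _ eps0.
exists (d / 2) => [|h k hd kd]; first by rewrite divr_gt0.
have nhk := normc_le_ReIm (h +i* k).
have /H : normc (h +i* k) < d.
  by apply: le_lt_trans nhk _; rewrite /= (splitr d) ltrD.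
have -> : (a +i* b) + (h +i* k) = (a + h) +i* (b + k) by [].
set D := F _ => Hd.
have {}Hd : normc (D - F (a +i* b) - (al +i* be) * (h +i* k)) <= eps * (`|h| + `|k|).
  by apply: le_trans Hd _; rewrite ler_pM2l.
split; apply: le_trans Hd; [apply: le_trans (normr_Re _)|apply: le_trans (normr_Im _)].
  by case: D (F _) => [? ?] [? ?].
by case: D (F _) => [x y] [x' y'] /=; rewrite [al * k + _]addrC.
Qed.

Lemma cexp_period (z : C) : cexp (z + (0 +i* (2 * pi))) = cexp z.
Proof.
by rewrite cexpD /cexp /= expR0 mulr_natl cos2pi sin2pi mul1r mulr1.
Qed.

(** The function F z = g (exp(2 pi z)) has period i, so the horizontal sides of
    the unit squares [a, a + 1] x [0, 1] cancel in Goursat's lemma and the mean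
    of Im F over the vertical segments above a does not change when a decreases
    by 1.  As a tends to - oo these means tend to Im g 0. *)
Lemma circle_mean_Im (g : C -> C) : (forall z, cderivable g z) ->
  itg (fun t => complex.Im (g (cexp (0 +i* (2 * pi * t))))) 0 1 = complex.Im (g 0).
Proof.
move=> dg; pose F z := g (cexp ((2 * pi)%:C * z)).
have dF z : cderivable F z.
  apply: (cderivable_comp (f := g)) => //.
  apply: (cderivable_comp (f := @cexp R)); last exact: cderivable_cexp.
  by apply: cderivableZ; exact: cderivable_id.
have CR := cderivable_cauchy_riemann dF.
set U := fun s t => complex.Re _ in CR; set V := fun s t => complex.Im _ in CR.
have cV s : continuous (V s) by have [] := cauchy_riemann_continuous CR s 0.
have Mper a : itg (V (a + 1)) 0 1 = itg (V a) 0 1.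
  have /eqP := goursat CR a 0 ltr01; rewrite /rect_form add0r.
  have -> : U^~ 1 = U^~ 0.
    apply/funext => s; rewrite /U /F; congr (complex.Re (g _)).
    rewrite -[RHS]cexp_period; congr cexp.
    by apply/eqP; rewrite eq_complex /=; apply/andP; split; apply/eqP; ring.
  by rewrite subrr sub0r oppr_eq0 subr_eq0 => /eqP.
have MN k : itg (V (- k%:R)) 0 1 = itg (V 0) 0 1.
  elim: k => [|k <-]; first by rewrite oppr0.
  by rewrite -Mper -natr1; congr (itg (V _) 0 1); ring.
have -> : itg (fun t => complex.Im (g (cexp (0 +i* (2 * pi * t))))) 0 1 = itg (V 0) 0 1.
  congr itg; apply/funext => t; rewrite /V /F; congr (complex.Im (g (cexp _))).
  by apply/eqP; rewrite eq_complex /=; apply/andP; split; apply/eqP; ring.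
apply/eqP; rewrite -subr_eq0 -normr_le0; apply/ler_addgt0Pl => e e0; rewrite addr0.
have [M M0 [d d0 H]] := cderivable_lipschitz (dg 0).
pose m := Num.min (d / 2) (e / M).
have m0 : 0 < m by rewrite lt_min !divr_gt0.
have [k km] : exists k : nat, expR (- k%:R) <= m.
  exists (Num.bound m^-1); rewrite expRN -[leRHS]invrK lef_pV2 ?posrE ?expR_gt0 ?invr_gt0//.
  apply: le_trans (ltW (archi_boundP _)) _; first by rewrite invr_ge0 ltW.
  by apply: le_trans (expR_ge1Dx _); rewrite lerDr.
rewrite -(MN k).
have := @itg_near_cst R (V (- k%:R)) 0 1 (complex.Im (g 0)) e (cV _) ler01.
rewrite add0r !mulr1; apply => t _.
have nE : normc (cexp ((2 * pi)%:C * ((- k%:R) +i* t))) <= m.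
  rewrite normc_cexp /= mul0r subr0; apply: le_trans km; rewrite ler_expR.
  rewrite mulrN lerN2 ler_peMl//; have := pi_ge2 R; lra.
rewrite /V /F -(add0r (cexp _)).
have -> : forall x y : C, complex.Im x - complex.Im y = complex.Im (x - y).
  by move=> [? ?] [? ?].
apply: le_trans (normr_Im _) _; apply: le_trans (H _ _) _.
  apply: le_lt_trans nE _; rewrite gt_min.
  by rewrite ltr_pdivrMr// mulr_natr mulr2n ltrDl d0.
apply: le_trans (ler_wpM2l (ltW M0) nE) _.
by rewrite mulrC -ler_pdivlMr// ge_min lexx orbT.
Qed.

Lemma circle_mean_Re (g : C -> C) : (forall z, cderivable g z) ->
  itg (fun t => complex.Re (g (cexp (0 +i* (2 * pi * t))))) 0 1 = complex.Re (g 0).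
Proof.
move=> dg; have E x : complex.Re x = complex.Im ('i%C * x).
  by case: x => a b /=; rewrite mul0r mul1r add0r.
rewrite E -(@circle_mean_Im (fun z => 'i%C * g z)); last first.
  by move=> z; exact: cderivableZ.
by congr itg; apply/funext => t; rewrite E.
Qed.

End MeanValue.


(** * Measure preserving maps and rotation averages *)

Section Preserve.
Variable R : realType.

Definition preserves d (T : measurableType d) (mu : set T -> \bar R)
    (phi : T -> T) :=
  measurable_fun setT phi /\
  forall A, measurable A -> mu (phi @^-1` A) = mu A.

Lemma preserves_comp d (T : measurableType d) (mu : set T -> \bar R) phi psi :
  preserves mu phi -> preserves mu psi -> preserves mu (phi \o psi).
Proof.
move=> [mphi Hphi] [mpsi Hpsi]; split; first exact: measurableT_comp.
move=> A mA; rewrite comp_preimage Hpsi ?Hphi//.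
by rewrite -[X in measurable X]setTI; exact: mphi.
Qed.

Section integral.
Context d (T : measurableType d) (mu : {measure set T -> \bar R}) (phi : T -> T).
Hypothesis phiP : preserves mu phi.

Lemma ge0_integral_preserves (f : T -> \bar R) :
  measurable_fun setT f -> (forall x, 0 <= f x)%E ->
  (\int[mu]_x f (phi x) = \int[mu]_x f x)%E.
Proof.
have [mphi Hphi] := phiP; move=> mf f0.
transitivity (\int[pushforward mu phi]_(x in setT) f x)%E; last first.
  by apply: eq_measure_integral => A mA _; exact: Hphi.
by rewrite ge0_integral_pushforward// preimage_setT.
Qed.

Lemma integrable_preserves (f : T -> \bar R) :
  mu.-integrable setT f -> mu.-integrable setT (f \o phi).
Proof.
have [mphi Hphi] := phiP; move=> /integrableP[mf foo].
apply/integrableP; split; first exact: measurableT_comp.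
rewrite (ge0_integral_preserves (f := fun x => `|f x|%E))//.
exact: measurableT_comp.
Qed.

Lemma integral_preserves (f : T -> \bar R) : mu.-integrable setT f ->
  (\int[mu]_x f (phi x) = \int[mu]_x f x)%E.
Proof.
have [mphi Hphi] := phiP; move=> fi.
have mf := measurable_int _ fi.
transitivity (\int[pushforward mu phi]_(x in setT) f x)%E; last first.
  by apply: eq_measure_integral => A mA _; exact: Hphi.
by rewrite integral_pushforward// preimage_setT//; exact: integrable_preserves.
Qed.

End integral.

Section shear.
Context d1 d2 (T1 : measurableType d1) (T2 : measurableType d2).
Variables (m1 : {sigma_finite_measure set T1 -> \bar R})
          (m2 : {sigma_finite_measure set T2 -> \bar R}).

Lemma product_measure12 (A : set (T1 * T2)) : measurable A ->
  (m1 \x m2)%E A = (m1 \x^ m2)%E A.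
Proof.
by move=> mA; apply: product_measure_unique => //= *; rewrite product_measure2E.
Qed.

(** The product measure under a name of its own, to carry the sigma-finite
    structure of arbitrary sigma-finite factors. *)
Definition prodm : set (T1 * T2) -> \bar R := (m1 \x m2)%E.

HB.instance Definition _ := Measure.copy prodm (m1 \x m2)%E.

Let prodm_sigma_finite : sigma_finite setT prodm.
Proof.
have /sigma_finiteP[F [FT ndF Foo]] := sigma_finiteT m1.
have /sigma_finiteP[G [GT ndG Goo]] := sigma_finiteT m2.
exists (fun k => F k `*` G k).
  apply/esym; rewrite -subTset => -[x y] _.
  have [i _ Fi] : (\bigcup_k F k) x by rewrite -FT.
  have [j _ Gj] : (\bigcup_k G k) y by rewrite -GT.
  exists (maxn i j) => //; split.
  - by move: Fi; exact/subsetPset/ndF/leq_maxl.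
  - by move: Gj; exact/subsetPset/ndG/leq_maxr.
move=> k; have [mFk Fk] := Foo k; have [mGk Gk] := Goo k; split.
  exact: measurableX.
by rewrite /prodm product_measure1E// lte_mul_pinfty// ge0_fin_numE.
Qed.

HB.instance Definition _ := Measure_isSigmaFinite.Build _ _ _
  prodm prodm_sigma_finite.

Lemma preserves_shear1 (phi : T2 -> T1 -> T1) :
  measurable_fun setT (fun p => phi p.2 p.1) ->
  (forall y, preserves m1 (phi y)) ->
  preserves (m1 \x m2)%E (fun p => (phi p.2 p.1, p.2)).
Proof.
move=> mphi phiP.
have mS : measurable_fun setT (fun p : T1 * T2 => (phi p.2 p.1, p.2)).
  exact: measurable_fun_pair.
split=> // A mA.
have mpA : measurable ((fun p : T1 * T2 => (phi p.2 p.1, p.2)) @^-1` A).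
  by rewrite -[X in measurable X]setTI; exact: mS.
rewrite !product_measure12//; apply: eq_integral => y _ /=.
have <- : phi y @^-1` (ysection A y)
    = ysection ((fun p => (phi p.2 p.1, p.2)) @^-1` A) y.
  by apply/seteqP; split=> x /=; rewrite /ysection /= !inE.
by apply: (phiP y).2; exact: measurable_ysection.
Qed.

Lemma preserves_shear2 (phi : T1 -> T2 -> T2) :
  measurable_fun setT (fun p => phi p.1 p.2) ->
  (forall x, preserves m2 (phi x)) ->
  preserves (m1 \x m2)%E (fun p => (p.1, phi p.1 p.2)).
Proof.
move=> mphi phiP.
have mS : measurable_fun setT (fun p : T1 * T2 => (p.1, phi p.1 p.2)).
  exact: measurable_fun_pair.
split=> // A mA.
apply: eq_integral => x _ /=.
have <- : phi x @^-1` (xsection A x)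
    = xsection ((fun p => (p.1, phi p.1 p.2)) @^-1` A) x.
  by apply/seteqP; split=> y /=; rewrite /xsection /= !inE.
by apply: (phiP x).2; exact: measurable_xsection.
Qed.

Lemma preserves_prod (f : T1 -> T1) (g : T2 -> T2) :
  preserves m1 f -> preserves m2 g ->
  preserves (m1 \x m2)%E (fun p => (f p.1, g p.2)).
Proof.
move=> fP gP; have -> : (fun p : T1 * T2 => (f p.1, g p.2))
    = (fun p => (f p.1, p.2)) \o (fun p => (p.1, g p.2)) by [].
apply: preserves_comp.
  apply: (preserves_shear1 (phi := fun=> f)) => //.
  by apply: measurableT_comp => //; exact: fP.1.
apply: (preserves_shear2 (phi := fun=> g)) => //.
by apply: measurableT_comp => //; exact: gP.1.
Qed.

End shear.

Lemma preserves_lebesgue_translation (c : R) :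
  preserves (@lebesgue_measure R)
    ((fun x => x + c) : measurableTypeR R -> measurableTypeR R).
Proof.
have mt : measurable_fun setT
    ((fun x => x + c) : measurableTypeR R -> measurableTypeR R).
  exact: measurable_funD.
split=> // A mA; apply/esym.
suff : lebesgue_measure A = pushforward (@lebesgue_measure R)
    ((fun x => x + c) : measurableTypeR R -> measurableTypeR R) A by [].
apply: lebesgue_measure_unique => //= _ [[a b] _ <-] /=; rewrite /pushforward.
have -> : (fun x : R => x + c) @^-1` `]a, b] = `]a - c, b - c]%classic.
  by apply/seteqP; split=> x /=; rewrite !in_itv/= ltrBlDr lerBrDr.
rewrite !lebesgue_measure_itv /= !lte_fin ltrD2r; case: ifP => // _.
by rewrite -!EFinD; congr EFin; ring.
Qed.

Local Notation tup n := (n.-tuple (measurableTypeR R)).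

Definition tcomb n (a b : R) (t s : n.-tuple R) : tup n :=
  [tuple a * tnth t i + b * tnth s i | i < n].

Lemma measurable_tcomb d (T : measurableType d) n (a b : T -> R) (t s : T -> tup n) :
  measurable_fun setT a -> measurable_fun setT b ->
  measurable_fun setT t -> measurable_fun setT s ->
  measurable_fun setT (fun x => tcomb (a x) (b x) (t x) (s x)).
Proof.
move=> ma mb mt ms; apply/measurable_fun_tnthP => i.
rewrite (_ : _ \o _ = (fun x => a x * tnth (t x) i + b x * tnth (s x) i)); last first.
  by apply/funext => x; rewrite /= tnth_mktuple.
apply: measurable_funD; apply: measurable_funM => //.
  by move/measurable_fun_tnthP : mt; exact.
by move/measurable_fun_tnthP : ms; exact.
Qed.

Lemma preserves_leb_translation n (a : R) (s : tup n) :
  preserves (leb R n) (fun t => tcomb 1 a t s).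
Proof.
split; first by apply: measurable_tcomb.
elim: n s => [|n IH] s A mA.
  by congr (leb R 0 _); apply/seteqP; split=> t /=;
    rewrite (tuple0 (tcomb _ _ _ _)) (tuple0 t).
rewrite /= /leb_step /pushforward.
pose f x : R := x + a * thead s.
pose g (t : tup n) : tup n := tcomb 1 a t [tuple of behead s].
have := @preserves_prod _ _ _ _ (@lebesgue_measure R) (leb R n) f g.
case; first exact: preserves_lebesgue_translation.
  by split; [exact: measurable_tcomb|exact: IH].
move=> _ /(_ (@tcons R n @^-1` A)) <-; last first.
  by rewrite -[X in measurable X]setTI; exact: measurable_tcons.
congr ((_ \x _)%E _); apply/funext => -[x t] /=; congr (A _).
apply/eq_from_tnth => i; rewrite tnth_mktuple.
case: (unliftP ord0 i) => [j ->|->].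
  rewrite !(tnth_nth 0) /= nth_mktuple.
  have -> : tnth t j = t`_j :> R by exact: tnth_nth.
  have -> : tnth [tuple of behead s] j = (behead s)`_j :> R by exact: tnth_nth.
  by rewrite nth_behead.
by rewrite mul1r.
Qed.

Lemma tcomb10 n (t s : n.-tuple R) : tcomb 1 0 t s = t.
Proof. by apply/eq_from_tnth => i; rewrite tnth_mktuple mul1r mul0r addr0. Qed.

Lemma tcombC n a b (t s : n.-tuple R) : tcomb a b t s = tcomb b a s t.
Proof. by apply/eq_from_tnth => i; rewrite !tnth_mktuple addrC. Qed.

Lemma tcomb_comp n a b a1 b1 a2 b2 (t s : n.-tuple R) :
  tcomb a b (tcomb a1 b1 t s) (tcomb a2 b2 t s)
  = tcomb (a * a1 + b * a2) (a * b1 + b * b2) t s.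
Proof. by apply/eq_from_tnth => i; rewrite !tnth_mktuple; ring. Qed.

(** The measurable real vector spaces with a translation invariant measure;
    linear combinations [comb a b x y], standing for a x + b y, are the only
    operations that shears and rotations of pairs of vectors need. *)
Record haar_space := HaarSpace {
  hs_disp : measure_display;
  hs_type :> measurableType hs_disp;
  hs_measure : {sigma_finite_measure set hs_type -> \bar R};
  comb : R -> R -> hs_type -> hs_type -> hs_type;
  measurable_comb : forall d (X : measurableType d) (a b : X -> R)
    (x y : X -> hs_type),
    measurable_fun setT a -> measurable_fun setT b ->
    measurable_fun setT x -> measurable_fun setT y ->
    measurable_fun setT (fun t => comb (a t) (b t) (x t) (y t));
  comb10 : forall x y, comb 1 0 x y = x;
  combC : forall a b x y, comb a b x y = comb b a y x;
  comb_comp : forall a b a1 b1 a2 b2 x y,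
    comb a b (comb a1 b1 x y) (comb a2 b2 x y)
    = comb (a * a1 + b * a2) (a * b1 + b * b2) x y;
  preserves_translation : forall a y,
    preserves hs_measure (fun x => comb 1 a x y) }.

Definition tuple_space n : haar_space :=
  @HaarSpace _ (tup n) (leb R n) (@tcomb n)
    (fun d X a b x y => @measurable_tcomb d X n a b x y)
    (@tcomb10 n) (@tcombC n) (@tcomb_comp n) (@preserves_leb_translation n).

Section rotation.
Variable V : haar_space.
Let mu := prodm (hs_measure V) (hs_measure V).

Definition rot2 (c s : R) (p : V * V) : V * V :=
  (comb c (- s) p.1 p.2, comb s c p.1 p.2).

(** A rotation that is not the half turn is a product of three shears with
    parameters - s / (1 + c), s, - s / (1 + c), and a shear is a translation of
    one vector by a multiple of the other; the half turn is the square of the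
    quarter turn. *)
Lemma preserves_rot2 c s : c ^+ 2 + s ^+ 2 = 1 -> preserves mu (rot2 c s).
Proof.
move=> cs.
have sh1 (t : R) : preserves mu (fun p => (comb 1 t p.1 p.2, p.2)).
  apply: (@preserves_shear1 _ _ _ _ _ _ (fun y x => comb 1 t x y)).
    exact: measurable_comb.
  by move=> y; exact: preserves_translation.
have sh2 (t : R) : preserves mu (fun p => (p.1, comb t 1 p.1 p.2)).
  apply: (@preserves_shear2 _ _ _ _ _ _ (fun x y => comb t 1 x y)).
    exact: measurable_comb.
  move=> x; have [] := preserves_translation t x.
  by rewrite (_ : (fun x0 => _) = comb t 1 x)//; apply/funext => y; exact: combC.
have comb01 x y : comb 0 1 x y = y :> V by rewrite combC comb10.
have key (c' s' : R) : c' ^+ 2 + s' ^+ 2 = 1 -> c' != -1 -> preserves mu (rot2 c' s').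
  move=> cs' c1; have d0 : 1 + c' != 0 by rewrite addrC addr_eq0.
  pose t := s' / (1 + c').
  have := preserves_comp (sh1 (- t)) (preserves_comp (sh2 s') (sh1 (- t))).
  congr (preserves _ _); apply/funext => -[x y] /=; rewrite /rot2 /=.
  have E1 (a b : R) : comb a b (comb 1 (- t) x y) y = comb a (- a * t + b) x y.
    rewrite -[X in comb a b _ X = _](comb01 x y) comb_comp; congr comb.
      by rewrite mulr1 mulr0 addr0.
    by rewrite mulr1 mulrN mulNr.
  have s2 : s' ^+ 2 = (1 - c') * (1 + c').
    have -> : s' ^+ 2 = 1 - c' ^+ 2 by rewrite -cs'; ring.
    by ring.
  have ts : t * s' = 1 - c' by rewrite /t mulrAC -expr2 s2 mulfK.
  rewrite E1 comb_comp; congr (comb _ _ _ _, comb _ _ _ _).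
  - by rewrite mul1r mulNr ts; ring.
  - have -> : 1 * - t + - t * (- s' * t + 1) = - t * (1 + (1 - t * s')) by ring.
    by rewrite ts subKr /t mulNr divfK.
  - by rewrite mulNr mulrC ts; ring.
have [c1|] := eqVneq c (-1); last exact: key.
have s0 : s = 0 by apply/eqP; rewrite -sqrf_eq0; apply/eqP; move: cs; rewrite c1; lra.
have h : (0 : R) ^+ 2 + 1 ^+ 2 = 1 by ring.
have n1 : (0 : R) != -1 by rewrite eq_sym oppr_eq0 oner_eq0.
have := preserves_comp (key _ _ h n1) (key _ _ h n1).
congr (preserves _ _); apply/funext => -[x y] /=; rewrite /rot2 /= !comb_comp.
by congr (comb _ _ _ _, comb _ _ _ _); rewrite ?c1 ?s0; ring.
Qed.

Definition pcomb a b (p q : V * V) : V * V := (comb a b p.1 q.1, comb a b p.2 q.2).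

Lemma measurable_pcomb d (X : measurableType d) (a b : X -> R)
    (x y : X -> V * V) :
  measurable_fun setT a -> measurable_fun setT b ->
  measurable_fun setT x -> measurable_fun setT y ->
  measurable_fun setT (fun t => pcomb (a t) (b t) (x t) (y t)).
Proof.
move=> ma mb mx my.
by apply: measurable_fun_pair; apply: measurable_comb => //; exact: measurableT_comp.
Qed.

Lemma preserves_pcomb a y : preserves mu (fun x => pcomb 1 a x y).
Proof.
apply: (@preserves_prod _ _ _ _ _ _ (fun x => comb 1 a x y.1) (fun x => comb 1 a x y.2));
exact: preserves_translation.
Qed.

Lemma pcomb10 x y : pcomb 1 0 x y = x.
Proof. by case: x => ? ?; rewrite /pcomb !comb10. Qed.

Lemma pcombC a b x y : pcomb a b x y = pcomb b a y x.
Proof. by rewrite /pcomb combC; congr pair; rewrite combC. Qed.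

Lemma pcomb_comp a b a1 b1 a2 b2 x y :
  pcomb a b (pcomb a1 b1 x y) (pcomb a2 b2 x y)
  = pcomb (a * a1 + b * a2) (a * b1 + b * b2) x y.
Proof. by rewrite /pcomb /= !comb_comp. Qed.

(** Pairs form a space of the same kind, so that rotations also apply to pairs
    of complex vectors. *)
Definition pair_space : haar_space :=
  @HaarSpace _ (V * V)%type
    (prodm (hs_measure V) (hs_measure V)) pcomb
    measurable_pcomb pcomb10 pcombC pcomb_comp preserves_pcomb.

Lemma integral_indicM d (X : measurableType d) (m : {measure set X -> \bar R})
    (D : set X) (g : X -> \bar R) :
  (\int[m]_x ((\1_D x)%:E * g x) = \int[m]_(x in D) g x)%E.
Proof.
rewrite [RHS]integral_mkcond; apply: eq_integral => x _.
by rewrite patchE indicE; case: (x \in D); rewrite ?mul1e ?mul0e.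
Qed.

(** By Fubini, the average of F over its rotations has the integral of F, since
    every rotation preserves the measure. *)
Lemma rotation_average (F : V * V -> R) (M : V * V -> R) :
  mu.-integrable setT (EFin \o F) ->
  (forall p, continuous (fun t : R => F (rot2 (cos (2 * pi * t)) (sin (2 * pi * t)) p))) ->
  (forall p, itg (fun t => F (rot2 (cos (2 * pi * t)) (sin (2 * pi * t)) p)) 0 1 = M p) ->
  (\int[mu]_p (F p)%:E = \int[mu]_p (M p)%:E)%E.
Proof.
move=> iF cF FM.
pose rt (t : R) := rot2 (cos (2 * pi * t)) (sin (2 * pi * t)).
have rtP t : preserves mu (rt t) by apply: preserves_rot2; exact: cos2Dsin2.
set L := @lebesgue_measure R.
pose D : set (measurableTypeR R) := `[0, 1]%classic.
pose H (x : measurableTypeR R * (V * V)) : \bar R := ((\1_D x.1)%:E * (F (rt x.1 x.2))%:E)%E.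
have mF : measurable_fun setT F by exact/measurable_EFinP/measurable_int/iF.
have LD : L D = 1%E by rewrite /L lebesgue_measure_itv /= lte_fin ltr01 -EFinB subr0.
have mrt : measurable_fun setT (fun x : measurableTypeR R * (V * V) => rt x.1 x.2).
  have mt (f : R -> R) : continuous f -> measurable_fun setT
      (fun x : measurableTypeR R * (V * V) => f (2 * pi * x.1)).
    move=> cf; apply: (measurableT_comp (f := f)); first exact: continuous_measurable_fun.
    exact: measurable_funM.
  apply: measurable_fun_pair; apply: measurable_comb.
  - exact: (mt _ (@continuous_cos R)).
  - by apply: measurableT_comp => //; exact: (mt _ (@continuous_sin R)).
  - by apply: measurableT_comp.
  - by apply: measurableT_comp.
  - exact: (mt _ (@continuous_sin R)).
  - exact: (mt _ (@continuous_cos R)).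
  - by apply: measurableT_comp.
  - by apply: measurableT_comp.
have mH : measurable_fun setT H.
  apply: emeasurable_funM; apply/measurable_EFinP.
    apply: (measurableT_comp (f := \1_D : measurableTypeR R -> R)).
      by apply: measurable_indic; exact: measurable_itv.
    exact: measurable_fst.
  exact: measurableT_comp.
have iH : (L \x mu)%E.-integrable setT H.
  apply/integrable12ltyP => //.
  have -> : (\int[L]_x \int[mu]_y `|H (x, y)|
     = \int[L]_(x in D) \int[mu]_y `|(F y)%:E|)%E.
    rewrite -[RHS]integral_indicM; apply: eq_integral => t _.
    rewrite -(ge0_integral_preserves (rtP t) (f := fun y => `|(F y)%:E|%E))//; last first.
      by apply: measurableT_comp => //; exact/measurable_EFinP.
    rewrite /H -ge0_integralZl//.
    - apply: eq_integral => y _; rewrite abseM; congr (_ * _)%E.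
      by rewrite gee0_abs.
    - by apply: measurableT_comp => //; apply/measurable_EFinP; apply: measurableT_comp => //; exact: (rtP t).1.
  rewrite integral_cst; last exact: measurable_itv.
  rewrite [X in (_ * X)%E](_ : _ = 1%E) ?mule1; last exact: LD.
  by have /integrableP[] := iF.
have := Fubini iH.
have -> : (\int[L]_x \int[mu]_y H (x, y) = \int[mu]_y (F y)%:E)%E.
  transitivity (\int[L]_(x in D) \int[mu]_y (F y)%:E)%E; last first.
    rewrite integral_cst; last exact: measurable_itv.
    by rewrite [X in (_ * X)%E](_ : _ = 1%E) ?mule1; last exact: LD.
  rewrite -[RHS]integral_indicM; apply: eq_integral => t _.
  rewrite -[X in (_ * X)%E](integral_preserves (rtP t) iF).
  by rewrite -integralZl//; exact: (integrable_preserves (rtP t) iF).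
move=> ->; apply: eq_integral => p _.
rewrite /H /= integral_indicM -FM /itg /Rintegral fineK//.
apply: integrable_fin_num => //.
exact: (continuous_integrable_itv 0 1 (cF p)).
Qed.

End rotation.

End Preserve.


(** * Vectors, real linear forms and measurability *)

Section Topo.
Variable R : realType.
Local Notation C := R[i].
Local Notation normc := (@Normc.normc R).
Variable n : nat.
Implicit Types (z w : 'rV[C]_n).

Lemma normc_sqrE (z : C) : normc z ^+ 2 = complex.Re z ^+ 2 + complex.Im z ^+ 2.
Proof. by case: z => a b; exact: normc_complex_sqr. Qed.

Lemma sqnorm_ge0 z : 0 <= sqnorm z.
Proof. by apply: sumr_ge0 => j _; exact: sqr_ge0. Qed.

Lemma sqnormE z : sqnorm z = \sum_j (complex.Re (z 0 j) ^+ 2 + complex.Im (z 0 j) ^+ 2).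
Proof. by apply: eq_bigr => j _; exact: normc_sqrE. Qed.

Lemma sqnorm_eq0 z : (sqnorm z == 0) = (z == 0).
Proof.
rewrite psumr_eq0 => [|j _]; last exact: sqr_ge0.
apply/allP/eqP => [h|-> j _]; last by rewrite mxE Normc.normc0 expr0n eqxx.
apply/rowP => j; rewrite mxE; apply: Normc.eq0_normc.
by apply/eqP; rewrite -sqrf_eq0; apply: (h j); rewrite mem_index_enum.
Qed.

Lemma sqnorm0 : sqnorm (0 : 'rV[C]_n) = 0.
Proof. by apply/eqP; rewrite sqnorm_eq0. Qed.

Lemma sqnorm_gt0 z : (0 < sqnorm z) = (z != 0).
Proof. by rewrite lt_def sqnorm_ge0 andbT sqnorm_eq0. Qed.

Lemma sqnormZ (a : C) z : sqnorm (a *: z) = normc a ^+ 2 * sqnorm z.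
Proof. by rewrite mulr_sumr; apply: eq_bigr => j _; rewrite mxE Normc.normcM exprMn. Qed.

Lemma sqnormN z : sqnorm (- z) = sqnorm z.
Proof. by apply: eq_bigr => j _; rewrite mxE normcN. Qed.

Lemma sqnormD_le z w : sqnorm (z + w) <= 2 * sqnorm z + 2 * sqnorm w.
Proof.
rewrite !sqnormE !mulr_sumr -big_split /=; apply: ler_sum => j _; rewrite mxE.
case: (z 0 j) (w 0 j) => [a b] [c d] /=.
have := sqr_ge0 (a - c); have := sqr_ge0 (b - d); rewrite !expr2; lra.
Qed.

Lemma sqnormB_le z w : sqnorm (z - w) <= 2 * sqnorm z + 2 * sqnorm w.
Proof. by have := sqnormD_le z (- w); rewrite sqnormN. Qed.

Lemma ball_complexE (x e y : C) : ball x e y = (`|x - y| < e).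
Proof. by []. Qed.

Lemma nbhs_sqnorm z (A : set 'rV[C]_n) : nbhs z A ->
  exists2 r : R, 0 < r & forall w, sqnorm (w - z) < r -> A w.
Proof.
move=> /nbhs_ballP[e e0 H]; set r := complex.Re e.
have eE : e = r%:C.
  by move: e0; rewrite /r; case: (e) => a b; rewrite /= ltcE /= => /andP[/eqP -> _].
have r0 : 0 < r by move: e0; rewrite eE /= ltcR.
exists (r ^+ 2) => [|w wz]; first exact: exprn_gt0.
apply: H; split=> // i j; rewrite !ord1 ball_complexE eE normr_normc ltcR.
rewrite -(@ltr_pXn2r _ 2) ?nnegrE ?normc_ge0 ?(ltW r0)//.
apply: le_lt_trans wz; rewrite /sqnorm (bigD1 j)//= ler_wpDr//.
  by apply: sumr_ge0 => k _; exact: sqr_ge0.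
by rewrite !mxE -normcN opprB.
Qed.

Lemma continuous_Re : continuous (@complex.Re R : C -> R).
Proof.
move=> z A /nbhs_ballP[e e0 H]; apply/nbhs_ballP.
exists e%:C => [|w]; first by rewrite /= ltcR.
rewrite ball_complexE normr_normc ltcR => zw; apply: H.
rewrite -ball_normE /=; apply: le_lt_trans zw.
by case: z w => [? ?] [? ?]; apply: le_trans (normr_Re _).
Qed.

Lemma continuous_Im : continuous (@complex.Im R : C -> R).
Proof.
move=> z A /nbhs_ballP[e e0 H]; apply/nbhs_ballP.
exists e%:C => [|w]; first by rewrite /= ltcR.
rewrite ball_complexE normr_normc ltcR => zw; apply: H.
rewrite -ball_normE /=; apply: le_lt_trans zw.
by case: z w => [? ?] [? ?]; apply: le_trans (normr_Im _).
Qed.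

Lemma continuous_Re_coord j : continuous (fun z => complex.Re (z 0 j)).
Proof.
by move=> z; apply: (continuous_comp (f := fun z : 'rV[C]_n => z 0 j));
  [exact: coord_continuous|exact: continuous_Re].
Qed.

Lemma continuous_Im_coord j : continuous (fun z => complex.Im (z 0 j)).
Proof.
by move=> z; apply: (continuous_comp (f := fun z : 'rV[C]_n => z 0 j));
  [exact: coord_continuous|exact: continuous_Im].
Qed.

Lemma holomorphic_continuous (u : 'rV[C]_n -> C) : holomorphic u -> continuous u.
Proof. by move=> hu z; exact: (differentiable_continuous (hu z)). Qed.

End Topo.

Section Forms.
Variable R : realType.
Local Notation C := R[i].
Local Notation normc := (@Normc.normc R).
Variable n : nat.
Local Notation V := 'rV[C]_n.
Implicit Types (x y z w : V) (l : V -> R) (b : V -> V -> R).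

Definition rlin l :=
  (forall x y, l (x + y) = l x + l y) /\ (forall (t : R) x, l (t%:C *: x) = t * l x).

Definition rbil b := (forall y, rlin (b^~ y)) /\ (forall x y, b x y = b y x).

Lemma rlin0 l : rlin l -> l 0 = 0.
Proof. by case=> _ /(_ 0 0); rewrite scale0r mul0r. Qed.

Lemma rlinN l x : rlin l -> l (- x) = - l x.
Proof.
by case=> _ /(_ (-1) x); rewrite rmorphN rmorph1 scaleN1r mulN1r.
Qed.

Lemma rlinB l x y : rlin l -> l (x - y) = l x - l y.
Proof. by move=> h; rewrite h.1 rlinN. Qed.

Lemma rlin_sum l (I : Type) (r : seq I) (F : I -> V) : rlin l ->
  l (\sum_(i <- r) F i) = \sum_(i <- r) l (F i).
Proof.
move=> h; elim: r => [|i r IH]; first by rewrite !big_nil rlin0.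
by rewrite !big_cons h.1 IH.
Qed.

Lemma rlin_coord l z : rlin l ->
  l z = \sum_j (complex.Re (z 0 j) * l (delta_mx 0 j)
              + complex.Im (z 0 j) * l ('i%C *: delta_mx 0 j)).
Proof.
move=> h; rewrite {1}[z]row_sum_delta rlin_sum//; apply: eq_bigr => j _.
by rewrite {1}[z 0 j]complexE ['i%C * _]mulrC scalerDl h.1 -scalerA !h.2.
Qed.

(** Measurability and continuity of linear and bilinear expressions are proved
    at once, for any class Q of functions containing the constants and closed
    under sums and products. *)
Section closed_class.
Variables (T : Type) (Q : (T -> R) -> Prop).
Hypothesis Qcst : forall r, Q (fun=> r).
Hypothesis QD : forall f g, Q f -> Q g -> Q (fun t => f t + g t).
Hypothesis QM : forall f g, Q f -> Q g -> Q (fun t => f t * g t).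

Lemma rlin_class l (X : T -> V) : rlin l ->
  (forall j, Q (fun t => complex.Re (X t 0 j))) ->
  (forall j, Q (fun t => complex.Im (X t 0 j))) -> Q (fun t => l (X t)).
Proof.
move=> hl QRe QIm.
rewrite (_ : (fun t => _) = fun t => \sum_j (complex.Re (X t 0 j) * l (delta_mx 0 j)
   + complex.Im (X t 0 j) * l ('i%C *: delta_mx 0 j))); last first.
  by apply/funext => t; exact: rlin_coord.
elim: (index_enum _) => [|j r IH].
  by rewrite (_ : (fun t => _) = fun=> 0)//; apply/funext => t; rewrite big_nil.
rewrite (_ : (fun t => _) = fun t => (complex.Re (X t 0 j) * l (delta_mx 0 j)
   + complex.Im (X t 0 j) * l ('i%C *: delta_mx 0 j)) + \sum_(j <- r) (complex.Re (X t 0 j) * l (delta_mx 0 j)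
   + complex.Im (X t 0 j) * l ('i%C *: delta_mx 0 j))); last first.
  by apply/funext => t; rewrite big_cons.
by apply: QD => //; apply: QD; apply: QM.
Qed.

End closed_class.

End Forms.

Section closed_class_bilinear.
Variable R : realType.
Local Notation C := R[i].
Variables (T : Type) (Q : (T -> R) -> Prop).
Hypothesis Qcst : forall r, Q (fun=> r).
Hypothesis QD : forall f g, Q f -> Q g -> Q (fun t => f t + g t).
Hypothesis QM : forall f g, Q f -> Q g -> Q (fun t => f t * g t).

Lemma rbil_class n m (b : 'rV[C]_n -> 'rV[C]_m -> R) (X : T -> 'rV[C]_n) (Y : T -> 'rV[C]_m) :
  (forall y, rlin (b^~ y)) -> (forall x, rlin (b x)) ->
  (forall j, Q (fun t => complex.Re (X t 0 j))) ->
  (forall j, Q (fun t => complex.Im (X t 0 j))) ->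
  (forall j, Q (fun t => complex.Re (Y t 0 j))) ->
  (forall j, Q (fun t => complex.Im (Y t 0 j))) ->
  Q (fun t => b (X t) (Y t)).
Proof.
move=> hl hr QX1 QX2 QY1 QY2.
have Qb x : Q (fun t => b x (Y t)) by exact: (rlin_class Qcst QD QM (hr x)).
rewrite (_ : (fun t => _) = fun t => \sum_j (complex.Re (X t 0 j) * b (delta_mx 0 j) (Y t)
   + complex.Im (X t 0 j) * b ('i%C *: delta_mx 0 j) (Y t))); last first.
  by apply/funext => t; exact: (rlin_coord _ (hl (Y t))).
elim: (index_enum _) => [|j r IH].
  by rewrite (_ : (fun t => _) = fun=> 0)//; apply/funext => t; rewrite big_nil.
rewrite (_ : (fun t => _) = fun t => (complex.Re (X t 0 j) * b (delta_mx 0 j) (Y t)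
   + complex.Im (X t 0 j) * b ('i%C *: delta_mx 0 j) (Y t)) + \sum_(j <- r) (complex.Re (X t 0 j) * b (delta_mx 0 j) (Y t)
   + complex.Im (X t 0 j) * b ('i%C *: delta_mx 0 j) (Y t))); last first.
  by apply/funext => t; rewrite big_cons.
by apply: QD => //; apply: QD; apply: QM.
Qed.

End closed_class_bilinear.

Section Meas.
Variable R : realType.
Local Notation C := R[i].
Local Notation normc := (@Normc.normc R).

Definition mvec d (T : measurableType d) n (X : T -> 'rV[C]_n) :=
  forall j, measurable_fun setT (fun t => complex.Re (X t 0 j)) /\
            measurable_fun setT (fun t => complex.Im (X t 0 j)).

Section countable.
Context d (T : measurableType d) (I : countType) (X : T -> I).
Hypothesis mX : forall i, measurable (X @^-1` [set i]).

Lemma measurable_countable_range (g : I -> R) : measurable_fun setT (g \o X).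
Proof.
move=> _ B mB; rewrite setTI.
have -> : (g \o X) @^-1` B = \bigcup_i (if `[< B (g i) >] then X @^-1` [set i] else set0).
  apply/seteqP; split=> t /=.
    by move=> Bt; exists (X t) => //; case: asboolP.
  by move=> [i _]; case: asboolP => // Bi ->.
apply: countable_bigcupT_measurable; first exact: countableP.
by move=> i; case: asboolP.
Qed.

End countable.

Definition grid (k : nat) (x : R) : R := (Num.floor (k.+1%:R * x))%:~R / k.+1%:R.

Lemma grid_near k x : `|grid k x - x| <= k.+1%:R^-1.
Proof.
rewrite /grid; have /andP[h1 h2] := floor_itv (k.+1%:R * x).
have k0 : 0 < k.+1%:R :> R by [].
have -> : (Num.floor (k.+1%:R * x))%:~R / k.+1%:R - x
   = ((Num.floor (k.+1%:R * x))%:~R - k.+1%:R * x) / k.+1%:R.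
  by rewrite mulrBl mulrAC divff ?mul1r// gt_eqF.
rewrite normrM normfV (ger0_norm (ltW k0)) ler_pdivrMr// mulVf ?gt_eqF//.
by rewrite ler_norml; move: h1 h2; rewrite intrD; lra.
Qed.

(** A continuous function of a vector with measurable coordinates is the
    pointwise limit of the functions obtained by rounding the coordinates down
    to finer and finer grids; these take countably many values. *)
Lemma measurable_continuous_mvec d (T : measurableType d) n (X : T -> 'rV[C]_n)
    (f : 'rV[C]_n -> R) :
  mvec X -> continuous f -> measurable_fun setT (fun t => f (X t)).
Proof.
move=> mX cf.
pose I := {ffun 'I_n -> int * int}.
pose idx k t : I := [ffun j => (Num.floor (k.+1%:R * complex.Re (X t 0 j)),
                                Num.floor (k.+1%:R * complex.Im (X t 0 j)))].
pose pt k (i : I) : 'rV[C]_n :=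
  \row_j (((i j).1%:~R / k.+1%:R) +i* ((i j).2%:~R / k.+1%:R)).
apply: (@measurable_fun_cvg _ _ _ _ (fun k t => f (pt k (idx k t)))) => [k|t _].
  apply: (measurable_countable_range (X := idx k) _ (fun i => f (pt k i))) => i.
  have -> : idx k @^-1` [set i] = \bigcap_(j in [set: 'I_n])
     ((fun t => k.+1%:R * complex.Re (X t 0 j)) @^-1` `[(i j).1%:~R, ((i j).1 + 1)%:~R[
      `&` (fun t => k.+1%:R * complex.Im (X t 0 j)) @^-1` `[(i j).2%:~R, ((i j).2 + 1)%:~R[).
    apply/seteqP; split=> t /=.
      by move=> <- j _; rewrite /= !ffunE /= !in_itv/=; split; exact: floor_itv.
    move=> H; apply/ffunP => j; rewrite ffunE; have := H j Logic.I.
    rewrite /= !in_itv/= => -[h1 h2].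
    by rewrite (Num.Theory.floor_def h1) (Num.Theory.floor_def h2) -surjective_pairing.
  apply: fin_bigcap_measurable => // j _; have [m1 m2] := mX j.
  apply: measurableI; rewrite -[X in measurable X]setTI.
    by apply: (measurable_funM _ m1) => //; exact: measurable_itv.
  by apply: (measurable_funM _ m2) => //; exact: measurable_itv.
apply/cvgrPdist_lt => e e0.
have := cf (X t); move/cvgrPdist_lt => /(_ _ e0) /nbhs_sqnorm[r r0 H].
have [N HN] : exists N : nat, forall k, (N <= k)%N -> n%:R * (2 / k.+1%:R) < r.
  exists (Num.bound (n%:R * 2 / r)) => k Nk.
  rewrite mulrA ltr_pdivrMr// [r * _]mulrC -ltr_pdivrMr//.
  apply: lt_le_trans (archi_boundP _) _; first by rewrite divr_ge0 ?mulr_ge0// ltW.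
  by rewrite ler_nat (leq_trans Nk).
exists N => // k Nk; rewrite -normrN opprB.
suff : `|f (X t) - f (pt k (idx k t))| < e by rewrite distrC.
apply: H; apply: le_lt_trans (HN _ Nk).
rewrite sqnormE.
apply: le_trans (_ : \sum_(j < n) 2 / k.+1%:R <= _); last first.
  by rewrite big_const_ord iter_addr_0 -[leLHS]mulr_natl.
apply: ler_sum => j _; rewrite !mxE !ffunE /=.
have := grid_near k (complex.Re (X t 0 j)); have := grid_near k (complex.Im (X t 0 j)).
rewrite /grid; case: (X t 0 j) => a b /=.
move=> hb ha.
have k1 : k.+1%:R^-1 <= 1 :> R by rewrite invf_le1// ler1n.
have sq (c : R) : `|c| <= k.+1%:R^-1 -> c ^+ 2 <= k.+1%:R^-1.
  move=> hc; rewrite -real_normK ?num_real// expr2.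
  by apply: le_trans (ler_pM _ _ hc (le_trans hc k1)) _; rewrite ?mulr1.
apply: le_trans (lerD (sq _ ha) (sq _ hb)) _.
by rewrite mulrDl mul1r.
Qed.

End Meas.


(** * Integrals of complex functions *)

Section Integ.
Variable R : realType.
Local Notation C := R[i].
Local Notation normc := (@Normc.normc R).

Definition integ d (T : measurableType d) (mu : {measure set T -> \bar R})
  (f : T -> R) := mu.-integrable setT (EFin \o f).

Section one.
Context d (T : measurableType d) (mu : {measure set T -> \bar R}).
Implicit Types f g : T -> R.

Lemma integ_measurable f : integ mu f -> measurable_fun setT f.
Proof. by move=> h; exact/measurable_EFinP/measurable_int/h. Qed.

Lemma integ_le f g : measurable_fun setT f -> (forall x, `|f x| <= g x) ->
  integ mu g -> integ mu f.
Proof.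
move=> mf fg; apply: le_integrable => //; first exact/measurable_EFinP.
by move=> x _; rewrite lee_fin; apply: le_trans (fg x) (ler_norm _).
Qed.

Lemma ge0_integ f : measurable_fun setT f -> (forall x, 0 <= f x) ->
  (\int[mu]_x (f x)%:E < +oo)%E -> integ mu f.
Proof.
move=> mf f0 foo; apply/integrableP; split; first exact/measurable_EFinP.
by under eq_integral do rewrite /= ger0_norm//.
Qed.

Lemma integE f : integ mu f -> ((Rintegral mu setT f)%:E = \int[mu]_x (f x)%:E)%E.
Proof. by move=> h; rewrite /Rintegral fineK//; exact: integrable_fin_num. Qed.

Lemma integZ (k : R) f : integ mu f -> integ mu (fun x => k * f x).
Proof. exact: integrableZl. Qed.

Lemma integD f g : integ mu f -> integ mu g -> integ mu (fun x => f x + g x).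
Proof. by move=> hf hg; exact: (integrableD measurableT hf hg). Qed.

End one.

Section two.
Context d1 d2 (T1 : measurableType d1) (T2 : measurableType d2).
Variables (m1 : {sigma_finite_measure set T1 -> \bar R})
          (m2 : {sigma_finite_measure set T2 -> \bar R}).
Implicit Types f : T1 * T2 -> R.

Lemma Rintegral_prodm12 f : integ (prodm m1 m2) f ->
  (forall x, integ m2 (fun y => f (x, y))) ->
  Rintegral (prodm m1 m2) setT f
  = Rintegral m1 setT (fun x => Rintegral m2 setT (fun y => f (x, y))).
Proof.
move=> fi f2; congr fine.
transitivity (\int[m1]_x \int[m2]_y (f (x, y))%:E)%E.
  by rewrite -(integral12_prod_meas1 (f := EFin \o f)).
by apply: eq_integral => x _; rewrite integE.
Qed.

Lemma Rintegral_prodm21 f : integ (prodm m1 m2) f ->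
  (forall y, integ m1 (fun x => f (x, y))) ->
  Rintegral (prodm m1 m2) setT f
  = Rintegral m2 setT (fun y => Rintegral m1 setT (fun x => f (x, y))).
Proof.
move=> fi f1; congr fine.
transitivity (\int[m2]_y \int[m1]_x (f (x, y))%:E)%E.
  by rewrite -(integral21_prod_meas1 (f := EFin \o f)).
by apply: eq_integral => y _; rewrite integE.
Qed.

Lemma integ_prodm (f : T1 -> R) (g : T2 -> R) : integ m1 f -> integ m2 g ->
  integ (prodm m1 m2) (fun p => f p.1 * g p.2).
Proof.
move=> fi gi.
have mf := integ_measurable fi; have mg := integ_measurable gi.
apply/integrable12ltyP.
  apply/measurable_EFinP; apply: measurable_funM.
    by apply: measurableT_comp => //; exact: measurable_fst.
  by apply: measurableT_comp => //; exact: measurable_snd.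
have -> : (\int[m1]_x \int[m2]_y `|(EFin \o (fun p => (f p.1 * g p.2)%R)) (x, y)|
  = \int[m1]_x (`|(f x)%:E| * \int[m2]_y `|(g y)%:E|))%E.
  apply: eq_integral => x _; rewrite -ge0_integralZl//.
    by apply: eq_integral => y _; rewrite /= normrM.
  by apply: measurableT_comp => //; exact/measurable_EFinP.
have /integrableP[_ foo] := fi; have /integrableP[_ goo] := gi.
rewrite ge0_integralZr//; last exact: integral_ge0.
  by apply: lte_mul_pinfty => //; [exact: integral_ge0|rewrite ge0_fin_numE//; exact: integral_ge0].
by apply: measurableT_comp => //; exact/measurable_EFinP.
Qed.

End two.

Definition cmeas d (T : measurableType d) (f : T -> C) :=
  measurable_fun setT (fun t => complex.Re (f t)) /\
  measurable_fun setT (fun t => complex.Im (f t)).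

Section cmeas.
Context d (T : measurableType d).
Implicit Types f g : T -> C.

Lemma cmeas_cst (c : C) : cmeas (fun _ : T => c).
Proof. by split; exact: measurable_cst. Qed.

Lemma cmeas_real (f : T -> R) : measurable_fun setT f -> cmeas (fun t => (f t)%:C).
Proof. by move=> mf; split=> //=; exact: measurable_cst. Qed.

Lemma cmeasD f g : cmeas f -> cmeas g -> cmeas (fun t => f t + g t).
Proof.
move=> [f1 f2] [g1 g2]; split.
  rewrite (_ : (fun t => _) = fun t => complex.Re (f t) + complex.Re (g t)).
    exact: measurable_funD.
  by apply/funext => t; case: (f t) (g t) => [? ?] [? ?].
rewrite (_ : (fun t => _) = fun t => complex.Im (f t) + complex.Im (g t)).
  exact: measurable_funD.
by apply/funext => t; case: (f t) (g t) => [? ?] [? ?].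
Qed.

Lemma cmeasM f g : cmeas f -> cmeas g -> cmeas (fun t => f t * g t).
Proof.
move=> [f1 f2] [g1 g2]; split.
  rewrite (_ : (fun t => _) = fun t =>
      complex.Re (f t) * complex.Re (g t) - complex.Im (f t) * complex.Im (g t)).
    by apply: measurable_funB; exact: measurable_funM.
  by apply/funext => t; case: (f t) (g t) => [? ?] [? ?].
rewrite (_ : (fun t => _) = fun t =>
    complex.Re (f t) * complex.Im (g t) + complex.Im (f t) * complex.Re (g t)).
  by apply: measurable_funD; exact: measurable_funM.
by apply/funext => t; case: (f t) (g t) => [? ?] [? ?].
Qed.

Lemma cmeas_cexp f : cmeas f -> cmeas (fun t => cexp (f t)).
Proof.
move=> [f1 f2]; apply: cmeasM.
  apply: cmeas_real; apply: (measurableT_comp (f := @expR R)) => //.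
split=> /=.
  apply: (measurableT_comp (f := @cos R)) => //.
  by apply: continuous_measurable_fun; exact: continuous_cos.
apply: (measurableT_comp (f := @sin R)) => //.
  by apply: continuous_measurable_fun; exact: continuous_sin.
Qed.

Lemma cmeas_conj f : cmeas f -> cmeas (fun t => (f t)^*%C).
Proof.
move=> [f1 f2]; split.
  by rewrite (_ : (fun t => _) = fun t => complex.Re (f t))//; apply/funext => t; case: (f t).
rewrite (_ : (fun t => _) = fun t => - complex.Im (f t)).
  exact: measurable_funN.
by apply/funext => t; case: (f t).
Qed.

End cmeas.

Definition cinteg d (T : measurableType d) (mu : {measure set T -> \bar R})
  (f : T -> C) := integ mu (fun x => complex.Re (f x)) /\
                  integ mu (fun x => complex.Im (f x)).

Section cinteg.
Context d (T : measurableType d) (mu : {measure set T -> \bar R}).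
Implicit Types f : T -> C.

Lemma cinteg_le f g : cmeas f -> (forall x, normc (f x) <= g x) ->
  integ mu g -> cinteg mu f.
Proof.
move=> [f1 f2] fg gi; split; apply: integ_le gi => // x; apply: le_trans (fg x).
  exact: normr_Re.
exact: normr_Im.
Qed.

(** The factor 2 comes from estimating real and imaginary part separately. *)
Lemma Cintegral_bound f (g : T -> R) : cmeas f -> (forall x, normc (f x) <= g x) ->
  integ mu g -> normc (Cintegral mu f) <= 2 * Rintegral mu setT g.
Proof.
move=> mf fg gi; have [f1 f2] := cinteg_le mf fg gi.
apply: le_trans (normc_le_ReIm _) _; rewrite /= mulr_natl mulr2n; apply: lerD.
  apply: le_trans (le_normr_Rintegral _ f1) _ => //.
  apply: le_Rintegral => //; first exact: integrable_norm.
  by move=> x _; apply: le_trans (fg x); exact: normr_Re.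
apply: le_trans (le_normr_Rintegral _ f2) _ => //.
apply: le_Rintegral => //; first exact: integrable_norm.
by move=> x _; apply: le_trans (fg x); exact: normr_Im.
Qed.

Lemma eq_Cintegral f g : f =1 g -> Cintegral mu f = Cintegral mu g.
Proof. by move=> fg; congr Cintegral; exact/funext. Qed.

Lemma CintegralZ (c : C) f : cinteg mu f ->
  Cintegral mu (fun x => c * f x) = c * Cintegral mu f.
Proof.
move=> [f1 f2]; case: c => a b; rewrite /Cintegral.
transitivity ((a * Rintegral mu setT (fun x => complex.Re (f x))
    - b * Rintegral mu setT (fun x => complex.Im (f x)))
  +i* (a * Rintegral mu setT (fun x => complex.Im (f x))
    + b * Rintegral mu setT (fun x => complex.Re (f x)))) => //.
rewrite -!RintegralZl//.
rewrite -RintegralB//; [|exact: integZ..].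
rewrite -RintegralD//; [|exact: integZ..].
by congr Complex; apply: eq_Rintegral => x _; case: (f x).
Qed.

End cinteg.

Section cfubini.
Context d1 d2 (T1 : measurableType d1) (T2 : measurableType d2).
Variables (m1 : {sigma_finite_measure set T1 -> \bar R})
          (m2 : {sigma_finite_measure set T2 -> \bar R}).
Implicit Types f : T1 * T2 -> C.

Lemma Cintegral_prodm12 f : cinteg (prodm m1 m2) f ->
  (forall x, cinteg m2 (fun y => f (x, y))) ->
  Cintegral (prodm m1 m2) f
  = Cintegral m1 (fun x => Cintegral m2 (fun y => f (x, y))).
Proof.
move=> [f1 f2] h; rewrite [LHS]/Cintegral !Rintegral_prodm12//.
  by move=> x; exact: (h x).2.
by move=> x; exact: (h x).1.
Qed.

Lemma Cintegral_prodm21 f : cinteg (prodm m1 m2) f ->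
  (forall y, cinteg m1 (fun x => f (x, y))) ->
  Cintegral (prodm m1 m2) f
  = Cintegral m2 (fun y => Cintegral m1 (fun x => f (x, y))).
Proof.
move=> [f1 f2] h; rewrite [LHS]/Cintegral !Rintegral_prodm21//.
  by move=> x; exact: (h x).2.
by move=> x; exact: (h x).1.
Qed.

End cfubini.

Section cpreserves.
Context d (T : measurableType d) (mu : {measure set T -> \bar R}) (phi : T -> T).
Hypothesis phiP : preserves mu phi.

Lemma cinteg_preserves f : cinteg mu f -> cinteg mu (f \o phi).
Proof.
move=> [f1 f2]; split.
  exact: (integrable_preserves phiP (f := fun x => (complex.Re (f x))%:E) f1).
exact: (integrable_preserves phiP (f := fun x => (complex.Im (f x))%:E) f2).
Qed.

Lemma Cintegral_preserves f : cinteg mu f ->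
  Cintegral mu (fun x => f (phi x)) = Cintegral mu f.
Proof.
move=> [f1 f2]; rewrite /Cintegral /Rintegral.
congr Complex; congr fine.
  exact: (integral_preserves phiP (f := fun x => (complex.Re (f x))%:E) f1).
exact: (integral_preserves phiP (f := fun x => (complex.Im (f x))%:E) f2).
Qed.

End cpreserves.

End Integ.


(** * Lebesgue measure on complex vectors *)

Section Gauss.
Variable R : realType.
Local Notation C := R[i].
Local Notation normc := (@Normc.normc R).
Local Notation tup n := (n.-tuple (measurableTypeR R)).

Lemma gaussian_integ1 (eps : R) : 0 < eps ->
  integ (@lebesgue_measure R) (fun x => expR (- eps * x ^+ 2)).
Proof.
move=> e0; pose s : R := Num.sqrt (2 * eps)^-1.
have s0 : s != 0 by rewrite gt_eqF// sqrtr_gt0 invr_gt0 mulr_gt0.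
have s2 : s ^+ 2 = (2 * eps)^-1 by rewrite sqr_sqrtr// invr_ge0 mulr_ge0// ltW.
have := integZ (normal_peak s)^-1 (integrable_normal_pdf 0 s).
congr (integ _ _); apply/funext => x; rewrite normal_pdfE//.
rewrite mulrA mulVf ?gt_eqF ?normal_peak_gt0// mul1r /normal_fun subr0 s2.
by congr expR; rewrite -mulr_natl; field; rewrite gt_eqF.
Qed.

Lemma gaussian_integ_leb n (eps : R) : 0 < eps ->
  integ (leb R n) (fun t => expR (- eps * \sum_i tnth t i ^+ 2)).
Proof.
move=> e0; have mf m : measurable_fun setT
    (fun t : tup m => expR (- eps * \sum_i tnth t i ^+ 2)).
  apply: (measurableT_comp (f := @expR R)) => //; apply: measurable_funM => //.
  apply: measurable_sum => i; apply: measurable_funX; exact: measurable_tnth.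
elim: n => [|n IH].
  suff : integ (@dirac _ (tup 0) [tuple] R)
    (fun t => expR (- eps * \sum_i tnth t i ^+ 2)) by [].
  apply: ge0_integ => //; first exact: mf.
  rewrite integral_dirac//=; last by apply/measurable_EFinP; exact: mf.
  by rewrite diracT mul1e ltry.
rewrite /integ /=.
apply: (@integrable_pushforward _ _ _ _ _ (@tcons R n)).
- exact: measurable_tcons.
- by apply/measurable_EFinP; exact: mf.
- rewrite preimage_setT.
  have := integ_prodm (gaussian_integ1 e0) IH.
  congr (_.-integrable _ _); apply/funext => -[x t] /=; congr EFin.
  rewrite big_ord_recl -expRD -mulrDr; congr (expR (_ * (_ + _))).
  by apply: eq_bigr => i _; congr (_ ^+ 2); rewrite [LHS](tnth_nth x) [RHS](tnth_nth x).
- exact: measurableT.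
Qed.

Definition vol n : {sigma_finite_measure set (tup n * tup n)%type -> \bar R} :=
  prodm (leb R n) (leb R n).

Lemma gaussian_integ n (eps : R) : 0 < eps ->
  integ (vol n) (fun p => expR (- eps * sqnorm (cvec p))).
Proof.
move=> e0; have := integ_prodm (gaussian_integ_leb n e0) (gaussian_integ_leb n e0).
congr (integ _ _); apply/funext => -[x y] /=; rewrite -expRD -mulrDr.
congr (expR (_ * _)); rewrite sqnormE -big_split; apply: eq_bigr => j _.
by rewrite !mxE.
Qed.

Lemma leb_setT_gt0 n : (0 < leb R n setT)%E.
Proof.
elim: n => [|n IH]; first by rewrite /= diracT.
rewrite /= /leb_step /pushforward preimage_setT -setXTT product_measure1E//.
apply: mule_gt0 => //.
apply: (@lt_le_trans _ _ (@lebesgue_measure R `[0%R, 1%R]%classic)).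
  by rewrite lebesgue_measure_itv /= lte_fin ltr01 oppr0 adde0 lte_fin.
by apply: le_measure; rewrite ?inE.
Qed.

Lemma Rintegral_gt0 d (T : measurableType d) (mu : {measure set T -> \bar R}) f :
  (0 < mu setT)%E -> integ mu f -> (forall x, 0 < f x) ->
  0 < Rintegral mu setT f.
Proof.
move=> mu0 fi f0; rewrite lt_def Rintegral_ge0 ?andbT => [|x _]; last exact: ltW.
apply/negP => /eqP h.
have mf := integ_measurable fi.
have : (\int[mu]_(x in setT) `|(EFin \o f) x| = 0)%E.
  transitivity (\int[mu]_x (f x)%:E)%E.
    by apply: eq_integral => x _; rewrite /= ger0_norm// ltW.
  by rewrite -integE// h.
move/ae_eq_integral_abs => /(_ measurableT).
case; first exact/measurable_EFinP.
move=> N [mN N0 sub].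
suff : mu setT = 0 by move=> h0; move: mu0; rewrite h0 ltxx.
apply/eqP; rewrite -measure_le0 -N0; apply: le_measure; rewrite ?inE//.
by move=> x _; apply: sub => /= /(_ I) [] /eqP; rewrite gt_eqF.
Qed.

Lemma vol_setT_gt0 n : (0 < vol n setT)%E.
Proof.
suff : (0 < (leb R n \x leb R n) setT)%E by [].
by rewrite -setXTT product_measure1E//; apply: mule_gt0; exact: leb_setT_gt0.
Qed.

End Gauss.

Section Vol.
Variable R : realType.
Local Notation C := R[i].
Local Notation normc := (@Normc.normc R).
Variable n : nat.
Local Notation V := 'rV[C]_n.
Local Notation tup n := (n.-tuple (measurableTypeR R)).
Implicit Types (z w : V).

Definition vspace := pair_space (tuple_space R n).

Lemma cvec_comb (a b : R) (p q : vspace) :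
  cvec (comb a b p q) = a%:C *: cvec p + b%:C *: cvec q.
Proof.
apply/rowP => j; rewrite !mxE /= !tnth_mktuple.
by apply/eqP; rewrite eq_complex /=; apply/andP; split; apply/eqP; ring.
Qed.

Lemma cvec_rot2 (c s : R) (p : vspace) :
  cvec (rot2 (V := tuple_space R n) c s p) = (c +i* s) *: cvec p.
Proof.
apply/rowP => j; rewrite !mxE /= !tnth_mktuple.
by apply/eqP; rewrite eq_complex /=; apply/andP; split; apply/eqP; ring.
Qed.

Definition coords (z : V) : tup n * tup n :=
  ([tuple complex.Re (z 0 j) | j < n], [tuple complex.Im (z 0 j) | j < n]).

Lemma coordsK z : cvec (coords z) = z.
Proof. by apply/rowP => j; rewrite !mxE !tnth_mktuple; case: (z 0 j). Qed.

Definition vtrans (w : V) (p : tup n * tup n) : tup n * tup n :=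
  comb (h := vspace) 1 1 p (coords w).

Lemma cvec_vtrans w p : cvec (vtrans w p) = cvec p + w.
Proof. by rewrite /vtrans cvec_comb coordsK !scale1r. Qed.

Lemma preserves_vtrans w : preserves (vol R n) (vtrans w).
Proof. exact: (preserves_translation (h := vspace)). Qed.

Lemma mvec_cvec d (T : measurableType d) (f : T -> tup n * tup n) :
  measurable_fun setT f -> mvec (fun t => cvec (f t)).
Proof.
move=> mf j; split.
  rewrite (_ : (fun t => _) = fun t => tnth (f t).1 j); last by apply/funext => t; rewrite mxE.
  apply: (measurableT_comp (f := fun x : tup n => tnth x j)); first exact: measurable_tnth.
  exact: measurableT_comp.
rewrite (_ : (fun t => _) = fun t => tnth (f t).2 j); last by apply/funext => t; rewrite mxE.
apply: (measurableT_comp (f := fun x : tup n => tnth x j)); first exact: measurable_tnth.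
exact: measurableT_comp.
Qed.

Lemma measurable_vol (f : V -> R) : continuous f ->
  measurable_fun setT (fun p : tup n * tup n => f (cvec p)).
Proof. by move=> cf; apply: measurable_continuous_mvec => //; exact: mvec_cvec. Qed.

Lemma continuous_class (T : topologicalType) :
  [/\ forall r : R, continuous (fun _ : T => r),
      forall f g : T -> R, continuous f -> continuous g -> continuous (fun t => f t + g t)
    & forall f g : T -> R, continuous f -> continuous g -> continuous (fun t => f t * g t)].
Proof.
split=> [r|f g cf cg|f g cf cg]; first exact: cst_continuous.
  by move=> x; apply: cvgD; [exact: cf|exact: cg].
by move=> x; apply: cvgM; [exact: cf|exact: cg].
Qed.

Lemma continuous_rbil (b : V -> V -> R) : rbil b -> continuous (fun z => b z z).
Proof.
move=> [b1 bC]; have [c1 c2 c3] := continuous_class V.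
apply: (rbil_class c1 c2 c3) => // [x|j|j|j|j].
- by split=> [y z|t y]; rewrite bC ?(b1 x).1 ?(b1 x).2 !(bC x).
- exact: continuous_Re_coord.
- exact: continuous_Im_coord.
- exact: continuous_Re_coord.
- exact: continuous_Im_coord.
Qed.

Lemma continuous_sqnorm_affine (a : R) w :
  continuous (fun z : V => sqnorm (a%:C *: z - w)).
Proof.
have [c1 c2 c3] := continuous_class V.
rewrite (_ : (fun z => _) = fun z => \sum_j
    ((a * complex.Re (z 0 j) + - complex.Re (w 0 j)) ^+ 2
   + (a * complex.Im (z 0 j) + - complex.Im (w 0 j)) ^+ 2)); last first.
  apply/funext => z; rewrite sqnormE; apply: eq_bigr => j _; rewrite !mxE.
  by case: (z 0 j) (w 0 j) => [? ?] [? ?] /=; congr (_ ^+ 2 + _ ^+ 2); ring.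
elim: (index_enum _) => [|j r IH].
  by rewrite (_ : (fun z => _) = fun=> 0)//; apply/funext => z; rewrite big_nil.
under eq_fun do rewrite big_cons.
apply: (c2 _ _ _ IH); apply: (c2 (fun z : V => _) (fun z : V => _)).
  by apply: (c3 (fun z : V => _) (fun z : V => _)); apply: (c2 (fun z : V => _) (fun z : V => _)) => //;
    apply: (c3 (fun z : V => _) (fun z : V => _)) => //; exact: continuous_Re_coord.
by apply: (c3 (fun z : V => _) (fun z : V => _)); apply: (c2 (fun z : V => _) (fun z : V => _)) => //;
    apply: (c3 (fun z : V => _) (fun z : V => _)) => //; exact: continuous_Im_coord.
Qed.

Lemma continuous_sqnorm : continuous (@sqnorm R n).
Proof.
have := @continuous_sqnorm_affine 1 0.
rewrite (_ : (fun z => _) = @sqnorm R n)//.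
by apply/funext => z; rewrite scale1r subr0.
Qed.

End Vol.


(** * Growth and conic localization *)

Section Cone.
Variable R : realType.
Local Notation C := R[i].
Local Notation normc := (@Normc.normc R).
Variable n : nat.
Local Notation V := 'rV[C]_n.
Implicit Types (z w : V).

Lemma real_quadratic_rbil (Phi : V -> R) : real_quadratic Phi ->
  exists2 b, rbil b & forall z, Phi z = b z z.
Proof.
move=> [S PhiE].
pose rx (z : V) : 'rV[R]_(n + n) :=
  row_mx (map_mx (@complex.Re R) z) (map_mx (@complex.Im R) z).
have rxD x y : rx (x + y) = rx x + rx y.
  rewrite /rx add_row_mx; congr row_mx; apply/rowP => j; rewrite !mxE;
  by case: (x 0 j) (y 0 j) => [? ?] [? ?].
have rxZ (t : R) x : rx (t%:C *: x) = t *: rx x.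
  rewrite /rx scale_row_mx; congr row_mx; apply/rowP => j; rewrite !mxE;
  by case: (x 0 j) => [? ?] /=; ring.
pose B x y := (rx x *m S *m (rx y)^T) 0 0.
exists (fun x y => (B x y + B y x) / 2); last first.
  by move=> z; rewrite PhiE /B -/(rx z); field.
split=> [y|x y]; last by rewrite addrC.
split=> [x x'|t x]; rewrite /B ?rxD ?rxZ.
  by rewrite linearD /= !mulmxDl mulmxDr !mxE; field.
by rewrite linearZ /= -!scalemxAl -scalemxAr !mxE; field.
Qed.

Lemma continuous_real_quadratic (Phi : V -> R) : real_quadratic Phi -> continuous Phi.
Proof.
move=> /real_quadratic_rbil[b hb PhiE].
by rewrite (_ : Phi = fun z => b z z); [exact: continuous_rbil|exact/funext].
Qed.

Lemma continuous_normc (u : V -> C) : continuous u -> continuous (fun z => normc (u z)).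
Proof.
move=> cu z; have [c1 c2 c3] := continuous_class R V.
have cR : continuous (fun z => complex.Re (u z)).
  by move=> x; apply: (continuous_comp (f := u)); [exact: cu|exact: continuous_Re].
have cI : continuous (fun z => complex.Im (u z)).
  by move=> x; apply: (continuous_comp (f := u)); [exact: cu|exact: continuous_Im].
rewrite (_ : (fun z => _) = Num.sqrt \o (fun z =>
  complex.Re (u z) * complex.Re (u z) + complex.Im (u z) * complex.Im (u z))); last first.
  by apply/funext => x /=; case: (u x) => a b /=; rewrite !expr2.
apply: continuous_comp; last exact: sqrt_continuous.
by apply: (c2 (fun z : V => _) (fun z : V => _)); exact: c3.
Qed.

Lemma cmeas_vol (u : V -> C) : continuous u -> cmeas (fun p : vspace R n => u (cvec p)).
Proof.
move=> cu; split.
  apply: (measurable_vol (f := fun z => complex.Re (u z))) => x.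
  by apply: (continuous_comp (f := u)); [exact: cu|exact: continuous_Re].
apply: (measurable_vol (f := fun z => complex.Im (u z))) => x.
by apply: (continuous_comp (f := u)); [exact: cu|exact: continuous_Im].
Qed.

Lemma continuous_expR_comp (T : topologicalType) (f : T -> R) :
  continuous f -> continuous (fun t => expR (f t)).
Proof.
by move=> cf z; apply: (continuous_comp (f := f)); [exact: cf|exact: continuous_expR].
Qed.

(** Integrability against all Gaussians is the only growth information on an
    element of the union of the weighted spaces that the estimates use. *)
Definition subgaussian (U : V -> R) :=
  forall eps, 0 < eps -> integ (vol R n) (fun p => expR (- eps * sqnorm (cvec p)) * U (cvec p)).

(** Any Gaussian absorbs powers of the weight of the spaces; the inverse is the
    form in which a weighted Cauchy-Schwarz inequality uses it. *)
Lemma japanese_power_bound (s eps : R) : 0 < eps ->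
  exists2 K, 0 < K & forall z, (japanese z `^ (2 * s))^-1 <= K * expR (eps * sqnorm z).
Proof.
move=> e0; pose N := (Num.bound (- s)).+1.
have sN : - s <= N%:R.
  have [s0|s0] := leP 0 (- s); last by apply: le_trans (ltW s0) _.
  by apply: le_trans (ltW (archi_boundP s0)) _; rewrite ler_nat.
have N0 : 0 < N%:R :> R by [].
pose d := eps / N%:R; have d0 : 0 < d by rewrite divr_gt0.
exists (d^-1 ^+ N * expR eps) => [|z]; first by rewrite mulr_gt0 ?expR_gt0// exprn_gt0// invr_gt0.
have q0 := sqnorm_ge0 z.
have J1 : 1 <= japanese z by rewrite -sqrtr1 ler_wsqrtr// lerDl.
rewrite -powRN; apply: le_trans (_ : japanese z `^ (2 * N%:R) <= _).
  by apply: ler_powR => //; move: sN; lra.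
have -> : japanese z `^ (2 * N%:R) = (1 + sqnorm z) ^+ N.
  rewrite -natrM powR_mulrn ?exprM ?sqr_sqrtr// ?sqrtr_ge0//; lra.
(* The Gaussian with parameter d bounds 1 + |z|^2, and N d = eps. *)
have h : 1 + sqnorm z <= d^-1 * expR (d * (1 + sqnorm z)).
  rewrite mulrC ler_pdivlMr// mulrC.
  by apply: le_trans (expR_ge1Dx _); rewrite lerDr.
apply: le_trans (lerXn2r N _ _ h) _; rewrite ?nnegrE.
- lra.
- by rewrite mulr_ge0 ?expR_ge0// invr_ge0 ltW.
rewrite exprMn -expRM_natl -[leRHS]mulrA -expRD ler_pM2l ?exprn_gt0 ?invr_gt0//.
have -> : N%:R * (d * (1 + sqnorm z)) = eps + eps * sqnorm z; last by [].
by rewrite mulrA /d mulrCA divff ?gt_eqF//; ring.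
Qed.

(** Cauchy-Schwarz between the weighted square norm and a Gaussian divided by
    the weight, in the pointwise form a e <= a^2 J + e^2 / J. *)
Lemma subgaussian_Hinf (Phi : V -> R) u : real_quadratic Phi -> Hinf Phi u ->
  subgaussian (fun z => normc (u z) * expR (- Phi z)).
Proof.
move=> hPhi [s [hu uoo]] eps e0.
have cPhi := continuous_real_quadratic hPhi.
have cu := holomorphic_continuous hu.
have [c1 c2 c3] := continuous_class R V.
have cN := continuous_normc cu.
have cO (f : V -> R) : continuous f -> continuous (fun z => - f z).
  move=> cf; rewrite (_ : (fun z => _) = fun z => -1 * f z); first exact: c3.
  by apply/funext => z; rewrite mulN1r.
have cE (c : R) : continuous (fun z => expR (c * sqnorm z)).
  by apply: continuous_expR_comp; apply: (c3 (fun z : V => _) (fun z : V => _)) => //; exact: continuous_sqnorm.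
have cNPhi : continuous (fun z => expR (- Phi z)).
  by apply: continuous_expR_comp; exact: cO.
have cN2Phi : continuous (fun z => expR (- (2 * Phi z))).
  by apply: continuous_expR_comp; apply: cO; exact: c3.
have [K K0 HK] := japanese_power_bound s e0.
pose J z := japanese z `^ (2 * s).
have J0 z : 0 < J z.
  by apply: powR_gt0; rewrite sqrtr_gt0 ltr_pwDl// sqnorm_ge0.
have mJ : measurable_fun setT (fun p : vspace R n => J (cvec p)).
  apply: (measurableT_comp (f := fun x : R => x `^ (2 * s))); first exact: measurable_powR.
  apply: (measurable_vol (f := @japanese R n)) => z.
  apply: (continuous_comp (f := fun z => 1 + sqnorm z)); last exact: sqrt_continuous.
  by apply: (c2 (fun z : V => _) (fun z : V => _)) => //; exact: continuous_sqnorm.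
pose A z := normc (u z) ^+ 2 * J z * expR (- (2 * Phi z)).
have iA : integ (vol R n) (fun p => A (cvec p)).
  apply: (ge0_integ (f := fun p : vspace R n => A (cvec p))); last exact: uoo; last first.
    by move=> p; rewrite /A mulr_ge0 ?expR_ge0// mulr_ge0 ?sqr_ge0// ltW.
  apply: measurable_funM; last exact: (measurable_vol cN2Phi).
  by apply: measurable_funM => //; apply: measurable_funX; exact: (measurable_vol cN).
apply: (@integ_le _ _ _ _ _ (fun p : vspace R n => A (cvec p) + K * expR (- eps * sqnorm (cvec p)))).
- apply: measurable_funM; first exact: (measurable_vol (cE (- eps))).
  by apply: measurable_funM; [exact: (measurable_vol cN)|exact: (measurable_vol cNPhi)].
- move=> p; set z := cvec p; rewrite ger0_norm ?mulr_ge0 ?expR_ge0 ?normc_ge0//.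
  set a := normc (u z) * expR (- Phi z); set e := expR (- eps * sqnorm z).
  have a0 : 0 <= a by rewrite mulr_ge0 ?expR_ge0 ?normc_ge0.
  have Ae : A z = a ^+ 2 * J z.
    rewrite /A /a exprMn -expRM_natl mulrN; ring.
  have h : e ^+ 2 / J z <= K * e.
    apply: le_trans (ler_wpM2l (sqr_ge0 e) (HK z)) _.
    rewrite mulrCA ler_pM2l// expr2 -mulrA /e -expRD.
    by rewrite mulNr addNr expR0 mulr1.
  rewrite Ae; apply: le_trans (_ : a ^+ 2 * J z + e ^+ 2 / J z <= _); last by rewrite lerD2l.
  have : 0 <= (a * J z - e) ^+ 2 / J z by rewrite divr_ge0 ?sqr_ge0// ltW.
  have -> : (a * J z - e) ^+ 2 / J z = a ^+ 2 * J z + e ^+ 2 / J z - 2 * (e * a).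
    by field; rewrite gt_eqF.
  have : 0 <= e * a by rewrite mulr_ge0// expR_ge0.
  lra.
- by apply: integD => //; apply: integZ; exact: gaussian_integ.
Qed.

End Cone.

Section Cone.
Variable R : realType.
Local Notation C := R[i].
Local Notation normc := (@Normc.normc R).
Variable n : nat.
Local Notation V := 'rV[C]_n.
Implicit Types (z w : V).

Definition bilipschitz (L : V -> V) (m K : R) :=
  [/\ 0 < m, 0 < K, forall x y, L (x - y) = L x - L y,
      forall (t : R) x, L (t%:C *: x) = t%:C *: L x
    & forall x, m * sqnorm x <= sqnorm (L x) <= K * sqnorm x].

(** The cone over a ball about a; squared radii avoid square roots. *)
Definition cone_about (a : V) (rho : R) : set V :=
  [set z | exists2 t : R, 0 < t & sqnorm (t%:C *: z - a) < rho].

Lemma cone_about_open a rho : open (cone_about a rho).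
Proof.
have -> : cone_about a rho = \bigcup_(t in [set t : R | 0 < t])
    ((fun z => sqnorm (t%:C *: z - a)) @^-1` [set x | x < rho]).
  by apply/seteqP; split=> z /= [t t0 h]; exists t.
apply: bigcup_open => t _; apply: open_comp; last exact: open_lt.
by move=> z _; exact: continuous_sqnorm_affine.
Qed.

Lemma cone_about_conic a rho : conic (cone_about a rho).
Proof.
move=> t z t0 [s s0 h]; exists (s / t); first by rewrite divr_gt0.
by rewrite scalerA -rmorphM /= divfK// gt_eqF.
Qed.

Lemma cone_about_center a rho : 0 < rho -> cone_about a rho a.
Proof. by move=> r0; exists 1 => //; rewrite scale1r subrr sqnorm0. Qed.

Lemma cone_about_not0 a rho : rho <= sqnorm a -> ~ cone_about a rho 0.
Proof. by move=> h [t _]; rewrite scaler0 sub0r sqnormN ltNge h. Qed.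

Lemma bilipschitz0 L m K : bilipschitz L m K -> forall w, w != 0 -> L w != 0.
Proof.
move=> [m0 _ _ _ H] w w0; rewrite -sqnorm_gt0.
by have /andP[+ _] := H w; apply: lt_le_trans; rewrite mulr_gt0// sqnorm_gt0.
Qed.

(** Scaling makes z close to L w0; then w outside a conic neighbourhood of w0
    stays at a distance from w0, which L turns into a distance of L w from z
    comparable with both |z| and |w|. *)
Lemma cone_separation L m K (W : set V) w0 : bilipschitz L m K ->
  open W -> conic W -> W w0 -> w0 != 0 ->
  exists rho del : R, [/\ 0 < rho, rho <= sqnorm (L w0), 0 < del &
    forall z w, cone_about (L w0) rho z -> ~ W w ->
      del * (sqnorm z + sqnorm w) <= sqnorm (z - L w)].
Proof.
move=> bL oW cW Ww0 w00; have [m0 K0 LB LZ LH] := bL.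
have [r r0 Hr] : exists2 r, 0 < r & forall w, sqnorm (w - w0) < r -> W w.
  by apply: nbhs_sqnorm; exact: open_nbhs_nbhs.
have Lw0 : 0 < sqnorm (L w0) by rewrite sqnorm_gt0; exact: bilipschitz0 bL _ w00.
pose rho := Num.min (m * r / 8) (sqnorm (L w0)).
have rho0 : 0 < rho by rewrite lt_min Lw0 andbT !mulr_gt0// invr_gt0.
(* For z in the cone, A bounds (|z|^2 + |w|^2) / |w - w0|^2 after scaling z to be near L w0. *)
pose A := (2 * sqnorm (L w0) + 2 * rho) / r + (2 + 2 * sqnorm w0 / r).
have A0 : 0 < A.
  have := sqnorm_ge0 w0 => q0.
  have X0 : 0 < (2 * sqnorm (L w0) + 2 * rho) / r.
    by rewrite divr_gt0// addr_gt0// mulr_gt0.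
  have Y0 : 0 <= 2 * sqnorm w0 / r by rewrite divr_ge0 ?mulr_ge0// ltW.
  by rewrite /A; lra.
exists rho, (m / 4 / A); split=> //.
- by rewrite ge_min lexx orbT.
- by rewrite !divr_gt0.
move=> z w [t t0 tz] nWw.
have t2 : 0 < t ^+ 2 by rewrite exprn_gt0.
rewrite -(ler_pM2l t2) mulrCA mulrDr.
have nt x : t ^+ 2 * sqnorm x = sqnorm (t%:C *: x).
  by rewrite sqnormZ /= expr0n addr0 sqrtr_sqr real_normK ?num_real.
rewrite !nt scalerBr -LZ.
move: tz; set z' := _ *: z; set w' := _ *: w => tz.
have {}nWw : ~ W w'.
  move=> h; apply: nWw; have -> : w = t^-1%:C *: w'.
    by rewrite scalerA -rmorphM /= mulVf ?gt_eqF// scale1r.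
  by apply: cW => //; rewrite invr_gt0.
have d0 : r <= sqnorm (w' - w0).
  by rewrite leNgt; apply/negP => /Hr.
have rho8 : rho <= m * r / 8 by rewrite ge_min lexx.
have h1 : m / 4 * sqnorm (w' - w0) <= sqnorm (z' - L w').
  have /andP[h _] := LH (w' - w0); move: h; rewrite LB.
  have -> : L w' - L w0 = (z' - L w0) - (z' - L w').
    by rewrite opprB [RHS]addrC addrA subrK.
  move=> h; have := le_trans h (sqnormB_le _ _).
  have := ler_wpM2l (ltW m0) d0.
  lra.
have h2 : sqnorm z' + sqnorm w' <= A * sqnorm (w' - w0).
  have hz : sqnorm z' <= (2 * sqnorm (L w0) + 2 * rho) / r * sqnorm (w' - w0).
    have := sqnormD_le (z' - L w0) (L w0); rewrite subrK => h.
    have e : 1 <= sqnorm (w' - w0) / r by rewrite ler_pdivlMr// mul1r.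
    rewrite mulrAC -mulrA.
    apply: le_trans (_ : (2 * sqnorm (L w0) + 2 * rho) * 1 <= _); first by lra.
    by apply: ler_wpM2l => //; lra.
  have hw : sqnorm w' <= (2 + 2 * sqnorm w0 / r) * sqnorm (w' - w0).
    have := sqnormD_le (w' - w0) w0; rewrite subrK => h.
    have e : 1 <= sqnorm (w' - w0) / r by rewrite ler_pdivlMr// mul1r.
    have := ler_wpM2l (sqnorm_ge0 w0) e; lra.
  by rewrite /A mulrDl; exact: lerD.
apply: le_trans h1; apply: le_trans (ler_wpM2l _ h2) _.
  by rewrite !mulr_ge0// ?invr_ge0 ltW.
by rewrite mulrA divfK// gt_eqF.
Qed.

(** For w in W, |z|^2 is controlled by |z - L w|^2 + |w|^2, so that the kernel
    and U together decay in z; for other w the separation makes the kernel decay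
    in both variables.  What multiplies the Gaussian in z is integrable. *)
Lemma cone_pointwise L m K (W : set V) w0 (U : V -> R) (K0 c0 c : R) :
  bilipschitz L m K ->
  open W -> conic W -> W w0 -> w0 != 0 ->
  (forall w, 0 <= U w) -> 0 < c -> 0 < K0 -> 0 < c0 ->
  (forall w, W w -> U w <= K0 * expR (- c0 * sqnorm w)) ->
  exists rho eps : R, [/\ 0 < rho, rho <= sqnorm (L w0), 0 < eps &
    forall z w, cone_about (L w0) rho z ->
      expR (- c * sqnorm (z - L w)) * U w <=
      expR (- eps * sqnorm z) *
        (expR (- eps * sqnorm w) * U w + K0 * expR (- eps * sqnorm w))].
Proof.
move=> bL oW cW Ww0 w00 U0 c_gt0 K0_gt0 c0_gt0 UW; have [m0 K_gt0 LB LZ LH] := bL.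
have [rho [del [rho0 rhoL del0 H]]] := cone_separation bL oW cW Ww0 w00.
pose eps := Num.min (c * del) (Num.min (c / 2) (Num.min (c0 / 2) (c0 / (4 * K)))).
have eps0 : 0 < eps.
  by rewrite !lt_min !divr_gt0 ?mulr_gt0.
have e1 : eps <= c * del by rewrite ge_min lexx.
have e2 : eps <= c / 2 by rewrite !ge_min lexx orbT.
have e3 : eps <= c0 / 2 by rewrite !ge_min lexx !orbT.
have e4 : eps <= c0 / (4 * K) by rewrite !ge_min lexx !orbT.
exists rho, eps; split=> // z w zc; rewrite mulrDr.
have qz := sqnorm_ge0 z; have qw := sqnorm_ge0 w.
have qzw := sqnorm_ge0 (z - L w).
have [Ww|nWw] := pselect (W w).
  apply: ler_wpDl.
    by rewrite !mulr_ge0 ?expR_ge0.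
  apply: le_trans (ler_wpM2l (expR_ge0 _) (UW _ Ww)) _.
  rewrite mulrCA [leRHS]mulrCA ler_pM2l// -!expRD ler_expR.
  have := sqnormD_le (z - L w) (L w); rewrite subrK => hz.
  have /andP[_ hK] := LH w.
  have h1 : eps * sqnorm z <= eps * (2 * sqnorm (z - L w) + 2 * (K * sqnorm w)).
    by rewrite ler_pM2l//; lra.
  have h2 : eps * sqnorm (z - L w) <= c / 2 * sqnorm (z - L w) by exact: ler_wpM2r.
  have h3 : eps * (4 * K) <= c0 by rewrite -ler_pdivlMr// mulr_gt0.
  have h4 : eps * (4 * K) * sqnorm w <= c0 * sqnorm w by exact: ler_wpM2r.
  have h5 : eps * sqnorm w <= c0 / 2 * sqnorm w by exact: ler_wpM2r.
  lra.
apply: ler_wpDr; first by rewrite !mulr_ge0 ?expR_ge0 ?ltW.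
rewrite mulrA ler_wpM2r// -expRD ler_expR.
have h := H _ _ zc nWw.
have : eps * (sqnorm z + sqnorm w) <= c * del * (sqnorm z + sqnorm w).
  by apply: ler_wpM2r => //; exact: addr_ge0.
have := ler_wpM2l (ltW c_gt0) h; lra.
Qed.

(** A kernel concentrated along the graph of L sends rapid decay near w0 to
    rapid decay near L w0. *)
Lemma kernel_cone_decay L m K (W : set V) w0 (U : V -> R) (K0 c0 c : R) :
  bilipschitz L m K ->
  open W -> conic W -> W w0 -> w0 != 0 ->
  (forall w, 0 <= U w) -> subgaussian U -> 0 < c -> 0 < K0 -> 0 < c0 ->
  (forall w, W w -> U w <= K0 * expR (- c0 * sqnorm w)) ->
  exists V' : set V, [/\ open V', conic V', ~ V' 0, V' (L w0) &
    exists K' c' : R, [/\ 0 < K', 0 < c' &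
      forall z A (f : V -> C), V' z -> 0 <= A ->
        cmeas (fun p : vspace R n => f (cvec p)) ->
        (forall w, normc (f w) <= A * (expR (- c * sqnorm (z - L w)) * U w)) ->
        normc (Cintegral (@lebC R n) (fun p => f (cvec p)))
          <= A * (K' * expR (- c' * sqnorm z))]].
Proof.
move=> bL oW cW Ww0 w00 U0 sU c_gt0 K0_gt0 c0_gt0 UW.
have [rho [eps [rho0 rhoL eps0 H]]] :=
  cone_pointwise bL oW cW Ww0 w00 U0 c_gt0 K0_gt0 c0_gt0 UW.
exists (cone_about (L w0) rho); split.
- exact: cone_about_open.
- exact: cone_about_conic.
- exact: cone_about_not0.
- exact: cone_about_center.
pose g (p : vspace R n) := expR (- eps * sqnorm (cvec p)) * U (cvec p)
   + K0 * expR (- eps * sqnorm (cvec p)).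
have ig : integ (vol R n) g.
  by apply: integD; [exact: sU|apply: integZ; exact: gaussian_integ].
pose I := Rintegral (vol R n) setT g.
have I0 : 0 <= I.
  by apply: Rintegral_ge0 => p _; rewrite /g addr_ge0// mulr_ge0 ?expR_ge0// ltW.
exists (2 * I + 1), eps; split=> //; first by rewrite ltr_wpDl// mulr_ge0.
move=> z A f zc A0 mf hf.
have := @Cintegral_bound _ _ _ (vol R n) (fun p => f (cvec p))
  (fun p => A * expR (- eps * sqnorm z) * g p) mf.
move=> /(_ _ (integZ _ ig)) h; apply: le_trans (h _) _.
  move=> p; apply: le_trans (hf _) _; rewrite -mulrA; apply: ler_wpM2l => //; exact: H.
rewrite RintegralZl// -/I -/g.
have := mulr_ge0 A0 (expR_ge0 (- eps * sqnorm z)); lra.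
Qed.

(** Without any decay of U, the kernel still loses less than any Gaussian. *)
Lemma kernel_subgaussian_bound L m K (U : V -> R) (c eps : R) :
  bilipschitz L m K -> (forall w, 0 <= U w) -> subgaussian U -> 0 < c -> 0 < eps ->
  exists2 K' : R, 0 < K' &
    forall z A (f : V -> C), 0 <= A ->
        cmeas (fun p : vspace R n => f (cvec p)) ->
        (forall w, normc (f w) <= A * (expR (- c * sqnorm (z - L w)) * U w)) ->
        normc (Cintegral (@lebC R n) (fun p => f (cvec p)))
          <= A * (K' * expR (eps * sqnorm z)).
Proof.
move=> [m0 K_gt0 LB LZ LH] U0 sU c0 eps0.
(* Lowering c to d makes the loss exp(d |z|^2) at most exp(eps |z|^2). *)
pose d := Num.min c eps.
have d0 : 0 < d by rewrite lt_min c0.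
have dc : d <= c by rewrite ge_min lexx.
have de : d <= eps by rewrite ge_min lexx orbT.
pose e := d * m / 2; have e0 : 0 < e by rewrite divr_gt0// mulr_gt0.
pose g (p : vspace R n) := expR (- e * sqnorm (cvec p)) * U (cvec p).
have ig : integ (vol R n) g by exact: sU.
pose I := Rintegral (vol R n) setT g.
have I0 : 0 <= I by apply: Rintegral_ge0 => p _; rewrite /g mulr_ge0 ?expR_ge0.
exists (2 * I + 1); first by rewrite ltr_wpDl// mulr_ge0.
move=> z A f A0 mf hf.
have := @Cintegral_bound _ _ _ (vol R n) (fun p => f (cvec p))
  (fun p => A * expR (eps * sqnorm z) * g p) mf.
move=> /(_ _ (integZ _ ig)) h; apply: le_trans (h _) _.
  move=> p; apply: le_trans (hf _) _; rewrite -mulrA; apply: ler_wpM2l => //.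
  rewrite /g mulrA ler_wpM2r// -expRD ler_expR.
  set w := cvec p; have /andP[h1 _] := LH w.
  have h2 : sqnorm (L w) <= 2 * sqnorm z + 2 * sqnorm (z - L w).
    by have := sqnormB_le z (z - L w); rewrite subKr.
  have h3 : d * sqnorm (z - L w) <= c * sqnorm (z - L w) by rewrite ler_wpM2r// sqnorm_ge0.
  have h4 : d * sqnorm z <= eps * sqnorm z by rewrite ler_wpM2r// sqnorm_ge0.
  have h5 : d * (m * sqnorm w) <= d * (2 * sqnorm z + 2 * sqnorm (z - L w)).
    by rewrite ler_pM2l//; lra.
  rewrite /e; lra.
rewrite RintegralZl// -/I -/g.
have := mulr_ge0 A0 (expR_ge0 (eps * sqnorm z)); lra.
Qed.

End Cone.


(** * Weights, Lagrangian subspaces and positivity *)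

Section Psh.
Variable R : realType.
Local Notation C := R[i].
Local Notation normc := (@Normc.normc R).
Variable n : nat.
Local Notation V := 'rV[C]_n.
Implicit Types (x y z w v : V) (b : V -> V -> R).

Lemma conjE (c : C) : Num.conj c = c^*%C.
Proof. by []. Qed.

Lemma derive1_quadratic (f : R -> R) (p q r : R) :
  (forall t, f t = p + t * q + t ^+ 2 * r) -> derive1 f 0 = q.
Proof.
move=> fE; rewrite /derive1; apply/cvg_lim => //; apply/cvgrPdist_le => e e0.
near=> h.
have h0 : h != 0 by near: h; exact: nbhs_dnbhs_neq.
have he : `|h| <= e / (1 + `|r|).
  by near: h; apply: dnbhs0_le; rewrite divr_gt0// ltr_pwDl.
rewrite !fE [_ *: _](_ : _ = q + h * r); last by rewrite /GRing.scale /=; field.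
rewrite opprD addNKr normrN normrM.
apply: le_trans (_ : `|h| * (1 + `|r|) <= _); first by rewrite ler_wpM2l// lerDr.
by rewrite -ler_pdivlMr// ltr_pwDl.
Unshelve. all: by end_near. Qed.

Lemma rbilr b x : rbil b -> rlin (b x).
Proof.
move=> [b1 bC]; split=> [y z|t y].
  by rewrite bC (b1 x).1 !(bC x).
by rewrite bC (b1 x).2 (bC x).
Qed.

Lemma rbil_affine b z v t : rbil b ->
  b (z + t%:C *: v) (z + t%:C *: v) = b z z + t * (2 * b z v) + t ^+ 2 * b v v.
Proof.
move=> hb; have [b1 bC] := hb.
rewrite !((b1 _).1, (b1 _).2, (rbilr _ hb).1, (rbilr _ hb).2) (bC v z); ring.
Qed.

(** The complex linear part in y of the derivative of z |-> b z z. *)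
Definition dlin b z y : C := b z y +i* (- b z ('i%C *: y)).

Lemma dz_quadratic (Phi : V -> R) b : rbil b -> (forall z, Phi z = b z z) ->
  forall k z, dz (fun y => (Phi y)%:C) k z = dlin b z (delta_mx 0 k).
Proof.
move=> hb PhiE k z; rewrite /dz /dreal.
have D v : derive1 (fun t : R => complex.Re ((Phi (z + t%:C *: v))%:C)) 0 = 2 * b z v.
  by apply: (derive1_quadratic (p := b z z) (r := b v v)) => t /=; rewrite PhiE rbil_affine.
have D0 v : derive1 (fun t : R => complex.Im ((Phi (z + t%:C *: v))%:C)) 0 = 0.
  by apply: (derive1_quadratic (p := 0) (r := 0)) => t /=; ring.
rewrite !D !D0 /dlin; set p := b z _; set q := b z _.
apply: (mulfI (x := 2)); first by rewrite pnatr_eq0.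
rewrite mulrA mulfV ?pnatr_eq0// mul1r.
by apply/eqP; rewrite eq_complex /=; apply/andP; split; apply/eqP; ring.
Qed.

Lemma levi_quadratic (Phi : V -> R) b : rbil b -> (forall z, Phi z = b z z) ->
  forall j k z, levi Phi z j k
   = 2^-1 * (dlin b (delta_mx 0 j) (delta_mx 0 k)
             + 'i%C * dlin b ('i%C *: delta_mx 0 j) (delta_mx 0 k)).
Proof.
move=> hb PhiE j k z; rewrite mxE /dzbar.
have -> : dz (fun y => (Phi y)%:C) k = fun y => dlin b y (delta_mx 0 k).
  by apply/funext => y; exact: dz_quadratic.
have [b1 bC] := hb.
have D v : dreal (fun y => dlin b y (delta_mx 0 k)) v z = dlin b v (delta_mx 0 k).
  rewrite /dreal /dlin /=; congr Complex.
    apply: (derive1_quadratic (p := b z (delta_mx 0 k)) (r := 0)) => t /=.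
    by rewrite (b1 _).1 (b1 _).2; ring.
  apply: (derive1_quadratic (p := - b z ('i%C *: delta_mx 0 k)) (r := 0)) => t /=.
  by rewrite (b1 _).1 (b1 _).2; ring.
by rewrite !D.
Qed.

Lemma dlinD b z x y : rbil b -> dlin b z (x + y) = dlin b z x + dlin b z y.
Proof.
move=> hb; rewrite /dlin scalerDr !(rbilr _ hb).1 opprD; exact: erefl.
Qed.

Lemma scale_complexE (c : C) x : c *: x = (complex.Re c)%:C *: x + (complex.Im c)%:C *: ('i%C *: x).
Proof. by rewrite scalerA -scalerDl [_ * 'i%C]mulrC -complexE. Qed.

Lemma scaleii x : 'i%C *: ('i%C *: x) = - x :> V.
Proof.
by rewrite scalerA (_ : 'i%C * 'i%C = -1 :> C) ?scaleN1r// -expr2 sqr_i.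
Qed.

Lemma dlinZ b z (c : C) y : rbil b -> dlin b z (c *: y) = c * dlin b z y.
Proof.
move=> hb; have hr x := rbilr x hb.
rewrite /dlin scalerA (mulrC 'i%C) -scalerA (scale_complexE c y) (scale_complexE c ('i%C *: y)).
rewrite scaleii !(hr _).1 !(hr _).2 (rlinN _ (hr _)).
case: c => c d /=; apply/eqP; rewrite eq_complex /=; apply/andP; split; apply/eqP; ring.
Qed.

Lemma dlin_coord b z y : rbil b ->
  dlin b z y = \sum_k y 0 k * dlin b z (delta_mx 0 k).
Proof.
move=> hb; rewrite {1}[y]row_sum_delta.
elim: (index_enum _) => [|j r IH].
  rewrite !big_nil /dlin scaler0 (rlin0 (rbilr _ hb)) oppr0; exact: erefl.
by rewrite !big_cons dlinD// dlinZ// IH.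
Qed.

(** The sesquilinear form with the Levi form as its matrix (herm_levi). *)
Definition herm b x y : C := 2^-1 * (dlin b x y + 'i%C * dlin b ('i%C *: x) y).

Lemma dlinDl b x x' y : rbil b -> dlin b (x + x') y = dlin b x y + dlin b x' y.
Proof. move=> [b1 _]; rewrite /dlin !(b1 _).1 opprD; exact: erefl. Qed.

Lemma dlinZl b (t : R) x y : rbil b -> dlin b (t%:C *: x) y = t%:C * dlin b x y.
Proof.
move=> [b1 _]; rewrite /dlin !(b1 _).2.
by apply/eqP; rewrite eq_complex /=; apply/andP; split; apply/eqP; ring.
Qed.

Lemma dlinNl b x y : rbil b -> dlin b (- x) y = - dlin b x y.
Proof. by move=> hb; rewrite -scaleN1r -[-1](rmorphN1 (real_complex R)) dlinZl// rmorphN1 mulN1r. Qed.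

Lemma dlin0l b y : rbil b -> dlin b 0 y = 0.
Proof. by move=> hb; rewrite -(scale0r 0) -[0 : C](rmorph0 (real_complex R)) dlinZl// rmorph0 mul0r. Qed.

Lemma hermDl b x x' y : rbil b -> herm b (x + x') y = herm b x y + herm b x' y.
Proof. by move=> hb; rewrite /herm scalerDr !dlinDl//; ring. Qed.

Lemma hermZl b (c : C) x y : rbil b -> herm b (c *: x) y = c^*%C * herm b x y.
Proof.
move=> hb; rewrite /herm ['i%C *: (c *: x)]scalerA ['i%C * c]mulrC -scalerA (scale_complexE c x) (scale_complexE c ('i%C *: x)).
rewrite scaleii scalerN !(dlinDl, dlinZl, dlinNl)//.
have -> : c^*%C = (complex.Re c)%:C - 'i%C * (complex.Im c)%:C.
  by case: c => c d; apply/eqP; rewrite eq_complex /=; apply/andP; split; apply/eqP; ring.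
have i2 : 'i%C * 'i%C = -1 :> C by rewrite -expr2 sqr_i.
set p := dlin b x y; set q := dlin b _ y; set c1 := _%:C; set c2 := _%:C.
transitivity (2^-1 * (c1 * p + c2 * q + 'i%C * c1 * q - 'i%C * c2 * p)); first by ring.
have -> : c2 * q = - ('i%C * 'i%C) * (c2 * q) by rewrite i2 opprK mul1r.
by ring.
Qed.

Lemma herm_coord b x y : rbil b ->
  herm b x y = \sum_j \sum_k (x 0 j)^*%C * herm b (delta_mx 0 j) (delta_mx 0 k) * y 0 k.
Proof.
move=> hb.
have H w : herm b w y = \sum_k herm b w (delta_mx 0 k) * y 0 k.
  rewrite /herm (dlin_coord w y hb) (dlin_coord ('i%C *: w) y hb) mulr_sumr -big_split mulr_sumr.
  by apply: eq_bigr => k _ /=; ring.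
rewrite {1}[x]row_sum_delta.
have step r : herm b (\sum_(j <- r) x 0 j *: delta_mx 0 j) y = \sum_(j <- r)
    \sum_k (x 0 j)^*%C * herm b (delta_mx 0 j) (delta_mx 0 k) * y 0 k; last exact: step.
elim: r => [|j r IH].
  by rewrite !big_nil /herm scaler0 !dlin0l// mulr0 addr0 mulr0.
rewrite !big_cons hermDl// hermZl// IH H mulr_sumr; congr (_ + _).
by apply: eq_bigr => k _; rewrite mulrA.
Qed.

Lemma herm_levi (Phi : V -> R) b z : rbil b -> (forall z, Phi z = b z z) ->
  forall x y, (conjv x *m levi Phi z *m y^T) 0 0 = herm b x y.
Proof.
move=> hb PhiE x y; rewrite herm_coord// mxE exchange_big /=.
apply: eq_bigr => k _; rewrite !mxE mulr_suml; apply: eq_bigr => j _.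
by rewrite (levi_quadratic hb PhiE) mxE.
Qed.

Lemma herm_diag b x : rbil b -> herm b x x = ((b x x + b ('i%C *: x) ('i%C *: x)) / 2)%:C.
Proof.
move=> hb; have [b1 bC] := hb; rewrite /herm /dlin.
rewrite (bC ('i%C *: x) x).
apply: (mulfI (x := 2)); first by rewrite pnatr_eq0.
rewrite mulrA mulfV ?pnatr_eq0// mul1r -[2](rmorph_nat (real_complex R)) -rmorphM.
by apply/eqP; rewrite eq_complex /=; apply/andP; split; apply/eqP; field.
Qed.

Lemma conjvK : involutive (@conjv R n).
Proof. by move=> x; apply/rowP => j; rewrite !mxE conjCK. Qed.

(** A strictly plurisubharmonic quadratic form has a non-degenerate Levi form,
    constant in z; the last clause solves linear equations for it. *)
Lemma psh_rbil (Phi : V -> R) : strictly_psh Phi -> exists b,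
  [/\ rbil b, forall z, Phi z = b z z,
    forall z, z != 0 -> 0 < Phi z + Phi ('i%C *: z)
  & forall g : V, exists d, forall y, herm b d y = \sum_k g 0 k * y 0 k].
Proof.
move=> [/real_quadratic_rbil[b hb PhiE] Lpos]; exists b.
have pos z : z != 0 -> 0 < Phi z + Phi ('i%C *: z).
  move=> z0; have [_ /(_ z z0)] := Lpos 0.
  by rewrite (herm_levi _ hb PhiE) herm_diag// ltcR -!PhiE pmulr_lgt0// invr_gt0.
split=> // g; pose A := levi Phi 0.
have uA : A \in unitmx.
  rewrite -row_free_unit; apply: inj_row_free => v vA0.
  apply/eqP/negPn/negP => v0.
  have cv0 : conjv v != 0.
    by apply: contra v0 => /eqP h; rewrite -(conjvK v) h; apply/eqP/rowP => j; rewrite !mxE rmorph0.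
  have := pos _ cv0; rewrite !PhiE => h.
  have := herm_levi 0 hb PhiE (conjv v) (conjv v).
  rewrite conjvK -/A vA0 mul0mx mxE herm_diag// => /esym/eqP.
  by rewrite (fmorph_eq0 (real_complex R)) mulf_eq0 invr_eq0 pnatr_eq0 orbF gt_eqF.
exists (conjv (g *m invmx A)) => y.
rewrite -(herm_levi 0 hb PhiE) conjvK -/A mulmxKV// mxE.
by apply: eq_bigr => k _; rewrite mxE.
Qed.

Lemma lift_LambdaE (Phi : V -> R) b z : rbil b -> (forall z, Phi z = b z z) ->
  lift_Lambda Phi z = (z, (2 / 'i%C) *: \row_k dlin b z (delta_mx 0 k)).
Proof.
move=> hb PhiE; rewrite /lift_Lambda; congr (_, _ *: _).
by apply/rowP => k; rewrite !mxE (dz_quadratic hb PhiE).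
Qed.

Lemma sigma_lift (Phi : V -> R) b x y : rbil b -> (forall z, Phi z = b z z) ->
  sigma (lift_Lambda Phi x) (lift_Lambda Phi y)
  = (2 * (b y ('i%C *: x) - b x ('i%C *: y)))%:C.
Proof.
move=> hb PhiE; have [b1 bC] := hb; rewrite !(lift_LambdaE _ hb PhiE) /sigma /=.
transitivity (2 / 'i%C * (dlin b x y - dlin b y x)).
  rewrite (dlin_coord x y hb) (dlin_coord y x hb) -sumrB mulr_sumr.
  by apply: eq_bigr => k _; rewrite !mxE; ring.
rewrite /dlin (bC y x); set p := b x _; set q := b y _.
have i0 : 'i%C != 0 :> C by rewrite eq_complex /= oner_eq0 andbF.
apply: (mulfI i0); rewrite mulrA mulrCA divff// mulr1.
rewrite -[2](rmorph_nat (real_complex R)).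
by apply/eqP; rewrite eq_complex /=; apply/andP; split; apply/eqP; ring.
Qed.

Lemma sigmaDZ (X Y : V * V) (Z : V * V) (c : C) :
  sigma (X + c *: Y) Z = sigma X Z + c * sigma Y Z.
Proof.
rewrite /sigma mulr_sumr -big_split; apply: eq_bigr => j _ /=; rewrite !mxE; ring.
Qed.

Lemma sigmaC (X Y : V * V) : sigma Y X = - sigma X Y.
Proof. by rewrite /sigma -sumrN; apply: eq_bigr => j _; rewrite opprB. Qed.

Lemma Lambda_lift (Phi : V -> R) x : Lambda Phi (lift_Lambda Phi x).
Proof. exact: (ex_intro2 _ _ x Logic.I erefl). Qed.

Lemma Lambda_liftE (Phi : V -> R) X : Lambda Phi X -> X = lift_Lambda Phi X.1.
Proof. by move=> [w _ <-]. Qed.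

(** Since Lambda Phi is maximally totally real, the point Y of Lambda Phit over
    z is X1 + i X2 with X1, X2 in Lambda Phi, explicitly in terms of a solution
    d of an equation for the Levi form.  Positivity at the preimage W of Y,
    which is in Lambda Phi and hence has sigma W (iota W) = 0, reads
    0 <= - 2 sigma X1 X2; and Phi z - Phit z is a positive combination of this
    number and the Levi form at d. *)
Lemma positive_le (Phi Phit : V -> R) (kappa : V * V -> V * V) :
  strictly_psh Phi -> real_quadratic Phit -> positive_rel Phi kappa ->
  kappa @` Lambda Phi = Lambda Phit -> forall z, Phit z <= Phi z.
Proof.
move=> pPhi /real_quadratic_rbil[bt hbt PhitE] [iota [[ia ii ifix] pos]] kL z.
have [b [hb PhiE Hpos Hsolve]] := psh_rbil pPhi.
have [b1 bC] := hb.
have [d Hd] := Hsolve (\row_k (dlin bt z (delta_mx 0 k) - dlin b z (delta_mx 0 k))).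
have Hd' y : herm b d y = dlin bt z y - dlin b z y.
  rewrite Hd (dlin_coord _ _ hbt) (dlin_coord z y hb) -sumrB; apply: eq_bigr => k _.
  by rewrite mxE; ring.
have [_ [w _ <-] kw] : (kappa @` Lambda Phi) (lift_Lambda Phit z) by rewrite kL; exists z.
pose h := 2^-1 : R.
pose X1 := lift_Lambda Phi (z + h%:C *: d); pose X2 := lift_Lambda Phi (h%:C *: ('i%C *: d)).
have YE : lift_Lambda Phit z = X1 + 'i%C *: X2.
  rewrite /X1 /X2 !(lift_LambdaE _ hb PhiE) (lift_LambdaE _ hbt PhitE).
  congr pair => /=.
    rewrite scalerA (mulrC 'i%C) -scalerA scaleii -addrA -scalerDr subrr scaler0 addr0 //.
  rewrite ['i%C *: ((2 / 'i%C) *: _)]scalerA ['i%C * (2 / 'i%C)]mulrC -[(2 / 'i%C * 'i%C) *: _]scalerA -scalerDr.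
  congr (_ *: _).
  apply/rowP => k; rewrite !mxE.
  have := Hd' (delta_mx 0 k) => /esym/eqP; rewrite subr_eq addrC => /eqP ->.
  rewrite !(dlinDl, dlinZl)// /herm.
  have -> : (2^-1 : C) = h%:C by rewrite /h fmorphV rmorph_nat.
  by ring.
have key (W Y Y1 Y2 : V * V) : kappa W = Y -> iota W = W -> sigma W W = 0 ->
    Y = Y1 + 'i%C *: Y2 -> iota Y1 = Y1 -> iota Y2 = Y2 -> 0 <= - (2 * sigma Y1 Y2).
  move=> kW iW sW YY i1 i2; have := pos W; rewrite kW iW sW subr0.
  have -> : iota Y = Y1 + (- 'i%C) *: Y2.
    rewrite YY addrC ia i1 i2 addrC; congr (_ + _ *: _).
    by rewrite conjE; apply/eqP; rewrite eq_complex /= oppr0 !eqxx.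
  have -> : sigma Y (Y1 + - 'i%C *: Y2) = - (2 * 'i%C * sigma Y1 Y2).
    rewrite YY sigmaDZ sigmaC (sigmaC _ Y2) !sigmaDZ.
    have S0 X : sigma X X = 0 :> C by rewrite /sigma big1// => j _; rewrite subrr.
    by rewrite !S0 (sigmaC Y1 Y2); ring.
  have i0 : 'i%C != 0 :> C by rewrite eq_complex /= oner_eq0 andbF.
  have -> // : Num.imaginary^-1 * - (2 * 'i%C * sigma Y1 Y2) = - (2 * sigma Y1 Y2).
  rewrite mulrN mulrCA -mulrA -[Num.imaginary]/('i%C : C).
  by rewrite mulVKf.
have S0 : sigma (lift_Lambda Phi w) (lift_Lambda Phi w) = 0.
  by rewrite (sigma_lift _ _ hb PhiE) subrr mulr0.
have := key (lift_Lambda Phi w) (lift_Lambda Phit z) X1 X2 kw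
  (ifix _ (Lambda_lift Phi w)) S0 YE (ifix _ (Lambda_lift _ _)) (ifix _ (Lambda_lift _ _)).
rewrite /X1 /X2 {key YE}.
rewrite (sigma_lift _ _ hb PhiE) -[2 in X in 0 <= - X](rmorph_nat (real_complex R)).
rewrite -rmorphM -rmorphN /= ler0c => hs.
have := congr1 (@complex.Re R) (Hd' z).
rewrite /herm.
have -> : (2^-1 : C) = h%:C by rewrite /h fmorphV rmorph_nat.
rewrite /dlin /= => hz.
have posd : 0 <= b d d + b ('i%C *: d) ('i%C *: d).
  have [->|d0] := eqVneq d 0; last by rewrite -!PhiE ltW// Hpos.
  by rewrite scaler0 (rlin0 (rbilr _ hb)) addr0.
rewrite PhitE PhiE.
move: hs; rewrite !scalerDr ['i%C *: (h%:C *: ('i%C *: d))]scalerA (mulrC 'i%C) -scalerA scaleii.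
rewrite ['i%C *: (h%:C *: d)]scalerA (mulrC 'i%C) -scalerA scalerN.
rewrite !((b1 _).1, (b1 _).2, (rbilr _ hb).1, (rbilr _ hb).2, rlinN _ (rbilr _ hb)).
rewrite (bC z d).
move: hz posd; rewrite /h.
set p := b d d; set q := b ('i%C *: d) ('i%C *: d).
set r := b d z; set t := b ('i%C *: d) ('i%C *: z).
lra.
Qed.

End Psh.


(** * The real linear map below a canonical transformation *)

Section Flat.
Variable R : realType.
Local Notation C := R[i].
Local Notation normc := (@Normc.normc R).
Variable n : nat.
Local Notation V := 'rV[C]_n.
Implicit Types (x y z w v : V) (b : V -> V -> R).

(** Linearity over R is all that kappa^flat has: the subspace Lambda Phi is
    totally real. *)
Definition vrlin (L : V -> V) :=
  (forall x y, L (x + y) = L x + L y) /\ (forall (t : R) x, L (t%:C *: x) = t%:C *: L x).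

Lemma vrlinB L x y : vrlin L -> L (x - y) = L x - L y.
Proof.
move=> [LD LZ]; have LN v : L (- v) = - L v.
  have := LZ (-1) v; rewrite rmorphN1 !scaleN1r; exact.
by rewrite LD LN.
Qed.

Lemma rlin_bounded (l : V -> R) : rlin l -> exists2 K, 0 < K &
  forall z, l z ^+ 2 <= K * sqnorm z.
Proof.
move=> hl.
have coord (a : R) (f : V -> R) : (forall z, f z ^+ 2 <= sqnorm z) ->
   forall z, (f z * a) ^+ 2 <= a ^+ 2 * sqnorm z.
  by move=> hf z; rewrite exprMn mulrC ler_wpM2l ?sqr_ge0.
have hc j z : complex.Re (z 0 j) ^+ 2 + complex.Im (z 0 j) ^+ 2 <= sqnorm z.
  rewrite sqnormE (bigD1 j)//= lerDl; apply: sumr_ge0 => k _.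
  by rewrite addr_ge0// sqr_ge0.
have hRe j z : complex.Re (z 0 j) ^+ 2 <= sqnorm z.
  by apply: le_trans (hc j z); rewrite lerDl sqr_ge0.
have hIm j z : complex.Im (z 0 j) ^+ 2 <= sqnorm z.
  by apply: le_trans (hc j z); rewrite lerDr sqr_ge0.
suff [K K0 HK] : exists2 K, 0 < K & forall z, (\sum_(j <- index_enum 'I_n)
   (complex.Re (z 0 j) * l (delta_mx 0 j)
  + complex.Im (z 0 j) * l ('i%C *: delta_mx 0 j))) ^+ 2 <= K * sqnorm z.
  by exists K => // z; rewrite (rlin_coord z hl).
elim: (index_enum _) => [|j r [K K0 HK]].
  by exists 1 => // z; rewrite big_nil expr0n mul1r sqnorm_ge0.
pose a := l (delta_mx 0 j); pose c := l ('i%C *: delta_mx 0 j).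
exists (4 * a ^+ 2 + 4 * c ^+ 2 + 2 * K).
  by have := sqr_ge0 a; have := sqr_ge0 c; lra.
move=> z; rewrite big_cons -/a -/c; set S := \sum_(_ <- _) _.
have h1 := coord a _ (hRe j) z; have h2 := coord c _ (hIm j) z; have h3 := HK z.
rewrite -/S in h3; move: h1 h2 h3; rewrite -/a -/c.
set A := complex.Re _ * a; set B := complex.Im _ * c => h1 h2 h3.
have e1 : (A + B + S) ^+ 2 <= 2 * (A + B) ^+ 2 + 2 * S ^+ 2.
  by have := sqr_ge0 (A + B - S); rewrite !expr2; lra.
have e2 : (A + B) ^+ 2 <= 2 * A ^+ 2 + 2 * B ^+ 2.
  by have := sqr_ge0 (A - B); rewrite !expr2; lra.
lra.
Qed.

Lemma vrlin_bounded L : vrlin L -> exists2 K, 0 < K &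
  forall z, sqnorm (L z) <= K * sqnorm z.
Proof.
move=> [LD LZ].
have hRe j : rlin (fun z => complex.Re (L z 0 j)).
  split=> [x y|t x]; first by rewrite LD mxE; case: (L x 0 j) (L y 0 j) => [? ?] [? ?].
  by rewrite LZ mxE; case: (L x 0 j) => [? ?] /=; ring.
have hIm j : rlin (fun z => complex.Im (L z 0 j)).
  split=> [x y|t x]; first by rewrite LD mxE; case: (L x 0 j) (L y 0 j) => [? ?] [? ?].
  by rewrite LZ mxE; case: (L x 0 j) => [? ?] /=; ring.
suff [K K0 HK] : exists2 K, 0 < K & forall z, \sum_(j <- index_enum 'I_n)
    (complex.Re (L z 0 j) ^+ 2 + complex.Im (L z 0 j) ^+ 2) <= K * sqnorm z.
  by exists K => // z; rewrite sqnormE.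
elim: (index_enum _) => [|j r [K K0 HK]].
  by exists 1 => // z; rewrite big_nil mul1r sqnorm_ge0.
have [K1 K10 H1] := rlin_bounded (hRe j); have [K2 K20 H2] := rlin_bounded (hIm j).
exists (K1 + K2 + K) => [|z]; first by rewrite !addr_gt0.
by rewrite big_cons; have := HK z; have := H1 z; have := H2 z; lra.
Qed.

Lemma vrlin_cancel L L' : vrlin L -> cancel L L' -> cancel L' L -> vrlin L'.
Proof.
move=> [LD LZ] LK L'K; split=> [x y|t x]; apply: (can_inj LK).
  by rewrite LD !L'K.
by rewrite LZ !L'K.
Qed.

Lemma vrlin_bilipschitz L L' : vrlin L -> cancel L L' -> cancel L' L ->
  exists m K : R, bilipschitz L m K.
Proof.
move=> hL LK L'K; have hL' := vrlin_cancel hL LK L'K.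
have [K K0 HK] := vrlin_bounded hL; have [K' K'0 HK'] := vrlin_bounded hL'.
exists K'^-1, K; split=> //.
- by rewrite invr_gt0.
- by move=> x y; exact: vrlinB.
- exact: hL.2.
move=> x; rewrite HK andbT mulrC ler_pdivrMr// mulrC.
by have := HK' (L x); rewrite LK.
Qed.

Lemma lift_LambdaD (Phi : V -> R) x y : real_quadratic Phi ->
  lift_Lambda Phi (x + y) = lift_Lambda Phi x + lift_Lambda Phi y.
Proof.
move=> /real_quadratic_rbil[b hb PhiE]; rewrite !(lift_LambdaE _ hb PhiE).
congr pair; rewrite -scalerDr; congr (_ *: _).
by apply/rowP => k; rewrite !mxE dlinDl.
Qed.

Lemma lift_LambdaZ (Phi : V -> R) (t : R) x : real_quadratic Phi ->
  lift_Lambda Phi (t%:C *: x) = t%:C *: lift_Lambda Phi x.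
Proof.
move=> /real_quadratic_rbil[b hb PhiE]; rewrite !(lift_LambdaE _ hb PhiE).
congr pair; rewrite [RHS]scalerA [t%:C * _]mulrC -[RHS]scalerA; congr (_ *: _).
by apply/rowP => k; rewrite !mxE dlinZl.
Qed.

Variables (Phi Phit : V -> R) (kappa : {linear (V * V)%type -> (V * V)%type}).
Hypothesis qPhi : real_quadratic Phi.
Hypothesis canon : canonical_transformation kappa.
Hypothesis kL : kappa @` Lambda Phi = Lambda Phit.

(** The symplectic form is non-degenerate and preserved by kappa. *)
Lemma canonical_inj X : kappa X = 0 -> X = 0.
Proof.
move=> k0; have S0 Z : sigma X Z = 0.
  rewrite -canon k0 /sigma big1// => j _; rewrite !mxE mul0r mulr0 subrr//.
case: X k0 S0 => [x y] _ S0; congr pair; apply/rowP => j; rewrite mxE.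
  have := S0 (0, delta_mx 0 j); rewrite /sigma (bigD1 j)//= big1 => [|k kj].
    by rewrite !mxE !eqxx /= addr0 mulr0 sub0r mul1r => /eqP; rewrite oppr_eq0 => /eqP.
  by rewrite !mxE (negbTE kj) andbF mulr0 mul0r subrr.
have := S0 (delta_mx 0 j, 0); rewrite /sigma (bigD1 j)//= big1 => [|k kj].
  by rewrite !mxE !eqxx /= addr0 mulr1 mul0r subr0.
by rewrite !mxE (negbTE kj) andbF mulr0 mul0r subrr.
Qed.

Lemma kappa_flat_vrlin : vrlin (kappa_flat Phi kappa).
Proof.
split=> [x y|t x]; rewrite /kappa_flat.
  by rewrite lift_LambdaD// linearD.
by rewrite lift_LambdaZ// linearZ.
Qed.

(** Bijectivity passes from kappa to kappa^flat through this conjugation. *)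
Lemma kappa_lift w : kappa (lift_Lambda Phi w) = lift_Lambda Phit (kappa_flat Phi kappa w).
Proof.
apply: Lambda_liftE; rewrite -kL.
exact: (ex_intro2 _ _ (lift_Lambda Phi w) (Lambda_lift Phi w) erefl).
Qed.

Lemma kappa_flat_cancel : exists L', cancel (kappa_flat Phi kappa) L' /\
  cancel L' (kappa_flat Phi kappa).
Proof.
set L := kappa_flat Phi kappa.
have Linj : injective L.
  move=> x y xy; have := kappa_lift x; rewrite -/L xy -(kappa_lift y) => /eqP.
  rewrite -subr_eq0 -linearB => /eqP/canonical_inj/eqP; rewrite subr_eq0 => /eqP.
  exact: (congr1 fst).
have Lsurj z : exists w, L w = z.
  have [_ [w _ <-] kw] : (kappa @` Lambda Phi) (lift_Lambda Phit z).
    by rewrite kL; exact: Lambda_lift.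
  by exists w; have := congr1 fst kw.
pose L' z := projT1 (cid (Lsurj z)).
have L'K : cancel L' L by move=> z; rewrite /L'; case: (cid _).
by exists L'; split=> // w; apply: Linj; rewrite L'K.
Qed.

End Flat.


(** * The phase of a Bergman kernel *)

Section Bergman.
Variable R : realType.
Local Notation C := R[i].
Local Notation normc := (@Normc.normc R).
Variable n : nat.
Local Notation V := 'rV[C]_n.
Implicit Types (x y z w v : V) (b : V -> V -> R).

(** A quadratic phase 2 Psi(z, conj w), holomorphic in z and antiholomorphic in
    w, split into its three homogeneous parts. *)
Record phase_parts (Psi : V -> V -> C) := PhaseParts {
  ph1 : V -> V -> C;
  phm : V -> V -> C;
  ph0 : V -> V -> C;
  ph1D : forall x x' y, ph1 (x + x') y = ph1 x y + ph1 x' y;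
  ph1Z : forall c x y, ph1 (c *: x) y = c * ph1 x y;
  ph1C : forall x y, ph1 x y = ph1 y x;
  phmDl : forall x x' y, phm (x + x') y = phm x y + phm x' y;
  phmZl : forall c x y, phm (c *: x) y = c * phm x y;
  phmDr : forall x y y', phm x (y + y') = phm x y + phm x y';
  phmZr : forall c x y, phm x (c *: y) = c^*%C * phm x y;
  ph0D : forall x x' y, ph0 (x + x') y = ph0 x y + ph0 x' y;
  ph0Z : forall c x y, ph0 (c *: x) y = c^*%C * ph0 x y;
  ph0C : forall x y, ph0 x y = ph0 y x;
  phE : forall z w, 2 * Psi z (conjv w) = ph1 z z + phm z w + ph0 w w }.

Lemma half_double x : 2^-1%:C *: (x + x) = x.
Proof.
apply/rowP => j; rewrite !mxE; case: (x 0 j) => p q.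
by apply/eqP; rewrite eq_complex /=; apply/andP; split; apply/eqP; field.
Qed.

Lemma conjvD x y : conjv (x + y) = conjv x + conjv y.
Proof. exact: map_mxD. Qed.

Lemma conjvZ (c : C) x : conjv (c *: x) = c^*%C *: conjv x.
Proof. by rewrite /conjv map_mxZ. Qed.

(** Twice Psi is the diagonal of the symmetric bilinear form B of its matrix;
    expanding B over (z, conj w) = (z, 0) + (0, conj w) gives the parts. *)
Lemma hol_quadratic2_parts Psi : hol_quadratic2 Psi -> inhabited (phase_parts Psi).
Proof.
move=> [A PsiE]; pose B (x y : 'rV[C]_(n + n)) := (x *m A *m y^T) 0 0 + (y *m A *m x^T) 0 0.
have BC (x y : 'rV[C]_(n + n)) : B x y = B y x by rewrite /B addrC.
have BD (x x' y : 'rV[C]_(n + n)) : B (x + x') y = B x y + B x' y.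
  by rewrite /B linearD /= !mulmxDl mulmxDr !mxE; ring.
have BZ c (x y : 'rV[C]_(n + n)) : B (c *: x) y = c * B x y.
  by rewrite /B linearZ /= -!scalemxAl -scalemxAr !mxE; ring.
have BDr (x y y' : 'rV[C]_(n + n)) : B x (y + y') = B x y + B x y' by rewrite !(BC x) BD.
have BZr c (x y : 'rV[C]_(n + n)) : B x (c *: y) = c * B x y by rewrite !(BC x) BZ.
pose e1 x : 'rV[C]_(n + n) := row_mx x 0.
pose e2 x : 'rV[C]_(n + n) := row_mx 0 (conjv x).
have e1D x y : e1 (x + y) = e1 x + e1 y by rewrite /e1 add_row_mx addr0.
have e1Z c x : e1 (c *: x) = c *: e1 x by rewrite /e1 scale_row_mx scaler0.
have e2D x y : e2 (x + y) = e2 x + e2 y by rewrite /e2 add_row_mx addr0 conjvD.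
have e2Z c x : e2 (c *: x) = c^*%C *: e2 x by rewrite /e2 scale_row_mx scaler0 conjvZ.
have e12 z w : row_mx z (conjv w) = e1 z + e2 w by rewrite /e1 /e2 add_row_mx addr0 add0r.
have BE (x : 'rV[C]_(n + n)) : 2 * (x *m A *m x^T) 0 0 = B x x by rewrite /B; ring.
clearbody B e1 e2; apply: inhabits.
apply: (@PhaseParts Psi (fun x y => B (e1 x) (e1 y))
   (fun x y => 2 * B (e1 x) (e2 y)) (fun x y => B (e2 x) (e2 y))) => //.
- by move=> x x' y; rewrite e1D BD.
- by move=> c x y; rewrite e1Z BZ.
- by move=> x x' y; rewrite e1D BD mulrDr.
- by move=> c x y; rewrite e1Z BZ mulrCA.
- by move=> x y y'; rewrite e2D BDr mulrDr.
- by move=> c x y; rewrite e2Z BZr mulrCA.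
- by move=> x x' y; rewrite e2D BD.
- by move=> c x y; rewrite e2Z BZ.
move=> z w; have := PsiE (row_mx z (conjv w)); rewrite row_mxKl row_mxKr => ->.
rewrite e12 BE BD !BDr (BC (e2 w) (e1 z)); ring.
Qed.

Section data.
Variables (b bt : V -> V -> R) (L : V -> V) (Psi : V -> V -> C) (c K : R).
Hypotheses (hb : rbil b) (hbt : rbil bt) (hL : vrlin L) (c0 : 0 < c).
Variable P : phase_parts Psi.
Hypothesis Qbound : forall z w,
  c * sqnorm (z - L w) <= bt z z + b w w - 2 * complex.Re (Psi z (conjv w))
    <= K * sqnorm (z - L w).

(** The weight Phit without the pluriharmonic part contributed by the phase:
    the quadratic form of the Gaussian integrals over z. *)
Definition bq x y := bt x y - complex.Re (ph1 P x y).

Lemma ReD (u v : C) : complex.Re (u + v) = complex.Re u + complex.Re v.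
Proof. by case: u v => [? ?] [? ?]. Qed.

Lemma ImD (u v : C) : complex.Im (u + v) = complex.Im u + complex.Im v.
Proof. by case: u v => [? ?] [? ?]. Qed.

Lemma ReZ (t : R) (u : C) : complex.Re (t%:C * u) = t * complex.Re u.
Proof. by case: u => [? ?] /=; ring. Qed.

Lemma rbil_bq : rbil bq.
Proof.
have [b1 bC] := hbt; split=> [y|x y]; last by rewrite /bq bC ph1C.
split=> [x x'|t x]; rewrite /bq.
  by rewrite (b1 y).1 ph1D ReD; ring.
by rewrite (b1 y).2 ph1Z ReZ; ring.
Qed.

Lemma Q_parts z w : bt z z + b w w - 2 * complex.Re (Psi z (conjv w))
  = bq z z + b w w - complex.Re (phm P z w) - complex.Re (ph0 P w w).
Proof.
have -> : 2 * complex.Re (Psi z (conjv w)) = complex.Re (2 * Psi z (conjv w)).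
  by rewrite -[2 in RHS](rmorph_nat (real_complex R)) ReZ.
by rewrite (phE P) !ReD /bq; ring.
Qed.

Lemma Q_graph w : bq (L w) (L w) + b w w - complex.Re (phm P (L w) w)
   - complex.Re (ph0 P w w) = 0.
Proof.
have := Qbound (L w) w; rewrite Q_parts subrr sqnorm0 !mulr0 => /andP[h1 h2].
by apply/eqP; rewrite eq_le h2.
Qed.

(** The non-negative form Phit + Phi - 2 Re Psi vanishes on the graph of L, so
    its value at (x, 0) + s (L w, w) is affine in s; being non-negative, it is
    constant in s. *)
Lemma Re_phm x w : complex.Re (phm P x w) = 2 * bq x (L w).
Proof.
have hq := rbil_bq; have [q1 qC] := hq; have [b1 bC] := hb.
pose al := bq x x; pose be := 2 * bq x (L w) - complex.Re (phm P x w).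
have H (s : R) : 0 <= al + s * be.
  have /andP[+ _] := Qbound (x + s%:C *: L w) (s%:C *: w).
  rewrite Q_parts => h.
  have {h} := le_trans (mulr_ge0 (ltW c0) (sqnorm_ge0 _)) h.
  rewrite (rbil_affine _ _ _ hq) (b1 _).2 (rbilr _ hb).2 phmDl phmZl !phmZr ph0Z ph0C ph0Z.
  rewrite conjc_real ReD !ReZ => h.
  have := Q_graph w; move: h; rewrite /al /be; nra.
apply/eqP; rewrite eq_sym -subr_eq0 -/be; apply/negPn/negP => be0.
have := H (- (al + 1) / be); rewrite divfK//; lra.
Qed.

Lemma Im_phm x w : complex.Im (phm P x w) = 2 * bq x (L ('i%C *: w)).
Proof.
rewrite -Re_phm phmZr; case: (phm P x w) => u v /=; ring.
Qed.

Lemma bq_L_diag w : bq (L w) (L w) = b w w - complex.Re (ph0 P w w).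
Proof. by have := Q_graph w; rewrite Re_phm; lra. Qed.

Lemma bq_L x y : bq (L x) (L y) = b x y - complex.Re (ph0 P x y).
Proof.
have hq := rbil_bq; have [q1 qC] := hq; have [b1 bC] := hb.
have := bq_L_diag (x + y); have := bq_L_diag x; have := bq_L_diag y.
rewrite hL.1 (q1 _).1 !(rbilr _ hq).1 (b1 _).1 !(rbilr _ hb).1 ph0D.
rewrite (ph0C P x (x + y)) (ph0C P y (x + y)) !ph0D !ReD.
rewrite (qC (L y) (L x)) (bC y x) (ph0C P y x); lra.
Qed.

Lemma bq_pos x : c * sqnorm x <= bq x x.
Proof.
have L0 : L 0 = 0 by have := hL.2 0 0; rewrite !scale0r.
have /andP[+ _] := Qbound x 0; rewrite Q_parts L0 subr0.
have m0 : phm P x 0 = 0 by have := phmZr P 0 x 0; rewrite scaler0 rmorph0 mul0r.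
have p0 : ph0 P 0 0 = 0 by have := ph0Z P 0 0 0; rewrite scaler0 rmorph0 mul0r.
by rewrite (rlin0 (rbilr _ hb)) m0 p0 /= !subr0 addr0.
Qed.

(** Up to the form ph0, which changes sign under w |-> i w and so cancels, the
    weight Phi is the pull-back of the positive definite form bq by L. *)
Lemma weight_pos m : 0 < m -> (forall w, m * sqnorm w <= sqnorm (L w)) ->
  forall y, c * m * sqnorm y <= b y y + b ('i%C *: y) ('i%C *: y).
Proof.
move=> m0 Lm y; have h1 := bq_L_diag y; have h2 := bq_L_diag ('i%C *: y).
move: h2; rewrite ph0Z ph0C ph0Z => h2.
have : complex.Re (('i%C)^*%C * (('i%C)^*%C * ph0 P y y)) = - complex.Re (ph0 P y y).
  by case: (ph0 P y y) => u v /=; ring.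
have := le_trans (ler_wpM2l (ltW c0) (Lm y)) (bq_pos (L y)).
have := le_trans (mulr_ge0 (ltW c0) (sqnorm_ge0 _)) (bq_pos (L ('i%C *: y))).
move: h1 h2; lra.
Qed.

(** The polarization of the weight, evaluated at (w, conj w'). *)
Definition pol w w' : C :=
  let A := 2^-1%:C *: (w + w') in let B := 2^-1%:C *: ('i%C *: (w' - w)) in
  (b A A - b B B) +i* (2 * b A B).

(** The exponent of conj(kernel at w) times kernel at w' times exp(- 2 Phit),
    as a quadratic polynomial in z: by stationarity its linear part is given by
    bq, with w = A + i B and w' = A - i B. *)
Lemma phase_product z w w' :
  let A := 2^-1%:C *: (w + w') in let B := 2^-1%:C *: ('i%C *: (w' - w)) in
  (2 * Psi z (conjv w))^*%C + 2 * Psi z (conjv w') - (2 * bt z z)%:C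
  = ((- 2 * bq z z + 4 * bq z (L A)) +i* (4 * bq z (L B)))
    + ((ph0 P w w)^*%C + ph0 P w' w').
Proof.
move=> A B; rewrite !(phE P).
have hq := rbil_bq.
have E1 : 4 * bq z (L A) = complex.Re (phm P z w) + complex.Re (phm P z w').
  by rewrite !Re_phm /A hL.2 hL.1 (rbilr _ hq).2 (rbilr _ hq).1; field.
have E2 : 4 * bq z (L B) = complex.Im (phm P z w') - complex.Im (phm P z w).
  rewrite !Im_phm /B hL.2 scalerBr (vrlinB _ _ hL) (rbilr _ hq).2 (rlinB _ _ (rbilr _ hq)).
  by field.
rewrite E1 E2 /bq; case: (ph1 P z z) (phm P z w) (phm P z w') (ph0 P w w) (ph0 P w' w')
  => [a1 a2] [m1 m2] [k1 k2] [p1 p2] [q1 q2].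
by apply/eqP; rewrite eq_complex /=; apply/andP; split; apply/eqP; ring.
Qed.

(** Completing the square in the exponent leaves the polarization of Phi. *)
Lemma completed_square w w' :
  let A := 2^-1%:C *: (w + w') in let B := 2^-1%:C *: ('i%C *: (w' - w)) in
  ((2 * bq (L A) (L A) - 2 * bq (L B) (L B)) +i* (4 * bq (L A) (L B)))
    + ((ph0 P w w)^*%C + ph0 P w' w') = 2 * pol w w'.
Proof.
move=> A B; rewrite !bq_L /pol -/A -/B.
have wE : w = A + 'i%C *: B.
  rewrite /A /B [_%:C *: ('i%C *: _)]scalerA mulrC -scalerA ['i%C *: ('i%C *: _)]scaleii.
  by rewrite -scalerN -scalerDr opprB addrACA subrr addr0 half_double.
have wE' : w' = A - 'i%C *: B.
  rewrite /A /B [_%:C *: ('i%C *: _)]scalerA mulrC -scalerA ['i%C *: ('i%C *: _)]scaleii.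
  by rewrite opprK -scalerDr [w + w']addrC addrACA subrr addr0 half_double.
clearbody A B; rewrite wE wE' -[- ('i%C *: B)]scaleNr.
rewrite !ph0D !(ph0C P _ (_ + _)) !ph0D !ph0Z !(ph0C P _ (_ *: _)) !ph0Z.
rewrite (ph0C P B A) -[2 in RHS](rmorph_nat (real_complex R)).
case: (ph0 P A A) (ph0 P A B) (ph0 P B B) => [a1 a2] [m1 m2] [d1 d2].
by apply/eqP; rewrite eq_complex /=; apply/andP; split; apply/eqP; ring.
Qed.

End data.
End Bergman.


(** * Complex Gaussian integrals *)

Section Gaussian.
Variable R : realType.
Local Notation C := R[i].
Local Notation normc := (@Normc.normc R).
Variable n : nat.
Local Notation V := 'rV[C]_n.
Implicit Types (x y z w v : V) (b : V -> V -> R).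

Lemma circle_point (t : R) : cexp (0 +i* (2 * pi * t)) = cos (2 * pi * t) +i* sin (2 * pi * t).
Proof. by rewrite /cexp /= expR0 mul1r. Qed.

Lemma circle_continuous (g : C -> C) : (forall z : C, cderivable g z) ->
  continuous (fun t : R => complex.Re (g (cos (2 * pi * t) +i* sin (2 * pi * t)))) /\
  continuous (fun t : R => complex.Im (g (cos (2 * pi * t) +i* sin (2 * pi * t)))).
Proof.
move=> dg; pose F (z : C) := g (cexp ((2 * pi)%:C * z)).
have dF (z : C) : cderivable F z.
  apply: (cderivable_comp (f := g)) => //.
  apply: (cderivable_comp (f := @cexp R)); last exact: cderivable_cexp.
  by apply: cderivableZ; exact: cderivable_id.
have [_ h1 _ h2] := cauchy_riemann_continuous (cderivable_cauchy_riemann dF) 0 0.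
have FE (t : R) : F (0 +i* t) = g (cos (2 * pi * t) +i* sin (2 * pi * t)).
  rewrite /F -circle_point; congr (g (cexp _)).
  by apply/eqP; rewrite eq_complex /=; apply/andP; split; apply/eqP; ring.
split.
  by rewrite (_ : (fun t => _) = fun t => complex.Re (F (0 +i* t)))//; apply/funext => t; rewrite FE.
by rewrite (_ : (fun t => _) = fun t => complex.Im (F (0 +i* t)))//; apply/funext => t; rewrite FE.
Qed.

(** Rotation averaging for complex functions whose restriction to each orbit
    circle is the boundary value of an entire function. *)
Lemma rotation_mean (H : haar_space R) (F : H * H -> C) (g : H * H -> C -> C) :
  cinteg (prodm (hs_measure H) (hs_measure H)) F ->
  (forall p (z : C), cderivable (g p) z) ->
  (forall p (t : R), F (rot2 (cos (2 * pi * t)) (sin (2 * pi * t)) p)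
      = g p (cos (2 * pi * t) +i* sin (2 * pi * t))) ->
  Cintegral (prodm (hs_measure H) (hs_measure H)) F
  = Cintegral (prodm (hs_measure H) (hs_measure H)) (fun p => g p 0).
Proof.
move=> [F1 F2] dg Fg; rewrite /Cintegral /Rintegral; congr (fine _ +i* fine _).
  apply: (rotation_average (M := fun p => complex.Re (g p 0)) F1) => p.
    by under eq_fun do rewrite Fg; exact: (circle_continuous (dg p)).1.
  rewrite -(circle_mean_Re (dg p)); congr itg; apply/funext => t.
  by rewrite Fg circle_point.
apply: (rotation_average (M := fun p => complex.Im (g p 0)) F2) => p.
  by under eq_fun do rewrite Fg; exact: (circle_continuous (dg p)).2.
rewrite -(circle_mean_Im (dg p)); congr itg; apply/funext => t.
by rewrite Fg circle_point.
Qed.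

Lemma cderivable_cexpM (a X z : C) : cderivable (fun t => a * cexp (X * t)) z.
Proof.
apply: cderivableZ; apply: (cderivable_comp (f := @cexp R)); last exact: cderivable_cexp.
by apply: cderivableZ; exact: cderivable_id.
Qed.

Section form.
Variables (q : V -> V -> R) (c : R).
Hypotheses (hq : rbil q) (c0 : 0 < c) (qc : forall x, c * sqnorm x <= q x x).

Let vol2 : {measure set (vspace R n * vspace R n)%type -> \bar R} :=
  prodm (vol R n) (vol R n).

Definition gauss_mass := Rintegral (vol R n) setT (fun p => expR (- 2 * q (cvec p) (cvec p))).

Lemma measurable_form d (T : measurableType d) (X : T -> V) (a : V) : mvec X ->
  measurable_fun setT (fun t => q (X t) (X t)) /\ measurable_fun setT (fun t => q (X t) a).
Proof.
move=> mX; have [q1 qC] := hq.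
have Qc (r : R) : measurable_fun setT (fun _ : T => r) by exact: measurable_cst.
have QD (f g : T -> R) : measurable_fun setT f -> measurable_fun setT g ->
    measurable_fun setT (fun t => f t + g t) by exact: measurable_funD.
have QM (f g : T -> R) : measurable_fun setT f -> measurable_fun setT g ->
    measurable_fun setT (fun t => f t * g t) by exact: measurable_funM.
split.
  by apply: (rbil_class Qc QD QM) => // [y|j|j|j|j]; [exact: rbilr|exact: (mX j).1|
    exact: (mX j).2|exact: (mX j).1|exact: (mX j).2].
by apply: (rlin_class Qc QD QM (q1 a)) => j; [exact: (mX j).1|exact: (mX j).2].
Qed.

Lemma integ_form : integ (vol R n) (fun p => expR (- 2 * q (cvec p) (cvec p))).
Proof.
have e0 : 0 < 2 * c by rewrite mulr_gt0.
apply: integ_le (gaussian_integ n e0).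
  apply: (measurableT_comp (f := @expR R)) => //; apply: measurable_funM => //.
  by have [] := measurable_form 0 (mvec_cvec (f := id) (@measurable_id _ (vspace R n) setT)).
move=> p; rewrite ger0_norm ?expR_ge0// ler_expR.
by have := qc (cvec p); lra.
Qed.

Lemma gauss_mass_gt0 : 0 < gauss_mass.
Proof.
apply: Rintegral_gt0; [exact: vol_setT_gt0|exact: integ_form|].
by move=> p; exact: expR_gt0.
Qed.

Lemma shift_form A z : - 2 * q z z + 4 * q z A = - 2 * q (z - A) (z - A) + 2 * q A A.
Proof.
have [q1 qC] := hq.
rewrite (rlinB _ _ (q1 _)) !(rlinB _ _ (rbilr _ hq)) (qC A z); ring.
Qed.

Lemma integ_form_lin A : integ (vol R n)
  (fun p => expR (- 2 * q (cvec p) (cvec p) + 4 * q (cvec p) A)).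
Proof.
have := integZ (expR (2 * q A A)) (integrable_preserves (preserves_vtrans (- A)) integ_form).
congr (integ _ _); apply/funext => p /=.
by rewrite -expRD cvec_vtrans shift_form addrC.
Qed.

Lemma Rintegral_form_lin A : Rintegral (vol R n) setT
  (fun p => expR (- 2 * q (cvec p) (cvec p) + 4 * q (cvec p) A))
  = expR (2 * q A A) * gauss_mass.
Proof.
have h := integrable_preserves (preserves_vtrans (- A)) integ_form.
have e := integral_preserves (preserves_vtrans (- A)) integ_form.
rewrite /gauss_mass {2}/Rintegral -e -RintegralZl//.
apply: eq_Rintegral => p _ /=.
by rewrite -expRD cvec_vtrans shift_form addrC.
Qed.

Lemma cexp_split (a t : R) : cexp (a +i* t) = (expR a)%:C * cexp (0 +i* t).
Proof. by rewrite /cexp /= expR0 mul1r. Qed.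

Lemma cmeas_form_phase A B : cmeas (fun p : vspace R n =>
  cexp ((- 2 * q (cvec p) (cvec p) + 4 * q (cvec p) A) +i* (4 * q (cvec p) B))).
Proof.
have mv := mvec_cvec (f := id) (@measurable_id _ (vspace R n) setT).
have [m1 m2] := measurable_form A mv; have [_ m3] := measurable_form B mv.
apply: cmeas_cexp; split=> /=.
  by apply: measurable_funD; apply: measurable_funM.
exact: measurable_funM.
Qed.

Lemma cinteg_form_phase A B : cinteg (vol R n) (fun p =>
  cexp ((- 2 * q (cvec p) (cvec p) + 4 * q (cvec p) A) +i* (4 * q (cvec p) B))).
Proof.
apply: cinteg_le (cmeas_form_phase A B) _ (integ_form_lin A) => p.
by rewrite normc_cexp.
Qed.

(** The Fourier transform of the Gaussian: on pairs (z1, z2) the function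
    exp(4 (q(z1,B) + i q(z2,B))) is holomorphic along rotation orbits, so that
    its Gaussian mean is its value 1 at the origin; the z1 integral is a real
    translation, and only the z2 integral is unknown. *)
Lemma gauss_fourier B : Cintegral (vol R n) (fun p =>
    cexp ((- 2 * q (cvec p) (cvec p) + 4 * q (cvec p) 0) +i* (4 * q (cvec p) B)))
  = (expR (- 2 * q B B) * gauss_mass)%:C.
Proof.
set X := Cintegral _ _.
have q0 z : q z 0 = 0 by rewrite (rlin0 (rbilr z hq)).
pose E (p : vspace R n) := expR (- 2 * q (cvec p) (cvec p) + 4 * q (cvec p) B).
pose f (p : vspace R n) : C :=
  cexp ((- 2 * q (cvec p) (cvec p) + 4 * q (cvec p) 0) +i* (4 * q (cvec p) B)).
pose F (p : vspace R n * vspace R n) : C := (E p.1)%:C * f p.2.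
have mf : cmeas f by exact: cmeas_form_phase.
have fi : cinteg (vol R n) f by exact: cinteg_form_phase.
have Ei : integ (vol R n) E by exact: integ_form_lin.
have mF : cmeas F.
  apply: cmeasM.
    by apply: cmeas_real; exact: (measurableT_comp (integ_measurable Ei) measurable_fst).
  split; first exact: (measurableT_comp mf.1 measurable_snd).
  exact: (measurableT_comp mf.2 measurable_snd).
have iF : cinteg (prodm (vol R n) (vol R n)) F.
  apply: cinteg_le mF _ (integ_prodm Ei (integ_form_lin 0)) => p.
  rewrite /F Normc.normcM /f normc_cexp /= expr0n addr0 sqrtr_sqr.
  by rewrite ger0_norm ?expR_ge0.
have F1 : Cintegral (prodm (vol R n) (vol R n)) F
    = (expR (2 * q B B) * gauss_mass)%:C * X.
  rewrite Cintegral_prodm12//; last first.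
    move=> p; rewrite /F /=; apply: (cinteg_le _ _ (integZ (E p) (integ_form_lin 0))).
      by apply: cmeasM => //; exact: cmeas_cst.
    move=> p2; rewrite Normc.normcM /f normc_cexp /= expr0n addr0 sqrtr_sqr.
    by rewrite ger0_norm ?expR_ge0.
  transitivity (Cintegral (vol R n) (fun p => X * (E p)%:C)).
    by apply: eq_Cintegral => p; rewrite /F /= CintegralZ// mulrC.
  rewrite CintegralZ; last by split => //; exact: (integrable0 _ _).
  rewrite mulrC; congr (_ * _).
  rewrite /Cintegral /= Rintegral_form_lin; congr Complex.
  by rewrite /Rintegral integral0.
pose Y (p : vspace R n * vspace R n) : C :=
  4%:C * (q (cvec p.1) B +i* q (cvec p.2) B).
pose G (p : vspace R n * vspace R n) : R :=
  expR (- 2 * q (cvec p.1) (cvec p.1)) * expR (- 2 * q (cvec p.2) (cvec p.2)).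
have F2 : Cintegral (prodm (vol R n) (vol R n)) F = (gauss_mass * gauss_mass)%:C.
  rewrite (@rotation_mean (vspace R n) F (fun p t => (G p)%:C * cexp (Y p * t)) iF).
  - transitivity ((Rintegral vol2 setT G)%:C).
      rewrite /Cintegral; congr Complex.
        by apply: eq_Rintegral => p _; rewrite mulr0 cexp0 mulr1.
      transitivity (Rintegral vol2 setT (fun=> 0)); last by rewrite /Rintegral integral0.
      by apply: eq_Rintegral => p _; rewrite mulr0 cexp0 mulr1.
    congr (_%:C); rewrite Rintegral_prodm12.
    + transitivity (Rintegral (vol R n) setT
          (fun p => expR (- 2 * q (cvec p) (cvec p)) * gauss_mass)).
        by apply: eq_Rintegral => p _; rewrite /G /= RintegralZl//; exact: integ_form.
      by rewrite RintegralZr//; exact: integ_form.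
    + exact: integ_prodm integ_form integ_form.
    + by move=> p; exact: (integZ (expR (- 2 * q (cvec p) (cvec p))) integ_form).
  - by move=> p z; exact: (cderivable_cexpM (G p)%:C (Y p) z).
  move=> [p1 p2] t; rewrite /F /E /f /G /Y /rot2 /= !cvec_comb q0.
  have := cos2Dsin2 (2 * pi * t : R).
  set cc := cos _; set ss := sin _ => cs; set z1 := cvec p1; set z2 := cvec p2.
  have [q1 qC] := hq.
  rewrite !((q1 _).1, (q1 _).2, (rbilr _ hq).1, (rbilr _ hq).2) (qC z2 z1).
  have cexpM (a a' t' : R) : (expR a)%:C * cexp (a' +i* t') = cexp ((a + a') +i* t').
    by rewrite (cexp_split a') (cexp_split (a + a')) mulrA -rmorphM -expRD.
  have cexpM' (a a' : R) (Z : C) : (expR a * expR a')%:C * cexp Z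
      = cexp ((a + a' + complex.Re Z) +i* complex.Im Z).
    by case: Z => u u' /=; rewrite -expRD cexpM.
  rewrite cexpM cexpM'; congr cexp.
  apply/eqP; rewrite eq_complex /=; apply/andP; split; last by apply/eqP; ring.
  set q11 := q z1 z1; set q22 := q z2 z2; set q12 := q z1 z2.
  set q1B := q z1 B; set q2B := q z2 B.
  rewrite -subr_eq0 [X in X == 0](_ : _ = - 2 * (q11 + q22) * (cc ^+ 2 + ss ^+ 2 - 1)).
    by rewrite cs subrr mulr0.
  by ring.
have m0 := gauss_mass_gt0.
have nz : (expR (2 * q B B) * gauss_mass)%:C != 0 :> C.
  by rewrite (fmorph_eq0 (real_complex R)) gt_eqF// mulr_gt0// expR_gt0.
apply: (mulfI nz); rewrite -F1 F2 -rmorphM; congr (_%:C).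
rewrite mulrACA -expRD [X in expR X](_ : _ = 0); last by ring.
by rewrite expR0 mul1r.
Qed.

(** The real part of the linear term is removed by a translation. *)
Lemma gauss_complex A B : Cintegral (vol R n) (fun p =>
    cexp ((- 2 * q (cvec p) (cvec p) + 4 * q (cvec p) A) +i* (4 * q (cvec p) B)))
  = cexp ((2 * q A A - 2 * q B B) +i* (4 * q A B)) * gauss_mass%:C.
Proof.
have [q1 qC] := hq.
have h := Cintegral_preserves (preserves_vtrans (- A)) (cinteg_form_phase 0 B).
have hi := cinteg_preserves (preserves_vtrans (- A)) (cinteg_form_phase 0 B).
transitivity (Cintegral (vol R n) (fun p => cexp ((2 * q A A) +i* (4 * q A B)) *
    cexp ((- 2 * q (cvec (vtrans (- A) p)) (cvec (vtrans (- A) p))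
      + 4 * q (cvec (vtrans (- A) p)) 0) +i* (4 * q (cvec (vtrans (- A) p)) B)))).
  apply: eq_Cintegral => p; rewrite cvec_vtrans -cexpD; congr cexp.
  apply/eqP; rewrite eq_complex /=; apply/andP; split; apply/eqP.
    by rewrite shift_form (rlin0 (rbilr _ hq)); ring.
  by rewrite (rlinB _ _ (q1 B)); ring.
rewrite CintegralZ// h gauss_fourier.
have -> : (expR (- 2 * q B B) * gauss_mass)%:C
    = cexp (- (2 * q B B) +i* 0) * gauss_mass%:C.
  by rewrite cexp_split cexp0 mulr1 -rmorphM mulNr.
rewrite mulrA -cexpD; congr (cexp _ * _).
by apply/eqP; rewrite eq_complex /=; apply/andP; split; apply/eqP; ring.
Qed.

End form.
End Gaussian.


(** * The reproducing property *)

Section Reproducing.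
Variable R : realType.
Local Notation C := R[i].
Local Notation normc := (@Normc.normc R).
Variable n : nat.
Local Notation V := 'rV[C]_n.
Implicit Types (x y z w v : V).

Lemma holomorphic_line (u : V -> C) w y (t : C) : holomorphic u ->
  cderivable (fun s : C => u (w + s *: y)) t.
Proof.
move=> hu; apply: (cderivable_derivable (u := u : V -> C^o)).
exact: diff_derivable.
Qed.

Section weight.
Variables (b : V -> V -> R) (h : R).
Hypotheses (hb : rbil b) (h0 : 0 < h).
Hypothesis Hpos : forall y, h * sqnorm y <= b y y + b ('i%C *: y) ('i%C *: y).

Definition rotweight y := b y y + b ('i%C *: y) ('i%C *: y).

Lemma rotweight_rot (cc ss : R) y : cc ^+ 2 + ss ^+ 2 = 1 ->
  rotweight ((cc +i* ss) *: y) = rotweight y.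
Proof.
move=> cs; have [b1 bC] := hb; rewrite /rotweight.
have -> : 'i%C *: ((cc +i* ss) *: y) = (cc +i* ss) *: ('i%C *: y).
  by rewrite !scalerA mulrC.
rewrite !(scale_complexE (cc +i* ss)) scaleii /=.
rewrite !((b1 _).1, (b1 _).2, (rbilr _ hb).1, (rbilr _ hb).2, rlinN _ (b1 _), rlinN _ (rbilr _ hb)).
rewrite (bC ('i%C *: y) y).
set p := b y y; set r := b ('i%C *: y) ('i%C *: y); set s := b y ('i%C *: y).
apply/eqP; rewrite -subr_eq0 [X in X == 0](_ : _ = (p + r) * (cc ^+ 2 + ss ^+ 2 - 1)).
  by rewrite cs subrr mulr0.
by ring.
Qed.

Definition hol_lin w y : C := -2%:C * (b w y -i* b w ('i%C *: y)).
Definition hol_quad y : C :=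
  - 2^-1%:C * ((b y y - b ('i%C *: y) ('i%C *: y)) -i* (2 * b y ('i%C *: y))).

Lemma hol_linZ w (t : C) y : hol_lin w (t *: y) = t * hol_lin w y.
Proof.
have := dlinZ w t y hb; rewrite /dlin /hol_lin => ->; ring.
Qed.

Lemma hol_quadZ (t : C) y : hol_quad (t *: y) = t ^+ 2 * hol_quad y.
Proof.
have [b1 bC] := hb; rewrite /hol_quad.
have -> : 'i%C *: (t *: y) = t *: ('i%C *: y) by rewrite !scalerA mulrC.
rewrite !(scale_complexE t) scaleii.
rewrite !((b1 _).1, (b1 _).2, (rbilr _ hb).1, (rbilr _ hb).2, rlinN _ (b1 _), rlinN _ (rbilr _ hb)).
rewrite (bC ('i%C *: y) y); case: t => t s /=.
by apply/eqP; rewrite eq_complex /=; apply/andP; split; apply/eqP; ring.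
Qed.

(** The exponent of the Bergman kernel times exp(- 2 Phi), recentred at w: a
    holomorphic polynomial in y minus a form invariant under y |-> e^(it) y. *)
Lemma pol_expand w y :
  2 * pol b w (y + w) - (2 * b (y + w) (y + w))%:C
  = hol_lin w y + hol_quad y - (rotweight y)%:C.
Proof.
have [b1 bC] := hb; rewrite /pol /hol_lin /hol_quad /rotweight addrK.
have iA : 2^-1%:C *: (w + (y + w)) = w + 2^-1%:C *: y.
  by rewrite addrCA scalerDr half_double addrC.
rewrite iA -[2 in LHS](rmorph_nat (real_complex R)).
rewrite !((b1 _).1, (b1 _).2, (rbilr _ hb).1, (rbilr _ hb).2) (bC y w).
set p := b y y; set r := b ('i%C *: y) ('i%C *: y); set s := b y ('i%C *: y).
set a := b w w; set d := b w y; set e := b w ('i%C *: y).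
by apply/eqP; rewrite eq_complex /=; apply/andP; split; apply/eqP; field.
Qed.

Lemma Re_pol w z : complex.Re (2 * pol b w z - (2 * b z z)%:C)
  = b w w - b z z - rotweight (z - w) / 2.
Proof.
have -> : z = (z - w) + w by rewrite subrK.
rewrite addrK; move: (z - w) => y; rewrite pol_expand.
have [b1 bC] := hb; rewrite /hol_lin /hol_quad /rotweight.
rewrite !((b1 _).1, (b1 _).2, (rbilr _ hb).1, (rbilr _ hb).2) (bC y w) /=.
by field.
Qed.

Definition rot_mass : R := Rintegral (vol R n) setT (fun p => expR (- rotweight (cvec p))).

Lemma measurable_rotweight : measurable_fun setT (fun p : vspace R n => rotweight (cvec p)).
Proof.
have mv := mvec_cvec (f := id) (@measurable_id _ (vspace R n) setT).
have [b1 bC] := hb.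
have hi : rbil (fun x y => b ('i%C *: x) ('i%C *: y)).
  split=> [y|x y]; last exact: bC.
  split=> [x x'|t x]; first by rewrite scalerDr (b1 _).1.
  by rewrite scalerA mulrC -scalerA (b1 _).2.
apply: measurable_funD; first by have [] := measurable_form hb 0 mv.
by have [] := measurable_form hi 0 mv.
Qed.

Lemma integ_rotweight : integ (vol R n) (fun p => expR (- rotweight (cvec p))).
Proof.
apply: integ_le (gaussian_integ n h0).
  apply: (measurableT_comp (f := @expR R)) => //; apply: measurable_funN.
  exact: measurable_rotweight.
by move=> p; rewrite ger0_norm ?expR_ge0// ler_expR mulNr lerN2.
Qed.

Lemma rot_mass_gt0 : 0 < rot_mass.
Proof.
apply: Rintegral_gt0; [exact: vol_setT_gt0|exact: integ_rotweight|].
by move=> p; exact: expR_gt0.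
Qed.

Lemma cmeas_pol w : cmeas (fun p : vspace R n =>
  2 * pol b w (cvec p) - (2 * b (cvec p) (cvec p))%:C).
Proof.
have mv := mvec_cvec (f := id) (@measurable_id _ (vspace R n) setT).
have [b1 bC] := hb; have br x := rbilr x hb.
have Qc (r : R) : measurable_fun setT (fun _ : vspace R n => r) by exact: measurable_cst.
have QD (f g : vspace R n -> R) : measurable_fun setT f -> measurable_fun setT g ->
    measurable_fun setT (fun t => f t + g t) by exact: measurable_funD.
have QM (f g : vspace R n -> R) : measurable_fun setT f -> measurable_fun setT g ->
    measurable_fun setT (fun t => f t * g t) by exact: measurable_funM.
have ml l : rlin l -> measurable_fun setT (fun p : vspace R n => l (cvec p)).
  by move=> hl; apply: (rlin_class Qc QD QM hl) => j; [exact: (mv j).1|exact: (mv j).2].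
have mb (f : V -> V -> R) : (forall y, rlin (f^~ y)) -> (forall x, rlin (f x)) ->
    measurable_fun setT (fun p : vspace R n => f (cvec p) (cvec p)).
  by move=> f1 f2; apply: (rbil_class Qc QD QM) => // j;
    [exact: (mv j).1|exact: (mv j).2|exact: (mv j).1|exact: (mv j).2].
have ri l : rlin l -> rlin (fun x => l ('i%C *: x)).
  move=> hl; split=> [x y|t x]; first by rewrite scalerDr hl.1.
  by rewrite scalerA mulrC -scalerA hl.2.
rewrite -[2 in X in cmeas X](rmorph_nat (real_complex R)).
pose Re' z := (b w w + 2 * b z w + b z z) / 2 - (b ('i%C *: z) ('i%C *: z)
  - 2 * b ('i%C *: z) ('i%C *: w) + b ('i%C *: w) ('i%C *: w)) / 2 - 2 * b z z.
pose Im' z := b ('i%C *: z) w - b w ('i%C *: w) + b z ('i%C *: z) - b z ('i%C *: w).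
have E z : 2%:C * pol b w z - (2 * b z z)%:C = Re' z +i* Im' z.
  rewrite /pol /Re' /Im' (bC ('i%C *: z) w) scalerBr.
  rewrite !((b1 _).1, (b1 _).2, (br _).1, (br _).2, rlinN _ (b1 _), rlinN _ (br _)).
  rewrite (bC w z) (bC ('i%C *: w) ('i%C *: z)).
  by apply/eqP; rewrite eq_complex /=; apply/andP; split; apply/eqP; field.
rewrite (_ : (fun p => _) = fun p => Re' (cvec p) +i* Im' (cvec p)); last by apply/funext.
have m1 := mb _ b1 br.
have m2 : measurable_fun setT (fun p : vspace R n => b ('i%C *: cvec p) ('i%C *: cvec p)).
  by apply: (mb (fun x y => b ('i%C *: x) ('i%C *: y))) => x; [exact: (ri _ (b1 ('i%C *: x)))|exact: (ri _ (br ('i%C *: x)))].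
have m3 : measurable_fun setT (fun p : vspace R n => b (cvec p) ('i%C *: cvec p)).
  by apply: (mb (fun x y => b x ('i%C *: y))) => x; [exact: (b1 ('i%C *: x))|exact: (ri _ (br x))].
have m4 x : measurable_fun setT (fun p : vspace R n => b (cvec p) x) by exact: (ml _ (b1 x)).
have m5 x : measurable_fun setT (fun p : vspace R n => b ('i%C *: cvec p) x).
  by apply: (ml (fun z => b ('i%C *: z) x)); exact: (ri _ (b1 x)).
split=> /=; rewrite /Re' /Im'.
  apply: measurable_funB; last exact: measurable_funM.
  apply: measurable_funB; apply: measurable_funM => //.
    by apply: measurable_funD => //; apply: measurable_funD => //; exact: measurable_funM.
  by apply: measurable_funD => //; apply: measurable_funB => //; exact: measurable_funM.
by apply: measurable_funB => //; apply: measurable_funD => //; exact: measurable_funB.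
Qed.

Lemma cinteg_reproducing w u : continuous u ->
  subgaussian (fun z => normc (u z) * expR (- b z z)) ->
  cinteg (vol R n) (fun p => cexp (2 * pol b w (cvec p) - (2 * b (cvec p) (cvec p))%:C) * u (cvec p)).
Proof.
move=> cu sU; have h4 : 0 < h / 4 by rewrite divr_gt0.
apply: cinteg_le (integZ (expR (b w w + h / 2 * sqnorm w)) (sU _ h4)).
  by apply: cmeasM; [exact/cmeas_cexp/cmeas_pol|exact: cmeas_vol].
move=> p; set z := cvec p; rewrite Normc.normcM normc_cexp Re_pol.
rewrite [normc (u z) * _]mulrC [leRHS]mulrA [leRHS]mulrA ler_wpM2r ?normc_ge0//.
rewrite -!expRD ler_expR.
have := Hpos (z - w); rewrite -/(rotweight (z - w)) => h1.
have h2 : h * sqnorm z <= h * (2 * sqnorm (z - w) + 2 * sqnorm w).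
  by rewrite ler_pM2l//; have := sqnormD_le (z - w) w; rewrite subrK.
lra.
Qed.

(** The reproducing property of the Bergman kernel exp(2 pol(w, z)): recentred
    at w, the integrand is an entire function times a Gaussian invariant under
    y -> e^(it) y, and the mean value property picks the value at y = 0. *)
Lemma bergman_reproducing w u : holomorphic u ->
  subgaussian (fun z => normc (u z) * expR (- b z z)) ->
  Cintegral (vol R n)
    (fun p => cexp (2 * pol b w (cvec p) - (2 * b (cvec p) (cvec p))%:C) * u (cvec p))
  = rot_mass%:C * u w.
Proof.
move=> hu sU; have cu := holomorphic_continuous hu.
have iF0 := cinteg_reproducing w cu sU.
rewrite -(Cintegral_preserves (preserves_vtrans w) iF0).
have iF := cinteg_preserves (preserves_vtrans w) iF0.
pose g (p : vspace R n) (t : C) : C := (expR (- rotweight (cvec p)))%:C *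
  (cexp (t * hol_lin w (cvec p) + t ^+ 2 * hol_quad (cvec p)) * u (w + t *: cvec p)).
have gE p (c s : R) : c ^+ 2 + s ^+ 2 = 1 ->
    cexp (2 * pol b w (cvec (vtrans w (rot2 (V := tuple_space R n) c s p)))
      - (2 * b (cvec (vtrans w (rot2 (V := tuple_space R n) c s p)))
               (cvec (vtrans w (rot2 (V := tuple_space R n) c s p))))%:C)
    * u (cvec (vtrans w (rot2 (V := tuple_space R n) c s p))) = g p (c +i* s).
  move=> cs; rewrite !cvec_vtrans !cvec_rot2 pol_expand hol_linZ hol_quadZ.
  rewrite rotweight_rot// cexpD [cexp (- _%:C)](_ : _ = (expR (- rotweight (cvec p)))%:C).
    by rewrite /g [w + _]addrC; ring.
  by rewrite /cexp /= oppr0 cos0 sin0 mulr1.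
rewrite (@rotation_mean _ (tuple_space R n) _ g iF).
- transitivity (Cintegral (vol R n) (fun p => u w * (expR (- rotweight (cvec p)))%:C)).
    apply: eq_Cintegral => p; rewrite /g mul0r expr0n mul0r addr0 cexp0 mul1r scale0r addr0.
    by rewrite mulrC.
  rewrite CintegralZ; last by split; [exact: integ_rotweight|exact: integrable0].
  by rewrite mulrC /Cintegral /= /Rintegral integral0.
- move=> p t; apply: cderivableZ; apply: cderivableM; last exact: holomorphic_line.
  apply: (cderivable_comp (f := @cexp R)); last exact: cderivable_cexp.
  apply: cderivableD.
    rewrite (_ : (fun t => _) = fun t => hol_lin w (cvec p) * t); last by apply/funext => s; rewrite mulrC.
    by apply: cderivableZ; exact: cderivable_id.
  rewrite (_ : (fun t => _) = fun t => hol_quad (cvec p) * t ^+ 2); last by apply/funext => s; rewrite mulrC.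
  by apply: cderivableZ; exact: cderivable_sqr.
- by move=> p t; apply: gE; exact: cos2Dsin2.
Qed.

End weight.
End Reproducing.


(** * Inversion of the Bergman transform *)

Section Inversion.
Variable R : realType.
Local Notation C := R[i].
Local Notation normc := (@Normc.normc R).
Variable n : nat.
Local Notation V := 'rV[C]_n.
Implicit Types (x y z w v : V) (b : V -> V -> R).

Lemma cexp_conj (Z : C) : cexp Z^*%C = (cexp Z)^*%C.
Proof.
case: Z => s t; rewrite /cexp /= cosN sinN.
by apply/eqP; rewrite eq_complex /=; apply/andP; split; apply/eqP; ring.
Qed.

Lemma cexp_real (t : R) : cexp t%:C = (expR t)%:C.
Proof. by rewrite /cexp /= cos0 sin0 mulr1. Qed.

Lemma normc_conj (Z : C) : normc Z^*%C = normc Z.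
Proof. by case: Z => s t /=; rewrite sqrrN. Qed.

Lemma normc_real (t : R) : normc t%:C = `|t|.
Proof. by rewrite /= expr0n addr0 sqrtr_sqr. Qed.

Lemma cmeas_phase d (T : measurableType d) (X Y : T -> V) Psi : phase_parts Psi ->
  mvec X -> mvec Y -> cmeas (fun t => 2 * Psi (X t) (conjv (Y t))).
Proof.
move=> P mX mY.
have Qc (r : R) : measurable_fun setT (fun _ : T => r) by exact: measurable_cst.
have QD (f g : T -> R) : measurable_fun setT f -> measurable_fun setT g ->
    measurable_fun setT (fun t => f t + g t) by exact: measurable_funD.
have QM (f g : T -> R) : measurable_fun setT f -> measurable_fun setT g ->
    measurable_fun setT (fun t => f t * g t) by exact: measurable_funM.
have mb (f : V -> V -> R) (X1 Y1 : T -> V) : mvec X1 -> mvec Y1 ->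
    (forall y, rlin (f^~ y)) -> (forall x, rlin (f x)) ->
    measurable_fun setT (fun t => f (X1 t) (Y1 t)).
  by move=> m1 m2 f1 f2; apply: (rbil_class Qc QD QM) => // j;
    [exact: (m1 j).1|exact: (m1 j).2|exact: (m2 j).1|exact: (m2 j).2].
have cb (f : V -> V -> C) (X1 Y1 : T -> V) : mvec X1 -> mvec Y1 ->
    (forall x x' y, f (x + x') y = f x y + f x' y) ->
    (forall x y y', f x (y + y') = f x y + f x y') ->
    (forall (t : R) x y, f (t%:C *: x) y = t%:C * f x y) ->
    (forall (t : R) x y, f x (t%:C *: y) = t%:C * f x y) ->
    cmeas (fun t => f (X1 t) (Y1 t)).
  move=> m1 m2 f1 f2 f3 f4; split.
    apply: (mb (fun x y => complex.Re (f x y))) => // x; split=> *;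
      by rewrite ?f1 ?f2 ?f3 ?f4 ?ReD ?ReZ.
  have ImZ (t : R) (Z : C) : complex.Im (t%:C * Z) = t * complex.Im Z.
    by case: Z => ? ? /=; ring.
  apply: (mb (fun x y => complex.Im (f x y))) => // x; split=> *;
    by rewrite ?f1 ?f2 ?f3 ?f4 ?ImD ?ImZ.
rewrite (_ : (fun t => _) = fun t => ph1 P (X t) (X t) + phm P (X t) (Y t) + ph0 P (Y t) (Y t)); last first.
  by apply/funext => t; exact: phE.
apply: cmeasD; first apply: cmeasD; apply: cb => //.
- exact: ph1D.
- by move=> x y y'; rewrite !(ph1C P x) ph1D.
- by move=> t x y; exact: ph1Z.
- by move=> t x y; rewrite !(ph1C P x) ph1Z.
- exact: phmDl.
- exact: phmDr.
- by move=> t x y; exact: phmZl.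
- by move=> t x y; rewrite phmZr conjc_real.
- exact: ph0D.
- by move=> x y y'; rewrite !(ph0C P x) ph0D.
- by move=> t x y; rewrite ph0Z conjc_real.
- by move=> t x y; rewrite !(ph0C P x) ph0Z conjc_real.
Qed.

Section data.
Variables (b bt : V -> V -> R) (L : V -> V) (Psi : V -> V -> C) (c K m M : R).
Hypotheses (hb : rbil b) (hbt : rbil bt) (hL : vrlin L) (c0 : 0 < c).
Hypothesis bL : bilipschitz L m M.
Variable P : phase_parts Psi.
Hypothesis Qbound : forall z w,
  c * sqnorm (z - L w) <= bt z z + b w w - 2 * complex.Re (Psi z (conjv w))
    <= K * sqnorm (z - L w).

Definition kern z w : C := cexp (2 * Psi z (conjv w)).

Lemma normc_kern z w : normc (kern z w) <= expR (bt z z + b w w - c * sqnorm (z - L w)).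
Proof.
rewrite normc_cexp ler_expR -[2](rmorph_nat (real_complex R)) ReZ.
by have /andP[+ _] := Qbound z w; lra.
Qed.

Lemma mvec_vol : mvec (fun p : vspace R n => cvec p).
Proof. exact: (mvec_cvec (f := id) (@measurable_id _ (vspace R n) setT)). Qed.

Lemma mvec_cst d (T : measurableType d) x : mvec (fun _ : T => x).
Proof. by move=> j; split; exact: measurable_cst. Qed.

(** The Bergman form of the operator, without its scalar factor. *)
Definition transform (u : V -> C) z : C := Cintegral (vol R n) (fun p =>
  kern z (cvec p) * u (cvec p) * (expR (- (2 * b (cvec p) (cvec p))))%:C).

Variable u : V -> C.
Hypothesis hu : holomorphic u.
Let U z := normc (u z) * expR (- b z z).
Hypothesis sU : subgaussian U.

Let integrand w (p : vspace R n * vspace R n) : C :=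
  (kern (cvec p.1) w)^*%C * (expR (- (2 * bt (cvec p.1) (cvec p.1))))%:C *
  (kern (cvec p.1) (cvec p.2) * u (cvec p.2) * (expR (- (2 * b (cvec p.2) (cvec p.2))))%:C).

(** The factor in z - L w gives decay in z up to a constant depending on w; a
    small part of the factor in z - L w' turns decay in z into decay in w', so
    that the double integral converges absolutely. *)
Lemma integrand_bound w p : normc (integrand w p) <=
  expR (b w w + c * sqnorm (L w)) *
  (expR (- (3 * c / 8) * sqnorm (cvec p.1)) *
   (expR (- (c * m / 16) * sqnorm (cvec p.2)) * U (cvec p.2))).
Proof.
rewrite /integrand; set z := cvec p.1; set w' := cvec p.2.
have normE (k k' v : C) (s t : R) :
    normc (k^*%C * (expR s)%:C * (k' * v * (expR t)%:C))
    = normc k * expR s * (normc k' * normc v * expR t).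
  by rewrite !Normc.normcM normc_conj !normc_real !(ger0_norm (expR_ge0 _)).
rewrite normE /U.
have [m0 _ _ _ /(_ w')/andP[lm _]] := bL.
have h1 := sqnormD_le (z - L w) (L w); rewrite subrK in h1.
have h2 := sqnormB_le z (z - L w'); rewrite subKr in h2.
have A0 := sqnorm_ge0 (z - L w').
apply: le_trans (_ : expR (bt z z + b w w - c * sqnorm (z - L w)) * expR (- (2 * bt z z)) *
  (expR (bt z z + b w' w' - c * sqnorm (z - L w')) * normc (u w') * expR (- (2 * b w' w'))) <= _).
  apply: ler_pM; rewrite ?mulr_ge0 ?normc_ge0 ?expR_ge0//.
    by apply: ler_wpM2r; [exact: expR_ge0|exact: normc_kern].
  apply: ler_wpM2r; first exact: expR_ge0.
  by apply: ler_wpM2r; [exact: normc_ge0|exact: normc_kern].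
rewrite [leLHS](_ : _ = normc (u w') * expR (bt z z + b w w - c * sqnorm (z - L w)
  - 2 * bt z z + (bt z z + b w' w' - c * sqnorm (z - L w')) - 2 * b w' w')); last first.
  by rewrite !expRD; ring.
rewrite [leRHS](_ : _ = normc (u w') * expR (b w w + c * sqnorm (L w)
  + - (3 * c / 8) * sqnorm z + - (c * m / 16) * sqnorm w' - b w' w')); last first.
  by rewrite !expRD; ring.
apply: ler_wpM2l; first exact: normc_ge0.
rewrite ler_expR.
have {h1} : c * sqnorm z <= c * (2 * sqnorm (z - L w) + 2 * sqnorm (L w)) by rewrite ler_pM2l.
have : c * (m * sqnorm w') <= c * (2 * sqnorm z + 2 * sqnorm (z - L w')).
  by rewrite ler_pM2l//; exact: le_trans lm _.
have : 0 <= c * sqnorm (z - L w') by rewrite mulr_ge0// ltW.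
lra.
Qed.

Lemma cmeas_integrand w : cmeas (integrand w).
Proof.
have m1 : mvec (fun p : vspace R n * vspace R n => cvec p.1).
  by apply: (mvec_cvec (f := fst)); exact: measurable_fst.
have m2 : mvec (fun p : vspace R n * vspace R n => cvec p.2).
  by apply: (mvec_cvec (f := snd)); exact: measurable_snd.
have mexp (q : V -> V -> R) (X : vspace R n * vspace R n -> V) : rbil q -> mvec X ->
    cmeas (fun p => (expR (- (2 * q (X p) (X p))))%:C).
  move=> hq mX; apply: cmeas_real; apply: (measurableT_comp (f := @expR R)) => //.
  apply: measurable_funN; apply: measurable_funM => //.
  by have [] := measurable_form hq 0 mX.
have cu := cmeas_vol (holomorphic_continuous hu).
apply: cmeasM; first apply: cmeasM.
- by apply: cmeas_conj; apply: cmeas_cexp; apply: cmeas_phase => //; exact: mvec_cst.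
- exact: mexp.
apply: cmeasM; last exact: mexp.
apply: cmeasM; first by apply: cmeas_cexp; exact: cmeas_phase.
split; first exact: (measurableT_comp cu.1 measurable_snd).
exact: (measurableT_comp cu.2 measurable_snd).
Qed.

Lemma cmeas_section1 d1 d2 (T1 : measurableType d1) (T2 : measurableType d2)
  (f : T1 * T2 -> C) (x : T1) : cmeas f -> cmeas (fun y : T2 => f (x, y)).
Proof.
by move=> [f1 f2]; split; [exact: measurableT_comp f1 (pair1_measurable x)|exact: measurableT_comp f2 (pair1_measurable x)].
Qed.

Lemma cmeas_section2 d1 d2 (T1 : measurableType d1) (T2 : measurableType d2)
  (f : T1 * T2 -> C) (y : T2) : cmeas f -> cmeas (fun x : T1 => f (x, y)).
Proof.
by move=> [f1 f2]; split; [exact: measurableT_comp f1 (pair2_measurable y)|exact: measurableT_comp f2 (pair2_measurable y)].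
Qed.

Lemma cm_gt0 : 0 < 3 * c / 8 /\ 0 < c * m / 16.
Proof. by case: bL => m0 *; split; rewrite divr_gt0// mulr_gt0. Qed.

Lemma cinteg_integrand w : cinteg (prodm (vol R n) (vol R n)) (integrand w).
Proof.
have [e1 e2] := cm_gt0.
apply: cinteg_le (cmeas_integrand w) (integrand_bound w) _.
by apply: integZ; apply: (integ_prodm (gaussian_integ n e1) (sU e2)).
Qed.

Lemma cinteg_integrand1 w p : cinteg (vol R n) (fun p' => integrand w (p, p')).
Proof.
have [e1 e2] := cm_gt0.
apply: cinteg_le (cmeas_section1 _ (cmeas_integrand w)) _ _; first by move=> p'; exact: integrand_bound.
by apply: integZ => /=; apply: integZ; exact: (sU e2).
Qed.

Lemma cinteg_integrand2 w p' : cinteg (vol R n) (fun p => integrand w (p, p')).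
Proof.
have [e1 e2] := cm_gt0.
apply: cinteg_le (cmeas_section2 _ (cmeas_integrand w)) _ _; first by move=> p; exact: integrand_bound.
apply: integZ => /=.
have := integZ (expR (- (c * m / 16) * sqnorm (cvec p')) * U (cvec p')) (gaussian_integ n e1).
by congr (integ _ _); apply/funext => p; rewrite mulrC.
Qed.

Lemma cmeas_gauss q : rbil q ->
  cmeas (fun p : vspace R n => (expR (- (2 * q (cvec p) (cvec p))))%:C).
Proof.
move=> hq; apply: cmeas_real; apply: (measurableT_comp (f := @expR R)) => //.
apply: measurable_funN; apply: measurable_funM => //.
by have [] := measurable_form hq 0 mvec_vol.
Qed.

Lemma cmeas_transform z : cmeas (fun p : vspace R n =>
  kern z (cvec p) * u (cvec p) * (expR (- (2 * b (cvec p) (cvec p))))%:C).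
Proof.
apply: cmeasM; last exact: cmeas_gauss.
apply: cmeasM; last exact: cmeas_vol (holomorphic_continuous hu).
by apply: cmeas_cexp; apply: (cmeas_phase P); [exact: mvec_cst|exact: mvec_vol].
Qed.

Lemma transform_integrand_bound z w :
  normc (kern z w * u w * (expR (- (2 * b w w)))%:C)
  <= expR (bt z z) * (expR (- c * sqnorm (z - L w)) * U w).
Proof.
rewrite (Normc.normcM (kern z w * u w)) (Normc.normcM (kern z w)).
rewrite normc_real ger0_norm ?expR_ge0//.
apply: le_trans (_ : expR (bt z z + b w w - c * sqnorm (z - L w)) * normc (u w) *
  expR (- (2 * b w w)) <= _).
  apply: ler_wpM2r; first exact: expR_ge0.
  by apply: ler_wpM2r; [exact: normc_ge0|exact: (normc_kern z w)].
rewrite [leLHS](_ : _ = normc (u w) *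
  expR (bt z z + b w w - c * sqnorm (z - L w) - 2 * b w w)); last first.
  by rewrite !expRD; ring.
rewrite [leRHS](_ : _ = normc (u w) *
  expR (bt z z + - c * sqnorm (z - L w) - b w w)); last first.
  by rewrite !expRD /U; ring.
by apply: ler_wpM2l; [exact: normc_ge0|rewrite ler_expR; lra].
Qed.

Lemma cinteg_transform z : cinteg (vol R n) (fun p =>
  kern z (cvec p) * u (cvec p) * (expR (- (2 * b (cvec p) (cvec p))))%:C).
Proof.
have [m0 _ _ _ bLL] := bL.
have cm0 : 0 < c * m / 2 by rewrite divr_gt0// mulr_gt0.
apply: cinteg_le (cmeas_transform z) _ (integZ (expR (bt z z + c * sqnorm z)) (sU cm0)) => p.
set w := cvec p; apply: le_trans (transform_integrand_bound z w) _.
rewrite mulrA [leRHS]mulrA; apply: ler_wpM2r.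
  by rewrite mulr_ge0 ?normc_ge0 ?expR_ge0.
rewrite -!expRD ler_expR; have /andP[lm _] := bLL w.
have h := sqnormB_le z (z - L w); rewrite subKr in h.
have : c * (m * sqnorm w) <= c * (2 * sqnorm z + 2 * sqnorm (z - L w)).
  by rewrite ler_pM2l//; exact: le_trans lm _.
lra.
Qed.

(** The kernel of the inverse transform is concentrated along the same graph,
    with the roles of the weights exchanged. *)
Lemma inverse_kernel_bound z w (s : C) :
  normc ((kern z w)^*%C * (expR (- (2 * bt z z)))%:C * s)
  <= expR (b w w) * (expR (- c * sqnorm (z - L w)) * (normc s * expR (- bt z z))).
Proof.
rewrite (Normc.normcM (_ * _)) (Normc.normcM (kern z w)^*%C) normc_conj normc_real.
rewrite ger0_norm ?expR_ge0//.
apply: le_trans (_ : expR (bt z z + b w w - c * sqnorm (z - L w)) *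
  expR (- (2 * bt z z)) * normc s <= _).
  apply: ler_wpM2r; first exact: normc_ge0.
  by apply: ler_wpM2r; [exact: expR_ge0|exact: (normc_kern z w)].
rewrite -expRD mulrC.
rewrite [leRHS](_ : _ = normc s *
  expR (b w w + - c * sqnorm (z - L w) - bt z z)); last first.
  by rewrite !expRD; ring.
by apply: ler_wpM2l; [exact: normc_ge0|rewrite ler_expR; lra].
Qed.

Lemma cmeas_inverse_kernel w : cmeas (fun p : vspace R n =>
  (kern (cvec p) w)^*%C * (expR (- (2 * bt (cvec p) (cvec p))))%:C).
Proof.
apply: cmeasM; last exact: cmeas_gauss.
by apply: cmeas_conj; apply: cmeas_cexp; apply: (cmeas_phase P);
  [exact: mvec_vol|exact: mvec_cst].
Qed.

Lemma cinteg_inner w w' : cinteg (vol R n) (fun p =>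
  (kern (cvec p) w)^*%C * (expR (- (2 * bt (cvec p) (cvec p))))%:C * kern (cvec p) w').
Proof.
have c2 : 0 < c / 2 by rewrite divr_gt0.
apply: cinteg_le (integZ (expR (b w w + c * sqnorm (L w) + b w' w')) (gaussian_integ n c2)).
  apply: cmeasM; first exact: cmeas_inverse_kernel.
  by apply: cmeas_cexp; apply: (cmeas_phase P); [exact: mvec_vol|exact: mvec_cst].
move=> p; set z := cvec p; apply: le_trans (inverse_kernel_bound z w _) _.
apply: le_trans (_ : expR (b w w) * (expR (- c * sqnorm (z - L w)) *
  (expR (bt z z + b w' w' - c * sqnorm (z - L w')) * expR (- bt z z))) <= _).
  apply: ler_wpM2l; first exact: expR_ge0.
  apply: ler_wpM2l; first exact: expR_ge0.
  by apply: ler_wpM2r; [exact: expR_ge0|exact: (normc_kern z w')].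
rewrite -!expRD ler_expR.
have h := sqnormD_le (z - L w) (L w); rewrite subrK in h.
have : c * sqnorm z <= c * (2 * sqnorm (z - L w) + 2 * sqnorm (L w)) by rewrite ler_pM2l.
have : 0 <= c * sqnorm (z - L w') by rewrite mulr_ge0 ?sqnorm_ge0// ltW.
lra.
Qed.

Lemma inner_gaussian w w' : Cintegral (vol R n) (fun p =>
    (kern (cvec p) w)^*%C * (expR (- (2 * bt (cvec p) (cvec p))))%:C * kern (cvec p) w')
  = cexp (2 * pol b w w') * (gauss_mass (bq bt P))%:C.
Proof.
have hq := rbil_bq hbt P; have qc := bq_pos hb hL P Qbound.
pose A := 2^-1%:C *: (w + w'); pose B := 2^-1%:C *: ('i%C *: (w' - w)).
pose k := (ph0 P w w)^*%C + ph0 P w' w'.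
transitivity (Cintegral (vol R n) (fun p => cexp k *
   cexp ((- 2 * bq bt P (cvec p) (cvec p) + 4 * bq bt P (cvec p) (L A))
       +i* (4 * bq bt P (cvec p) (L B))))).
  apply: eq_Cintegral => p; rewrite /kern -cexp_conj -cexp_real -!cexpD; congr cexp.
  rewrite addrAC rmorphN /= (phase_product hb hbt hL c0 P Qbound) /k addrC.
  by [].
rewrite CintegralZ; last exact: (cinteg_form_phase hq c0 qc).
rewrite (gauss_complex hq c0 qc) mulrA -cexpD; congr (cexp _ * _).
by rewrite addrC /k (completed_square hb hbt hL c0 P Qbound).
Qed.

(** Fubini, the Gaussian integral over z, and the reproducing property. *)
Lemma transform_inversion w : Cintegral (vol R n) (fun p =>
    (kern (cvec p) w)^*%C * (expR (- (2 * bt (cvec p) (cvec p))))%:C * transform u (cvec p))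
  = (gauss_mass (bq bt P) * rot_mass b)%:C * u w.
Proof.
have [m0 _ _ _ bLL] := bL.
have hpos := weight_pos hb hbt hL c0 P Qbound m0 (fun w => (andP (bLL w)).1).
have cm0 : 0 < c * m by rewrite mulr_gt0.
transitivity (Cintegral (prodm (vol R n) (vol R n)) (integrand w)).
  rewrite Cintegral_prodm12; [|exact: cinteg_integrand|exact: cinteg_integrand1].
  by apply: eq_Cintegral => p; rewrite /transform -CintegralZ//; exact: cinteg_transform.
rewrite Cintegral_prodm21; [|exact: cinteg_integrand|exact: cinteg_integrand2].
transitivity (Cintegral (vol R n) (fun p => (gauss_mass (bq bt P))%:C *
   (cexp (2 * pol b w (cvec p) - (2 * b (cvec p) (cvec p))%:C) * u (cvec p)))).
  apply: eq_Cintegral => p'; set w' := cvec p'.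
  transitivity (Cintegral (vol R n) (fun p => (u w' * (expR (- (2 * b w' w')))%:C) *
    ((kern (cvec p) w)^*%C * (expR (- (2 * bt (cvec p) (cvec p))))%:C * kern (cvec p) w'))).
    by apply: eq_Cintegral => p; rewrite /integrand /= -/w'; ring.
  rewrite CintegralZ; last exact: cinteg_inner.
  by rewrite inner_gaussian cexpD -rmorphN cexp_real; ring.
rewrite CintegralZ; last exact: (cinteg_reproducing hb cm0 hpos w (holomorphic_continuous hu) sU).
by rewrite (bergman_reproducing hb cm0 hpos w hu sU) mulrA -rmorphM.
Qed.

End data.
End Inversion.


(** * Decay of transforms in cones *)

Section WaveFront.
Variable R : realType.
Local Notation C := R[i].
Local Notation normc := (@Normc.normc R).
Variable n : nat.
Local Notation V := 'rV[C]_n.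
Implicit Types (x y z w v : V) (b : V -> V -> R) (U : V -> R).

(** U is bounded by a decaying Gaussian in some cone about z0: the complement of
    the wavefront set, with the weight absorbed into U (WF_decays). *)
Definition decays U z0 := exists W : set V,
  [/\ open W, conic W, ~ W 0, W z0 & exists K c : R,
    [/\ 0 < K, 0 < c & forall z, W z -> U z <= K * expR (- c * sqnorm z)]].

Lemma WF_decays (Phi : V -> R) u z0 :
  WF Phi u z0 <-> z0 != 0 /\ ~ decays (fun z => normc (u z) * expR (- Phi z)) z0.
Proof.
split=> -[z00 H]; split=> // -[W [oW cW W0 Wz [K [c [K0 c0 HK]]]]]; apply: H;
  exists W; split=> //; exists K, c; split=> // z /HK.
  rewrite expRN ler_pdivrMr ?expR_gt0// -mulrA -expRD => /le_trans; apply.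
  by rewrite ler_pM2l// ler_expR; lra.
by rewrite expRN ler_pdivrMr ?expR_gt0// -mulrA -expRD mulNr [- _ + _]addrC.
Qed.

Lemma decays_le U U' (A : R) z0 : 0 < A -> (forall z, U z <= A * U' z) ->
  decays U' z0 -> decays U z0.
Proof.
move=> A0 UU' [W [oW cW W0 Wz [K [c [K0 c0 HK]]]]]; exists W; split=> //.
exists (A * K), c; split=> //; first exact: mulr_gt0.
move=> z /HK h; apply: le_trans (UU' z) _.
by rewrite -mulrA ler_pM2l.
Qed.

Definition cone_lt b (eta : R) : set V := [set z | b z z < eta * sqnorm z].

Lemma cone_lt_open b eta : rbil b -> open (cone_lt b eta).
Proof.
move=> hb; have [c1 c2 c3] := continuous_class R V.
have -> : cone_lt b eta = (fun z => b z z + (- eta) * sqnorm z) @^-1` [set x | x < 0].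
  by apply/seteqP; split=> z /=; rewrite /cone_lt/= mulNr subr_lt0.
apply: open_comp; last exact: open_lt.
move=> z _; apply: c2; first exact: continuous_rbil.
by apply: c3; [exact: c1|exact: continuous_sqnorm].
Qed.

Lemma cone_lt_conic b eta : rbil b -> conic (cone_lt b eta).
Proof.
move=> hb t z t0; rewrite /cone_lt/= => h.
rewrite (hb.1 _).2 (rbilr _ hb).2 sqnormZ normc_real real_normK ?num_real//.
by rewrite mulrA -expr2 mulrCA ltr_pM2l// exprn_gt0.
Qed.

Lemma rbilBr b b' : rbil b -> rbil b' -> rbil (fun x y => b x y - b' x y).
Proof.
move=> [b1 bC] [b1' bC']; split=> [y|x y]; last by rewrite bC bC'.
split=> [x x'|t x]; first by rewrite (b1 _).1 (b1' _).1; lra.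
by rewrite (b1 _).2 (b1' _).2; lra.
Qed.

(** A Gaussian factor that grows slower than U decays, in a cone around a zero
    of the exponent, costs only part of the decay. *)
Lemma decays_null b U z0 : rbil b -> b z0 z0 = 0 -> z0 != 0 ->
  (forall z, 0 <= U z) -> decays U z0 -> decays (fun z => expR (b z z) * U z) z0.
Proof.
move=> hb bz z00 U0 [W [oW cW W0 Wz [K [c [K0 c0 HK]]]]].
exists (W `&` cone_lt b (c / 2)); split.
- by apply: openI => //; exact: cone_lt_open.
- by move=> t z t0 [h1 h2]; split; [exact: cW|exact: cone_lt_conic].
- by case.
- by split=> //; rewrite /cone_lt/= bz mulr_gt0 ?sqnorm_gt0// divr_gt0.
exists K, (c / 2); split=> //; first exact: divr_gt0.
move=> z [/HK h1 h2].
apply: le_trans (ler_wpM2l (expR_ge0 _) h1) _.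
rewrite mulrCA ler_pM2l// -expRD ler_expR; move: h2; rewrite /cone_lt/=; lra.
Qed.

(** A function of subgaussian growth decays once multiplied by a Gaussian that
    is decaying in the direction considered. *)
Lemma decays_gap b U z0 : rbil b -> b z0 z0 < 0 -> z0 != 0 ->
  (forall eps, 0 < eps -> exists2 K, 0 < K & forall z, U z <= K * expR (eps * sqnorm z)) ->
  decays (fun z => expR (b z z) * U z) z0.
Proof.
move=> hb bz z00 HU; have q0 : 0 < sqnorm z0 by rewrite sqnorm_gt0.
(* On this cone the Gaussian uses half of its value at z0, and U a quarter. *)
pose eta := - b z0 z0 / (2 * sqnorm z0).
have eta0 : 0 < eta by rewrite divr_gt0 ?oppr_gt0 ?mulr_gt0.
have [|K K0 HK] := HU (eta / 2); first exact: divr_gt0.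
exists (cone_lt b (- eta)); split.
- exact: cone_lt_open.
- exact: cone_lt_conic.
- by rewrite /cone_lt/= sqnorm0 mulr0 (rlin0 (hb.1 _)) ltxx.
- rewrite /cone_lt/= [ltRHS](_ : _ = b z0 z0 / 2); first lra.
  by rewrite /eta; field; rewrite gt_eqF.
exists K, (eta / 2); split=> //; first exact: divr_gt0.
move=> z; rewrite /cone_lt/= => h.
apply: le_trans (ler_wpM2l (expR_ge0 _) (HK z)) _.
by rewrite mulrCA ler_pM2l// -expRD ler_expR; lra.
Qed.

Section data.
Variables (b bt : V -> V -> R) (L L' : V -> V) (Psi : V -> V -> C) (c K : R).
Hypotheses (hb : rbil b) (hbt : rbil bt) (hL : vrlin L) (c0 : 0 < c).
Hypotheses (LK : cancel L L') (L'K : cancel L' L).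
Hypothesis hPsi : hol_quadratic2 Psi.
Hypothesis Qbound : forall z w,
  c * sqnorm (z - L w) <= bt z z + b w w - 2 * complex.Re (Psi z (conjv w))
    <= K * sqnorm (z - L w).

Variable u : V -> C.
Hypothesis hu : holomorphic u.
Let U w := normc (u w) * expR (- b w w).
Hypothesis sU : subgaussian U.
Let T := transform b Psi u.
Let U' z := normc (T z) * expR (- bt z z).

Let U0 w : 0 <= U w.
Proof. by rewrite /U mulr_ge0 ?normc_ge0 ?expR_ge0. Qed.

Let weightK (z : V) (B : R) : normc (T z) <= expR (bt z z) * B -> U' z <= B.
Proof. by move=> h; rewrite /U' expRN ler_pdivrMr ?expR_gt0// mulrC. Qed.

Lemma transform_growth eps : 0 < eps -> exists2 K', 0 < K' &
  forall z, U' z <= K' * expR (eps * sqnorm z).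
Proof.
move=> e0; have [m [M bL]] := vrlin_bilipschitz hL LK L'K.
have [P] := hol_quadratic2_parts hPsi.
have [K' K'0 H] := kernel_subgaussian_bound bL U0 sU c0 e0.
exists K' => // z; apply: weightK.
apply: (H z (expR (bt z z)) (fun w => kern Psi z w * u w * (expR (- (2 * b w w)))%:C)); first exact: expR_ge0.
  exact: (cmeas_transform hb P hu).
by move=> w; exact: (transform_integrand_bound Qbound).
Qed.

Lemma transform_decays w0 : w0 != 0 -> decays U w0 -> decays U' (L w0).
Proof.
move=> w00 [W [oW cW W0 Ww [K0 [d [K00 d0 HU]]]]].
have [m [M bL]] := vrlin_bilipschitz hL LK L'K.
have [P] := hol_quadratic2_parts hPsi.
have [W' [oW' cW' W'0 W'w [K' [c' [K'0 c'0 H]]]]] :=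
  kernel_cone_decay bL oW cW Ww w00 U0 sU c0 K00 d0 HU.
exists W'; split=> //; exists K', c'; split=> // z zW'; apply: weightK.
apply: (H z (expR (bt z z)) (fun w => kern Psi z w * u w * (expR (- (2 * b w w)))%:C)) => //.
  exact: (cmeas_transform hb P hu).
by move=> w; exact: (transform_integrand_bound Qbound).
Qed.

(** The transform satisfies the growth condition required of a function to
    which the inverse kernel is applied. *)
Lemma transform_subgaussian : continuous T -> subgaussian U'.
Proof.
move=> cT eps e0; have e2 : 0 < eps / 2 by rewrite divr_gt0.
have [K' K'0 H] := transform_growth e2.
have [c1 c2 c3] := continuous_class R V.
apply: integ_le (integZ K' (gaussian_integ n e2)).
  apply: (measurable_vol (f := fun z => expR (- eps * sqnorm z) * U' z)).
  apply: (c3 (fun z => expR (- eps * sqnorm z)) U').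
    by apply: continuous_expR_comp; apply: c3; [exact: c1|exact: continuous_sqnorm].
  apply: (c3 (fun z => normc (T z)) (fun z => expR (- bt z z))).
    exact: continuous_normc.
  apply: continuous_expR_comp.
  rewrite (_ : (fun z => _) = fun z => (-1) * bt z z).
    by apply: c3; [exact: c1|exact: continuous_rbil].
  by apply/funext => z; rewrite mulN1r.
move=> p; set z := cvec p; rewrite ger0_norm ?mulr_ge0 ?normc_ge0 ?expR_ge0//.
apply: le_trans (ler_wpM2l (expR_ge0 _) (H z)) _.
by rewrite mulrCA ler_pM2l// -expRD ler_expR; lra.
Qed.

(** The inverse kernel at (z, w) decays in |z - L w|, hence in |w - L' z|. *)
Lemma transform_decays_inv w0 : continuous T -> w0 != 0 -> decays U' (L w0) -> decays U w0.
Proof.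
move=> cT w00 [W [oW cW W0 Ww [K0 [d [K00 d0 HU']]]]].
have [m [M bL]] := vrlin_bilipschitz hL LK L'K.
have [m' [M' bL']] := vrlin_bilipschitz (vrlin_cancel hL LK L'K) L'K LK.
have [P] := hol_quadratic2_parts hPsi.
have [m0 _ LB _ bLL] := bL.
have cm0 : 0 < c * m by rewrite mulr_gt0.
have U'0 z : 0 <= U' z by rewrite /U' mulr_ge0 ?normc_ge0 ?expR_ge0.
have [W' [oW' cW' W'0 W'w [K' [c' [K'0 c'0 H]]]]] :=
  kernel_cone_decay bL' oW cW Ww (bilipschitz0 bL w00) U'0 (transform_subgaussian cT)
    cm0 K00 d0 HU'.
rewrite LK in W'w.
pose mass := gauss_mass (bq bt P) * rot_mass b.
have mass0 : 0 < mass.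
  rewrite mulr_gt0//; first exact: (gauss_mass_gt0 (rbil_bq hbt P) c0 (bq_pos hb hL P Qbound)).
  exact: (rot_mass_gt0 hb cm0 (weight_pos hb hbt hL c0 P Qbound m0 (fun w => (andP (bLL w)).1))).
exists W'; split=> //; exists (mass^-1 * K'), c'; split=> //.
  by rewrite mulr_gt0// invr_gt0.
move=> w wW'.
have : normc (mass%:C * u w) <= expR (b w w) * (K' * expR (- c' * sqnorm w)).
  rewrite -(transform_inversion hb hbt hL c0 bL P Qbound hu sU).
  apply: (H w (expR (b w w)) (fun z => (kern Psi z w)^*%C * (expR (- (2 * bt z z)))%:C * T z)) => //.
  - by apply: cmeasM; [exact: (cmeas_inverse_kernel hbt P)|exact: cmeas_vol].
  move=> z; apply: le_trans (inverse_kernel_bound Qbound z w (T z)) _.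
  apply: ler_wpM2l; first exact: expR_ge0.
  apply: ler_wpM2r; first exact: U'0.
  rewrite ler_expR !mulNr lerN2 -mulrA ler_pM2l//.
  have /andP[+ _] := bLL (w - L' z); rewrite LB L'K => h.
  by rewrite -[sqnorm (L w - z)]sqnormN opprB in h.
rewrite Normc.normcM normc_real gtr0_norm// /U expRN => h.
rewrite ler_pdivrMr ?expR_gt0// -!mulrA ler_pdivlMl//.
by rewrite [leRHS]mulrA [leRHS]mulrC.
Qed.

End data.
End WaveFront.


(** * The theorem *)

Local Close Scope complex_scope.

Theorem theorem5p1 (R : realType) (n : nat) (Phi Phit : 'rV[R[i]]_n -> R)
  (kappa : {linear ('rV[R[i]]_n * 'rV[R[i]]_n)%type ->
                   ('rV[R[i]]_n * 'rV[R[i]]_n)%type})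
  (G : ('rV[R[i]]_n -> R[i]) -> ('rV[R[i]]_n -> R[i])) :
  strictly_psh Phi ->
  canonical_transformation kappa ->
  positive_rel Phi kappa ->
  strictly_psh Phit ->
  kappa @` Lambda Phi = Lambda Phit ->
  metaplectic_FIO Phit Phi kappa G ->
  (forall u, Hinf Phi u ->
     WF Phi (G u) `<=`
       (kappa_flat Phi kappa @` WF Phi u) `&` radical (fun z => Phi z - Phit z))
  /\
  ((exists2 u, Hinf Phi u & G u <> (fun=> 0)) ->
   kappa @` (Lambda Phi `&` Lambda Phit) = Lambda Phi `&` Lambda Phit ->
   forall u, Hinf Phi u ->
     WF Phi (G u) =
       (kappa_flat Phi kappa @` WF Phi u) `&` radical (fun z => Phi z - Phit z)).
Proof.
move=> pPhi canon pos pPhit kL [_ [a [Psi [Psi2 [[hPsi _] _ _ [c [K [c0 K0 Q]]] GE]]]] [GH _ _]].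
have le := positive_le pPhi pPhit.1 pos kL.
have [b hb PhiE] := real_quadratic_rbil pPhi.1.
have [bt hbt PhitE] := real_quadratic_rbil pPhit.1.
have hL := kappa_flat_vrlin kappa pPhi.1.
have [L' [LK L'K]] := kappa_flat_cancel canon kL.
set L := kappa_flat Phi kappa in hL LK L'K Q *.
have Qb z w : c * sqnorm (z - L w) <= bt z z + b w w - 2 * complex.Re (Psi z (conjv w))
    <= K * sqnorm (z - L w) by rewrite -PhiE -PhitE; exact: Q.
have GT u : Hinf Phi u -> forall z, G u z = a * transform b Psi u z.
  move=> uH z; rewrite (GE _ uH z); congr (a * _); rewrite /transform.
  by congr (Cintegral _ _); apply/funext => p; rewrite /= PhiE.
have hol u : Hinf Phi u -> holomorphic u by move=> [s []].
have sub u : Hinf Phi u -> subgaussian (fun w => Normc.normc (u w) * expR (- b w w)).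
  move=> uH; rewrite (_ : (fun w => _) = fun w => Normc.normc (u w) * expR (- Phi w)).
    exact: subgaussian_Hinf pPhi.1 uH.
  by apply/funext => w; rewrite PhiE.
pose T u z := Normc.normc (transform b Psi u z) * expR (- bt z z).
have T0 u z : 0 <= T u z by rewrite mulr_ge0 ?normc_ge0 ?expR_ge0.
have GTE u z : Hinf Phi u -> Normc.normc (G u z) * expR (- Phi z)
    = Normc.normc a * (expR (bt z z - b z z) * T u z).
  move=> uH; rewrite GT// Normc.normcM PhiE /T -mulrA; congr (_ * _).
  by rewrite mulrCA -expRD; congr (_ * expR _); lra.
have gap z : bt z z - b z z <= 0 by rewrite -PhiE -PhitE subr_le0.
have a1 : 0 < Normc.normc a + 1 by rewrite ltr_wpDl// normc_ge0.
have sup u : Hinf Phi u ->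
     WF Phi (G u) `<=` (L @` WF Phi u) `&` radical (fun z => Phi z - Phit z).
  move=> uH z0 /WF_decays[z00 nd]; split.
    have Lw : L (L' z0) = z0 by exact: L'K.
    exists (L' z0) => //; apply: contrapT => nWF; apply: nd.
    have w00 : L' z0 != 0.
      apply: contraNneq z00 => w0; rewrite -Lw w0.
      by have := vrlinB 0 0 hL; rewrite !subrr => ->.
    have : decays (fun w => Normc.normc (u w) * expR (- Phi w)) (L' z0).
      by apply: contrapT => nd; apply: nWF; apply/WF_decays.
    rewrite (_ : (fun w => _ * expR (- Phi w)) = fun w => Normc.normc (u w) * expR (- b w w)); last first.
      by apply/funext => w; rewrite PhiE.
    move=> /(transform_decays hb hL c0 LK L'K hPsi Qb (hol _ uH) (sub _ uH) w00).
    rewrite Lw; apply: decays_le a1 _ => z; rewrite GTE// -/(T u z).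
    have h1 : expR (bt z z - b z z) * T u z <= T u z.
      by rewrite ler_piMl// -expR0 ler_expR.
    have := ler_wpM2l (normc_ge0 a) h1; have := T0 u z; lra.
  apply: contrapT => nrad; apply: nd.
  have bz : bt z0 z0 - b z0 z0 < 0.
    rewrite lt_neqAle gap andbT; apply/eqP => bz; apply: nrad.
    by rewrite /radical/= PhiE PhitE -opprB bz oppr0.
  have := decays_gap (rbilBr hbt hb) bz z00
    (transform_growth hb hL c0 LK L'K hPsi Qb (hol _ uH) (sub _ uH)).
  apply: decays_le a1 _ => z; rewrite GTE// -/(T u z).
  apply: ler_wpM2r; first by rewrite mulr_ge0 ?expR_ge0.
  by rewrite lerDl.
split=> // -[u1 u1H Gu1] _ u uH; apply/seteqP; split; first exact: sup.
have a0 : a != 0.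
  apply/eqP => a0; apply: Gu1; apply/funext => z.
  by rewrite GT// a0 mul0r.
have na0 : 0 < Normc.normc a.
  rewrite lt_neqAle normc_ge0 andbT eq_sym; apply: contra a0 => /eqP/Normc.eq0_normc ->//.
move=> _ [[w0 /WF_decays[w00 nd] <-] rad]; apply/WF_decays.
have [m [M bL]] := vrlin_bilipschitz hL LK L'K.
have z00 := bilipschitz0 bL w00.
split=> // d; apply: nd.
have cT : continuous (transform b Psi u).
  rewrite (_ : transform b Psi u = fun z => a^-1 * G u z).
    apply: holomorphic_continuous => z; have := hol _ (GH _ uH) z.
    exact: (@differentiableZ _ _ R[i]^o (G u) a^-1 z).
  by apply/funext => z; rewrite GT// mulKf.
rewrite (_ : (fun w => _ * expR (- Phi w)) = fun w => Normc.normc (u w) * expR (- b w w)); last first.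
  by apply/funext => w; rewrite PhiE.
apply: (transform_decays_inv hb hbt hL c0 LK L'K hPsi Qb (hol _ uH) (sub _ uH) cT w00).
have bz : b (L w0) (L w0) - bt (L w0) (L w0) = 0 by rewrite -PhiE -PhitE.
have dpos z : 0 <= Normc.normc (G u z) * expR (- Phi z) by rewrite mulr_ge0 ?normc_ge0 ?expR_ge0.
have := decays_null (rbilBr hb hbt) bz z00 dpos d.
apply: decays_le (_ : 0 < (Normc.normc a)^-1) _; first by rewrite invr_gt0.
move=> z; rewrite GTE// ler_pdivlMl// [leRHS]mulrCA ler_pM2l// [leRHS]mulrA -expRD.
by rewrite (_ : _ + _ = 0) ?expR0 ?mul1r//; lra.
Qed.
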